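(* Let $G$ be a compactly generated locally compact group of polynomial growth, let $1<p<\infty$, and let $\omega$ be a continuous weight on $G$ such that $(G,\omega)$ satisfies (LPAlg). Assume that $\omega$ is polynomial in the sense of Pytlik, i.e. that there is a constant $C>0$ with $$\omega(xy)\le C\big(\omega(x)+\omega(y)\big)\qquad\text{for all } x,y\in G.$$ Then $L^p(G,\omega)$ is a symmetric Banach $*$-algebra.
   Context: $G$ is of polynomial growth if there are a relatively compact neighbourhood $U$ of the identity with $G=\bigcup_n U^n$ and constants $C_0,Q$ with $|U^n|\le C_0n^Q$ for all $n\ge 1$, where $|\cdot|$ is Haar measure. Let $\frac1p+\frac1q=1$. $(G,\omega)$ satisfies (LPAlg) if $\omega:G\to[1,+\infty[$ is measurable and $\omega(xy)\le\omega(x)\omega(y)$, $\omega(x^{-1})=\omega(x)$ for all $x,y\in G$, and $\omega^{-q}*\omega^{-q}\le\omega^{-q}$ pointwise. $L^p(G,\omega)$ is the space of measurable $f:G\to\mathbb{C}$ with $\|f\|_{p,\omega}=\big(\int_G|f(x)|^p\omega(x)^p\,dx\big)^{1/p}<\infty$; under (LPAlg) it is a Banach $*$-algebra for the convolution $(f*g)(x)=\int_G f(y)g(y^{-1}x)\,dy$ and the involution $f^*(x)=\overline{f(x^{-1})}$. A Banach $*$-algebra $\mathcal{A}$ is symmetric if $\sigma_{\mathcal{A}}(a^*a)\subset[0,+\infty[$ for all $a\in\mathcal{A}$, equivalently $\sigma_{\mathcal{A}}(a)\subset\mathbb{R}$ for all $a=a^*\in\mathcal{A}$. *)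

(* Defs.v *)
From HB Require Import structures.
From mathcomp Require Import all_boot all_order all_algebra complex.
From mathcomp Require Import all_classical all_reals all_analysis.

Set Implicit Arguments.
Unset Strict Implicit.
Unset Printing Implicit Defensive.

Import Order.TTheory GRing.Theory Num.Theory.
Import numFieldNormedType.Exports.

Local Open Scope classical_set_scope.
Local Open Scope ring_scope.
Local Open Scope complex_scope.

(* MathComp-Analysis only has topological groups in additive notation (and
   commutative).  The base point is irrelevant: it is there because the
   library defines generated sigma-algebras on pointed types only. *)
HB.mixin Record isTopologicalGroup G & PointedTopological G & Group G := {
  mulg_continuous : continuous (fun xy : G * G => (xy.1 * xy.2)%g) ;
  invg_continuous : continuous (fun x : G => (x^-1)%g)
}.

#[short(type="topologicalGroupType")]
HB.structure Definition TopologicalGroup :=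
  {G of PointedTopological G & Group G & isTopologicalGroup G}.

Definition borel (G : topologicalGroupType) := g_sigma_algebraType (@open G).

Definition locally_compact_group (G : topologicalGroupType) :=
  hausdorff_space G /\ locally_compact [set: G].

Section Groups.
Context {R : realType} {G : topologicalGroupType}.
Implicit Types (U K : set G).

Fixpoint set_expg U (n : nat) : set G :=
  if n is m.+1 then [set (x * y)%g | x in U & y in set_expg U m]
  else [set 1%g].

Definition compactly_generated := exists K, compact K /\
  \bigcup_n set_expg (K `|` [set (x^-1)%g | x in K]) n = [set: G].

Record left_haar (mu : {measure set (borel G) -> \bar R}) : Prop := {
  haar_neq0 : mu [set: G] <> 0%E ;
  haar_compact : forall K, compact K -> (mu K < +oo)%E ;
  haar_left : forall (x : G) (A : set (borel G)), measurable A ->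
    mu [set (x * y)%g | y in (A : set G)] = mu A ;
  haar_outer : forall A : set (borel G), measurable A ->
    mu A = ereal_inf [set mu U | U in [set U : set G | open U /\ A `<=` U]] ;
  haar_inner : forall U, open U ->
    mu U = ereal_sup [set mu K | K in [set K : set G | compact K /\ K `<=` U]]
}.

(* U, hence U^n, need not be a Borel set: |U^n| is its outer measure. *)
Definition polynomial_growth (mu : {measure set (borel G) -> \bar R}) :=
  exists (U : set G) (C0 Q : R),
    [/\ nbhs (1%g : G) U, precompact U,
        \bigcup_n set_expg U n = [set: G] &
        forall n : nat, (1 <= n)%N ->
          (mu_ext mu (set_expg U n) <= (C0 * n%:R `^ Q)%:E)%E].

Record LPAlg (mu : {measure set (borel G) -> \bar R}) (q : R) (w : G -> R)
    : Prop := {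
  lpalg_measurable : measurable_fun [set: borel G] (w : borel G -> R) ;
  lpalg_ge1 : forall x, 1 <= w x ;
  lpalg_submul : forall x y, w (x * y)%g <= w x * w y ;
  lpalg_sym : forall x, w (x^-1)%g = w x ;
  lpalg_conv : forall x,
    (\int[mu]_y (w y `^ (- q) * w ((y : G)^-1 * x)%g `^ (- q))%:E
       <= (w x `^ (- q))%:E)%E
}.

Definition polynomial_weight (w : G -> R) :=
  exists2 C : R, 0 < C & forall x y, w (x * y)%g <= C * (w x + w y).

End Groups.

Arguments compactly_generated G : clear implicits.

(* Not necessarily unital, which is why MathComp's rings do not apply. *)
HB.mixin Record isBanachStarAlgebra (R : realType) A
    & CompleteNormedModule R[i] A := {
  bmul : A -> A -> A ;
  bstar : A -> A ;
  bmulA : associative bmul ;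
  bmulDl : left_distributive bmul +%R ;
  bmulDr : right_distributive bmul +%R ;
  bmulZl : forall (z : R[i]) (a b : A), bmul (z *: a) b = z *: bmul a b ;
  bmulZr : forall (z : R[i]) (a b : A), bmul a (z *: b) = z *: bmul a b ;
  normr_bmul : forall a b : A, `|bmul a b| <= `|a| * `|b| ;
  bstarK : involutive bstar ;
  bstarD : {morph bstar : a b / a + b} ;
  bstarZ : forall (z : R[i]) (a : A), bstar (z *: a) = z^* *: bstar a ;
  bstarM : forall a b : A, bstar (bmul a b) = bmul (bstar b) (bstar a) ;
  normr_bstar : forall a : A, `|bstar a| = `|a|
}.

#[short(type="banachStarAlgType")]
HB.structure Definition BanachStarAlgebra (R : realType) :=
  {A of CompleteNormedModule R[i] A & isBanachStarAlgebra R A}.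

Section Spectrum.
Context {R : realType} {A : banachStarAlgType R}.

Definition is_unit (e : A) := forall a, bmul e a = a /\ bmul a e = a.

(* The product of the unitization of A, where (a, z) stands for a + z 1. *)
Definition umul (a b : A * R[i]) : A * R[i] :=
  (bmul a.1 b.1 + a.2 *: b.1 + b.2 *: a.1, a.2 * b.2).

(* Computed in A when A has a unit, in its unitization otherwise. *)
Definition spectrum (a : A) : set R[i] := [set z |
  (exists2 e, is_unit e &
     ~ exists b, bmul (z *: e - a) b = e /\ bmul b (z *: e - a) = e) \/
  ((~ exists e, is_unit e) /\
     ~ exists b, umul (- a, z) b = (0, 1) /\ umul b (- a, z) = (0, 1))].

End Spectrum.

(* In the order of R[i], 0 <= z means that z is real and nonnegative. *)
Definition symmetric_algebra (R : realType) (A : banachStarAlgType R) :=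
  forall a : A, spectrum (bmul (bstar a) a) `<=` [set z | 0 <= z].

Section LpSpace.
Context {R : realType} {G : topologicalGroupType}.
Variables (mu : {measure set (borel G) -> \bar R}) (p : R) (w : G -> R).
Implicit Types f g : G -> R[i].

Definition Cmeasurable f :=
  measurable_fun [set: borel G] (fun x : borel G => complex.Re (f x)) /\
  measurable_fun [set: borel G] (fun x : borel G => complex.Im (f x)).

Definition Cintegral f : R[i] :=
  (\int[mu]_(x in [set: borel G]) complex.Re (f x)) +i*
  (\int[mu]_(x in [set: borel G]) complex.Im (f x)).

Definition Lpw_norm f : \bar R :=
  ((\int[mu]_x (Normc.normc (f x) `^ p * w x `^ p)%:E) `^ p^-1)%E.

Definition Lpw f := Cmeasurable f /\ (Lpw_norm f < +oo)%E.

Definition convolution f g : G -> R[i] :=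
  fun x => Cintegral (fun y => f y * g (y^-1 * x)%g).

Definition involution f : G -> R[i] := fun x => (f (x^-1)%g)^*.

(* The Banach *-algebra A is L^p(G, w), i.e. its elements are the classes
   cls f of the functions f in L^p(G, w) modulo equality almost everywhere,
   and its operations and norm are those of L^p(G, w).  The values of cls
   outside of L^p(G, w) are irrelevant. *)
Record is_Lpw_algebra (A : banachStarAlgType R) (cls : (G -> R[i]) -> A)
    : Prop := {
  cls_eq : forall f g, Lpw f -> Lpw g ->
    (cls f = cls g <-> \forall x \ae mu, f x = g x) ;
  cls_surj : forall a, exists2 f, Lpw f & cls f = a ;
  cls_add : forall f g, Lpw f -> Lpw g ->
    Lpw (fun x => f x + g x) /\ cls (fun x => f x + g x) = cls f + cls g ;
  cls_scale : forall (z : R[i]) f, Lpw f ->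
    Lpw (fun x => z * f x) /\ cls (fun x => z * f x) = z *: cls f ;
  cls_conv : forall f g, Lpw f -> Lpw g ->
    Lpw (convolution f g) /\ cls (convolution f g) = bmul (cls f) (cls g) ;
  cls_star : forall f, Lpw f ->
    Lpw (involution f) /\ cls (involution f) = bstar (cls f) ;
  cls_norm : forall f, Lpw f -> `|cls f| = (fine (Lpw_norm f))%:C
}.

End LpSpace.

(* Main.v *)
(* A left Haar measure on a group of polynomial growth is right invariant, since
   a positive character is trivial as soon as its powers grow polynomially.  Let
   b = a^* a in L^p(G, w), let t lie outside [0, +oo[, and put c = |a|_1^2, which
   is finite because w^-1 is in L^q and L^p(G, w) is contained in L^1(G).  Some z
   with Re z = c / 2 satisfies |z| < |z - t|, and convolution by z - b has norm
   at most |z| on L^2(G).  The point is that (z - b)^n b grows in L^p(G, w) no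
   faster than |z|^n, up to an arbitrarily small change of the exponential rate;
   the Neumann series about z then converges at t and provides the resolvent.

   An exponential rate x in L^p(G, w) bounds the rate on every L^r(G), r >= 1, by
   Young's inequality.  Interpolating with the rate y of L^2(G) gives a rate
   (1 - s) x + s y on L^p(G), with s > 0 independent of x.  A polynomial weight
   is equivalent to weights that vary slowly under bounded translations, hence
   almost commute with convolutions, so that the rate on L^p(G) is a rate on
   L^p(G, w) as well.  Iterating, x decreases to y. *)

From HB Require Import structures.
Require Import Defs.
From mathcomp Require Import all_boot all_order all_algebra complex.
From mathcomp Require Import all_classical all_reals all_analysis.
From mathcomp Require Import measurable_realfun ring lra.
Import Order.TTheory GRing.Theory Num.Theory.
Import numFieldNormedType.Exports.
Set Implicit Arguments.
Unset Strict Implicit.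
Unset Printing Implicit Defensive.
Local Open Scope classical_set_scope.
Local Open Scope ring_scope.
Local Open Scope complex_scope.

(** * Haar measure *)

(** Only exponential rates of the powers of z - b matter, so every constant independent of the power
    is harmless. This is why Marcinkiewicz interpolation is enough, its constant depending only on
    the exponents, and why equivalent weights may be exchanged. The slowly varying weight depends on
    the level at which an element is cut, but its comparison constant with w does not; otherwise the
    tail could not be made small after the weight is known. The algebra may lack a unit, so growth
    is measured on (z - b)^n b, and (z - b)^n is handled as z^n 1 + f_n with f_n in the algebra. G
    need not be second countable, so (x, y) -> x^-1 y need not be measurable for the product of the
    Borel sigma-algebras. Open sigma-compact sets have measurable preimages all the same.
    Unimodularity is proved with these alone; the invariance under inversion that it yields then
    corrects general functions on null sections, after which Tonelli and Fubini apply to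
    convolutions. *)

Section TopologicalGroups.
Variable G : topologicalGroupType.
Implicit Types (x y z : G) (K V B O A : set G).

Lemma continuousM_mulg (T : topologicalType) (f g : T -> G) (t : T) :
  {for t, continuous f} -> {for t, continuous g} ->
  {for t, continuous (fun s => f s * g s)%g}.
Proof.
move=> cf cg; apply: (@continuous_comp T (G * G)%type G
  (fun s => (f s, g s)) (fun p => (p.1 * p.2)%g)).
- exact: cvg_pair.
- exact: mulg_continuous.
Qed.

Lemma continuousV_invg (T : topologicalType) (f : T -> G) (t : T) :
  {for t, continuous f} -> {for t, continuous (fun s => (f s)^-1)%g}.
Proof.
move=> cf; apply: (@continuous_comp T G G f (fun p => (p^-1)%g)) => //.
exact: invg_continuous.
Qed.

Lemma continuous_mull x : continuous (fun y => x * y)%g.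
Proof. by move=> y; apply: continuousM_mulg => //; exact: cvg_cst. Qed.

Lemma continuous_mulr x : continuous (fun y => y * x)%g.
Proof. by move=> y; apply: continuousM_mulg => //; exact: cvg_cst. Qed.

Lemma open_preimage (T : topologicalType) (f : T -> G) O :
  continuous f -> open O -> open (f @^-1` O).
Proof. by move=> /continuousP; apply. Qed.

(** The map (a, b, k) -> a^-1 b k is continuous and sends (1, 1, k) to k. Compactness of [K] makes
    the neighbourhood of (1, 1) uniform in k. *)
Lemma compact_near_translate K O : compact K -> open O -> K `<=` O ->
  exists V, [/\ open V, V 1%g &
    forall a b k, V a -> V b -> K k -> O (a^-1 * b * k)%g].
Proof.
move=> /compact_near_coveringP cK oO KO.
have /cK : forall x, K x -> \forall x' \near x & ab \near nbhs ((1%g, 1%g) : G * G),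
    (fun (ab : G * G) x => O (ab.1^-1 * ab.2 * x)%g) ab x'.
  move=> x Kx.
  have cf : {for (x, (1%g, 1%g)) : G * (G * G),
      continuous (fun p : G * (G * G) => (p.2.1^-1 * p.2.2 * p.1)%g)}.
    apply: continuousM_mulg; last exact: cvg_fst.
    apply: continuousM_mulg.
      apply: continuousV_invg.
      apply: (@continuous_comp _ (G * G)%type G snd fst); first exact: cvg_snd.
      exact: cvg_fst.
    apply: (@continuous_comp _ (G * G)%type G snd snd); first exact: cvg_snd.
    exact: cvg_snd.
  have : nbhs ((1%g : G)^-1 * 1 * x)%g O.
    by rewrite invg1 !mul1g; apply: open_nbhs_nbhs; split => //; exact: KO.
  by move/cf; exact.
move=> [[P Q] /= [nP nQ] PQ].
move: nP nQ; rewrite !nbhsE => -[V1 [oV1 V11] VP] [V2 [oV2 V21] VQ].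
exists (V1 `&` V2); split => //; first exact: openI.
move=> a b k [Va _] [_ Vb] Kk.
exact: (PQ (a, b) (conj (VP _ Va) (VQ _ Vb)) k Kk).
Qed.

Definition sigma_compact B :=
  exists2 K : nat -> set G, (forall n, compact (K n)) & B = \bigcup_n K n.

Hypothesis G_lc : locally_compact_group G.

Let G_hd : hausdorff_space G. Proof. by case: G_lc. Qed.

Lemma compact_nbhs_in V : open V -> V 1%g ->
  exists D, [/\ compact D, nbhs (1%g : G) D & D `<=` V].
Proof.
move=> oV V1; have [D0 + [cD0 clD0]] := G_lc.2 1%g Logic.I.
rewrite withinET => nD0.
have [W nW WV] := compact_regular G_hd cD0 nD0 (open_nbhs_nbhs (conj oV V1)).
exists (D0 `&` closure W); split.
- apply: (subclosed_compact _ cD0); last exact: subIsetl.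
  by apply: closedI => //; exact: closed_closure.
- by apply: filterI => //; apply: filterS nW; exact: subset_closure.
- by move=> x [_ /WV].
Qed.

Lemma compact_between K O : compact K -> open O -> K `<=` O ->
  exists C, [/\ compact C, K `<=` C^° & C `<=` O].
Proof.
move=> cK oO KO; have [V [oV V1 VO]] := compact_near_translate cK oO KO.
have [D [cD nD DV]] := compact_nbhs_in oV V1.
exists ((fun p : G * G => (p.1 * p.2)%g) @` (D `*` K)); split.
- apply: continuous_compact; last exact: compact_setX.
  by apply: continuous_subspaceT; exact: mulg_continuous.
- move=> k Kk; rewrite /interior/=.
  have nk : nbhs k ((fun y => y * k^-1)%g @^-1` D).
    by apply: continuous_mulr; rewrite mulgV.
  apply: filterS nk => x /= Dx.
  by exists ((x * k^-1)%g, k) => //=; rewrite -mulgA mulVg mulg1.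
- move=> _ [[d k] [/= Dd Kk] <-].
  by rewrite -[d]mul1g -invg1; apply: VO => //; exact: DV.
Qed.

(** Iterating [compact_between] gives a chain of compact sets, each inside the interior of the next,
    whose union is both open and sigma-compact. Such sets are those to which
    [measurable_left_quotient] applies. *)
Lemma sigma_compact_between K O : compact K -> open O -> K `<=` O ->
  exists B, [/\ open B, sigma_compact B, K `<=` B & B `<=` O].
Proof.
move=> cK oO KO.
have /choice [f fP] : forall C, exists C', compact C -> C `<=` O ->
    [/\ compact C', C `<=` C'^° & C' `<=` O].
  move=> C; have [[cC CO]|] := pselect (compact C /\ C `<=` O).
    by have [C' C'P] := compact_between cC oO CO; exists C'.
  by move=> h; exists C => *; exfalso; apply: h.
pose F n := iter n f K.
have FP n : compact (F n) /\ F n `<=` O.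
  elim: n => //= n [cF FO]; by have [] := fP _ cF FO.
have FF n : F n `<=` (F n.+1)^°.
  by have [cF FO] := FP n; have [] := fP _ cF FO.
exists (\bigcup_n F n); split.
- rewrite openE => x [n _ /FF]; rewrite /interior/=.
  by apply: filterS => y Fy; exists n.+1.
- by exists F => // n; exact: (FP n).1.
- by move=> x Kx; exists 0%N.
- by move=> x [n _]; exact: (FP n).2.
Qed.

Lemma set_expg_compact K n : compact K -> compact (set_expg K n).
Proof.
move=> cK; elim: n => [|n IH] /=; first exact: compact_set1.
rewrite (_ : [set _ | _ in _ & _ in _] =
  (fun p : G * G => (p.1 * p.2)%g) @` (K `*` set_expg K n)); last first.
  apply/seteqP; split=> [_ [x Kx [y Ky <-]]|_ [[x y] [/= Kx Ky] <-]].
    by exists (x, y).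
  by exists x => //; exists y.
apply: continuous_compact; last exact: compact_setX.
by apply: continuous_subspaceT; exact: mulg_continuous.
Qed.

Hypothesis G_cg : compactly_generated G.

Lemma compactly_generated_sigma_compact : sigma_compact [set: G].
Proof.
have [K [cK <-]] := G_cg; eexists; last reflexivity.
move=> n; apply: set_expg_compact; apply: compactU => //.
by apply: continuous_compact => //; apply: continuous_subspaceT; exact: invg_continuous.
Qed.

(** A compactly generated group is sigma-compact, and finitely many translates of [V] cover each
    compact piece. The sequence [z] enumerates all these translates. *)
Lemma countable_translates V : open V -> V 1%g ->
  exists z : nat -> G, forall x, exists i, V ((z i)^-1 * x)%g.
Proof.
move=> oV V1; have [K cK GK] := compactly_generated_sigma_compact.
have /choice [s sP] : forall n, exists s : seq G,
    forall x, K n x -> exists2 y, y \in s & V (y^-1 * x)%g.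
  move=> n; have := cK n; rewrite compact_cover.
  move=> /(_ G setT (fun y => [set x | V (y^-1 * x)%g])) [].
  - by move=> y _; apply: open_preimage => //; exact: continuous_mull.
  - by move=> x _; exists x => //=; rewrite mulVg.
  - by move=> D _ KD; exists (finmap.enum_fset D) => x /KD [y /= yD Vy]; exists y.
pose z k := if unpickle k is Some (n, j) then nth 1%g (s n) j else 1%g.
exists z => x; have : [set: G] x by [].
rewrite GK => -[n _ /sP [y ys Vy]].
by exists (pickle (n, index y (s n))); rewrite /z pickleK nth_index.
Qed.

Lemma measurable_open O : open O -> measurable (O : set (borel G)).
Proof. by move=> oO; exact: sub_gen_smallest. Qed.

Lemma measurable_fun_continuous (f : G -> G) : continuous f ->
  measurable_fun [set: borel G] (f : borel G -> borel G).
Proof.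
move=> cf; apply: (@measurability _ _ (borel G) (borel G) _ _ (@open G)) => //.
move=> _ [A oA <-]; rewrite setTI; apply: measurable_open.
exact: open_preimage.
Qed.

(** The preimage is a countable union of measurable rectangles. With [V n] adapted to the n-th
    compact piece [K n] of [B] and [P n] the open set V_n K_n, x in z_i V_n and y in z_i P_n give
    x^-1 y = a^-1 b k in [B]; conversely, if x^-1 y lies in [K n], choose i with x in z_i V_n, and
    then y = x k lies in z_i V_n K_n. *)
Lemma measurable_left_quotient B : open B -> sigma_compact B ->
  measurable ([set p | B (p.1^-1 * p.2)%g] : set (borel G * borel G)).
Proof.
move=> oB [K cK BK].
have /choice [V VP] n : exists V, [/\ open V, V 1%g &
    forall a b k, V a -> V b -> K n k -> B (a^-1 * b * k)%g].
  apply: compact_near_translate => //.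
  by rewrite BK; exact: bigcup_sup.
have /choice [z zP] n : exists z : nat -> G,
    forall x, exists i, V n ((z i)^-1 * x)%g.
  by have [oV V1 _] := VP n; exact: countable_translates.
pose P n := [set x | exists2 k, K n k & V n (x * k^-1)%g].
have oP n : open (P n).
  rewrite (_ : P n = \bigcup_(k in K n) ((fun x => x * k^-1)%g @^-1` V n)).
    apply: bigcup_open => k _; apply: open_preimage; first exact: continuous_mulr.
    by have [] := VP n.
  by apply/seteqP; split => [x [k Kk Vk]|x [k Kk Vk]]; exists k.
rewrite (_ : [set _ | _] = \bigcup_n \bigcup_i
  (((fun x => (z n i)^-1 * x)%g @^-1` V n) `*`
   ((fun x => (z n i)^-1 * x)%g @^-1` P n))); last first.
  apply/seteqP; split => [[x y] /=|[x y] [n _ [i _] [/= Vx [k Kk Vk]]]].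
    rewrite {1}BK => -[n _ Kn]; have [i Vi] := zP n x.
    exists n => //; exists i => //; split => //=.
    by exists (x^-1 * y)%g => //; rewrite invgM invgK mulgA mulgK.
  have [_ _ /(_ _ _ _ Vx Vk Kk)] := VP n.
  by rewrite invgM invgK -!mulgA mulVg mulg1 mulVKg.
apply: bigcupT_measurable => n; apply: bigcupT_measurable => i.
by apply: measurableX; apply: measurable_open; apply: open_preimage => //;
  [exact: continuous_mull|have [] := VP n|exact: continuous_mull].
Qed.

Lemma compact_borel K : compact K -> measurable (K : set (borel G)).
Proof.
move=> /(compact_closed G_hd) cK; rewrite -[K]setCK; apply: measurableC.
by apply: measurable_open; exact: closed_openC.
Qed.

End TopologicalGroups.

(* A measure known to be sigma-finite only by hypothesis is not an instance of
   the structure required by Fubini's theorem; this copy is. *)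
Definition sigma_finite_copy d (T : measurableType d) (R : realType)
  (mu : {measure set T -> \bar R}) of sigma_finite [set: T] mu
  : set T -> \bar R := mu.

Section EReal.
Context (R : realType).
Local Open Scope ereal_scope.

Lemma ereal_sup_mule_le (S : set (\bar R)) (r c : \bar R) :
  S !=set0 -> (forall a, S a -> 0 <= a) -> 0 <= r ->
  (forall a, S a -> a * r <= c) ->
  ereal_sup S * r <= c.
Proof.
move=> [s Ss] S0 r0 Sc.
have c0 : 0 <= c by apply: le_trans (Sc _ Ss); rewrite mule_ge0// S0.
have [->|rn0] := eqVneq r 0; first by rewrite mule0.
have rp : 0 < r by rewrite lt0e rn0.
have [ry|rny] := eqVneq r +oo.
  have [[x [Sx x0]]|nS] := pselect (exists x, S x /\ 0 < x).
    by have := Sc _ Sx; rewrite ry gt0_muley// leye_eq => /eqP ->; rewrite leey.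
  rewrite (_ : ereal_sup S = 0) ?mul0e//; apply/eqP; rewrite eq_le; apply/andP; split.
    by apply: ge_ereal_sup => x Sx; rewrite leNgt; apply/negP => x0; apply: nS; exists x.
  by apply: le_trans (ereal_sup_ubound Ss); exact: S0.
have rf : r \is a fin_num by rewrite fin_numElt (lt_le_trans _ r0)//= ltey.
rewrite -(fineK rf) -lee_pdivlMr; last by rewrite fine_gt0// rp ltey.
apply: ge_ereal_sup => x Sx; rewrite lee_pdivlMr; last by rewrite fine_gt0// rp ltey.
by rewrite fineK//; exact: Sc.
Qed.

Lemma muleI_fin (a x y : \bar R) : a \is a fin_num -> 0 < a ->
  a * x = a * y -> x = y.
Proof.
move=> af a0 axy; apply/eqP; rewrite eq_le; apply/andP.
by split; rewrite -(lee_pmul2l af a0) axy.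
Qed.

End EReal.

Section Tonelli.
Context d (T : measurableType d) (R : realType).
Variable mu : {measure set T -> \bar R}.
Hypothesis mu_sf : sigma_finite [set: T] mu.
Local Open Scope ereal_scope.

HB.instance Definition _ := Measure.copy (sigma_finite_copy mu_sf) mu.
HB.instance Definition _ :=
  Measure_isSigmaFinite.Build d T R (sigma_finite_copy mu_sf) mu_sf.

Let m := [the {sigma_finite_measure set T -> \bar R} of sigma_finite_copy mu_sf].

Variable f : T * T -> \bar R.
Hypothesis mf : measurable_fun setT f.
Hypothesis f0 : forall x, 0 <= f x.

Lemma measurable_tonelli1 :
  measurable_fun setT (fun x => \int[mu]_y f (x, y)).
Proof. exact: (@measurable_fun_fubini_tonelli_F _ _ _ _ _ m f mf f0). Qed.

Lemma measurable_tonelli2 :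
  measurable_fun setT (fun y => \int[mu]_x f (x, y)).
Proof. exact: (@measurable_fun_fubini_tonelli_G _ _ _ _ _ m f mf f0). Qed.

Lemma tonelli :
  \int[mu]_x \int[mu]_y f (x, y) = \int[mu]_y \int[mu]_x f (x, y).
Proof. exact: (@fubini_tonelli _ _ _ _ _ m m f mf f0). Qed.

End Tonelli.

Section TonelliSet.
Context d (T : measurableType d) (R : realType).
Variable mu : {measure set T -> \bar R}.
Hypothesis mu_sf : sigma_finite [set: T] mu.
Variable E : set (T * T).
Hypothesis mE : measurable E.
Local Open Scope ereal_scope.

Let f (p : T * T) : \bar R := (\1_E p)%:E.

Let mf : measurable_fun setT f.
Proof. by apply/measurable_EFinP; exact: measurable_indic. Qed.

Let f0 p : 0 <= f p. Proof. by rewrite lee_fin. Qed.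

Let f1 x : \int[mu]_y f (x, y) = mu [set y | E (x, y)].
Proof.
have mS : measurable [set y | E (x, y)].
  rewrite (_ : [set y | _] = xsection E x); first exact: measurable_xsection.
  by apply/seteqP; split => y /=; rewrite /xsection/= inE.
rewrite -[X in _ = mu X]setIT -(integral_indic mu measurableT mS).
by apply: eq_integral => y _; rewrite /f !indicE; congr ((_ _)%:R%:E); rewrite !inE.
Qed.

Let f2 y : \int[mu]_x f (x, y) = mu [set x | E (x, y)].
Proof.
have mS : measurable [set x | E (x, y)].
  rewrite (_ : [set x | _] = ysection E y); first exact: measurable_ysection.
  by apply/seteqP; split => x /=; rewrite /ysection/= inE.
rewrite -[X in _ = mu X]setIT -(integral_indic mu measurableT mS).
by apply: eq_integral => x _; rewrite /f !indicE; congr ((_ _)%:R%:E); rewrite !inE.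
Qed.

Lemma measurable_section1 : measurable_fun setT (fun x => mu [set y | E (x, y)]).
Proof.
rewrite (_ : (fun _ => _) = fun x => \int[mu]_y f (x, y)).
  exact: measurable_tonelli1.
by apply/funext => x; rewrite f1.
Qed.

Lemma tonelli_set :
  \int[mu]_x mu [set y | E (x, y)] = \int[mu]_y mu [set x | E (x, y)].
Proof.
under eq_integral do rewrite -f1; under [RHS]eq_integral do rewrite -f2.
exact: (tonelli mu_sf mf f0).
Qed.

End TonelliSet.

Section Haar.
Variables (R : realType) (G : topologicalGroupType).
Variable mu : {measure set (borel G) -> \bar R}.
Hypotheses (G_lc : locally_compact_group G) (G_cg : compactly_generated G).
Hypothesis mu_haar : left_haar mu.
Implicit Types (x y z : G) (K V B O A : set G).
Local Open Scope ereal_scope.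

Lemma haar_sigma_finite : sigma_finite [set: borel G] mu.
Proof.
have [K cK KT] := compactly_generated_sigma_compact G_cg.
exists K => // n; split; first exact: compact_borel.
exact: (haar_compact mu_haar).
Qed.

Lemma haar_preimage x A : measurable (A : set (borel G)) ->
  mu [set y | A (x * y)%g] = mu A.
Proof.
move=> mA; rewrite -(haar_left mu_haar x^-1%g mA); congr (mu _).
apply/seteqP; split => [y /= Ay|_ [y Ay <-]] /=.
  by exists (x * y)%g; rewrite // mulKg.
by rewrite mulVKg.
Qed.

Lemma measurable_mull x :
  measurable_fun [set: borel G] ((fun y => x * y)%g : borel G -> borel G).
Proof. by apply: measurable_fun_continuous; exact: continuous_mull. Qed.

Lemma measurable_mulr x :
  measurable_fun [set: borel G] ((fun y => y * x)%g : borel G -> borel G).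
Proof. by apply: measurable_fun_continuous; exact: continuous_mulr. Qed.

Lemma measurable_invg :
  measurable_fun [set: borel G] ((fun y => y^-1)%g : borel G -> borel G).
Proof. by apply: measurable_fun_continuous; exact: invg_continuous. Qed.

Lemma integral_measure_preserving (phi : borel G -> borel G) (f : borel G -> \bar R) :
  measurable_fun setT phi ->
  (forall A, measurable (A : set (borel G)) -> mu (phi @^-1` A) = mu A) ->
  measurable_fun setT f ->
  \int[mu]_y f (phi y) = \int[mu]_y f y.
Proof.
move=> mphi phiE mf.
have H (g : borel G -> \bar R) : measurable_fun setT g -> (forall x, 0 <= g x) ->
    \int[mu]_y g (phi y) = \int[mu]_y g y.
  move=> mg g0.
  have gD : {in setT, forall y : borel G, 0 <= g y} by move=> y _; exact: g0.
  rewrite -[LHS](ge0_integral_pushforward mphi mu measurableT mg gD).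
  by apply: eq_measure_integral => A mA _; exact: phiE.
rewrite integralE [RHS]integralE; congr (_ - _).
  rewrite -(H f^\+ (measurable_funepos mf) (funepos_ge0 f)).
  by apply: eq_integral => x _; rewrite !funeposE.
rewrite -(H f^\- (measurable_funeneg mf) (funeneg_ge0 f)).
by apply: eq_integral => x _; rewrite !funenegE.
Qed.

(** Countably many translates of a nonempty open set cover [G], so a null one would make the whole
    measure vanish. *)
Lemma haar_open_gt0 O : open O -> O !=set0 -> 0 < mu O.
Proof.
move=> oO [x Ox]; rewrite lt0e measure_ge0 andbT; apply/negP => /eqP O0.
have oV : open [set y | O (x * y)%g] by apply: open_preimage => //; exact: continuous_mull.
have [|z zP] := countable_translates G_cg oV; first by rewrite /= mulg1.
apply: (haar_neq0 mu_haar); apply/eqP; rewrite -measure_le0.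
have -> : [set: G] = \bigcup_i [set y | O (x * (z i)^-1 * y)%g].
  by apply/seteqP; split => // y _; have [i Vi] := zP y; exists i => //=; rewrite -mulgA.
have mO i : measurable ([set y | O (x * (z i)^-1 * y)%g] : set (borel G)).
  by apply: measurable_open; apply: open_preimage => //; exact: continuous_mull.
apply: (le_trans (measure_sigma_subadditive mu mO _ (@subset_refl _ _))).
  exact: bigcupT_measurable.
rewrite eseries0 // => i _ _.
by rewrite haar_preimage //; exact: measurable_open.
Qed.

Lemma measurable_proj_preimage A : measurable (A : set (borel G)) ->
  measurable ([set p | A p.1] : set (borel G * borel G)) /\
  measurable ([set p | A p.2] : set (borel G * borel G)).
Proof.
by move=> mA; split; rewrite -[X in measurable X]setTI;
  [exact: measurable_fst|exact: measurable_snd].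
Qed.

Lemma measurable_right_translate_pairs A B : measurable (A : set (borel G)) ->
    open B -> sigma_compact B ->
  measurable ([set p | A p.1 /\ B (p.2 * p.1)%g] : set (borel G * borel G)).
Proof.
move=> mA oB sB.
apply: measurableI; first exact: (measurable_proj_preimage mA).1.
have mphi : measurable_fun [set: borel G * borel G]
    ((fun p => (p.2^-1%g, p.1)) : borel G * borel G -> borel G * borel G).
  apply: measurable_fun_pair => //.
  by apply: (measurableT_comp measurable_invg) => //; exact: measurable_snd.
have := mphi measurableT _ (measurable_left_quotient G_cg oB sB).
rewrite setTI (_ : _ @^-1` _ = [set p | B (p.2 * p.1)%g])//.
by apply/seteqP; split => p /=; rewrite invgK.
Qed.

(* Integrates mu {y | y x in B} over x in A by going twice through Tonelli's
   theorem, with the substitution x -> y^-1 x in between. *)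
Lemma haar_right_translate_integral A B : open A -> sigma_compact A ->
    open B -> sigma_compact B ->
  \int[mu]_x mu [set y | A x /\ B (y * x)%g] = mu B * mu [set x | A x^-1%g].
Proof.
move=> oA sA oB sB.
have mA := measurable_open oA; have mB := measurable_open oB.
have mE1 := measurable_right_translate_pairs mA oB sB.
have mE2 : measurable ([set p | A (p.1^-1 * p.2)%g /\ B p.2] : set (borel G * borel G)).
  apply: measurableI; last exact: (measurable_proj_preimage mB).2.
  exact: (measurable_left_quotient G_cg).
rewrite (tonelli_set haar_sigma_finite mE1).
transitivity (\int[mu]_y mu [set x | A (y^-1 * x)%g /\ B x]).
  apply: eq_integral => y _; rewrite -(haar_preimage y).
    by congr (mu _); apply/seteqP; split => x /=; rewrite mulKg.
  apply: measurableI => //; rewrite -[X in measurable X]setTI.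
  exact: measurable_mull.
rewrite (tonelli_set haar_sigma_finite mE2).
transitivity (\int[mu]_x (mu [set x | A x^-1%g] * (\1_B x)%:E)).
  apply: eq_integral => x _; rewrite indicE; have [|] := boolP (x \in B).
    rewrite inE mule1 => Bx.
    rewrite -(haar_preimage x^-1%g); last first.
      by rewrite -[X in measurable X]setTI; exact: measurable_invg.
    by congr (mu _); apply/seteqP; split => y /=; rewrite invgM invgK // => -[].
  rewrite notin_setE mule0 => nBx.
  by rewrite (_ : [set _ | _] = set0) ?measure0//; apply/seteqP; split => y // [].
rewrite ge0_integralZl//.
- by rewrite integral_indic// setIT muleC.
- by apply/measurable_EFinP; exact: measurable_indic.
Qed.

Lemma measurable_right_translate x B : measurable (B : set (borel G)) ->
  measurable ([set y | B (y * x)%g] : set (borel G)).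
Proof. by move=> mB; rewrite -[X in measurable X]setTI; exact: measurable_mulr. Qed.

Lemma measurable_inverse B : measurable (B : set (borel G)) ->
  measurable ([set y | B y^-1%g] : set (borel G)).
Proof. by move=> mB; rewrite -[X in measurable X]setTI; exact: measurable_invg. Qed.

Lemma integral_section_ge A (f : borel G -> \bar R) (c : \bar R) :
  measurable (A : set (borel G)) -> measurable_fun setT f -> (forall x, 0 <= f x) ->
  0 <= c -> (forall x, A x -> c <= f x) -> c * mu A <= \int[mu]_x f x.
Proof.
move=> mA mf f0 c0 cf; have m1 : measurable_fun setT (fun x : borel G => (\1_A x)%:E : \bar R).
  by apply/measurable_EFinP; exact: measurable_indic.
rewrite -[A]setIT -(integral_indic mu measurableT mA) -ge0_integralZl//.
- apply: ge0_le_integral => //.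
  + by move=> x _; rewrite mule_ge0// lee_fin.
  + by exact: emeasurable_funM.
  + move=> x _; rewrite indicE; have [|] := boolP (x \in A).
      by rewrite inE mule1 => /cf.
    by rewrite mule0.
Qed.

Lemma integral_section_le A (f : borel G -> \bar R) (c : \bar R) :
  measurable (A : set (borel G)) -> measurable_fun setT f -> (forall x, 0 <= f x) ->
  0 <= c -> (forall x, f x <= c) -> (forall x, ~ A x -> f x = 0) ->
  \int[mu]_x f x <= c * mu A.
Proof.
move=> mA mf f0 c0 fc fA0; have m1 : measurable_fun setT (fun x : borel G => (\1_A x)%:E : \bar R).
  by apply/measurable_EFinP; exact: measurable_indic.
rewrite -[A]setIT -(integral_indic mu measurableT mA) -ge0_integralZl//.
- apply: ge0_le_integral => //.
  + by exact: emeasurable_funM.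
  + move=> x _; rewrite indicE; have [|] := boolP (x \in A).
      by rewrite inE mule1.
    by rewrite notin_setE => /fA0 ->; rewrite mule0.
Qed.

End Haar.

(** * Unimodularity *)

Section Growth.
Context (R : realType).

(** For r > 1 the left-hand side is doubly exponential in j, the right-hand side only exponential.
    It is used with [r] a value of the modular function: along the powers n = 2^j a polynomial bound
    in n becomes geometric in j. *)
Lemma growth_le1 (r a c : R) : 0 <= r -> 0 < a ->
  (forall j, r ^+ (2 ^ j) <= c * a ^+ j) -> r <= 1.
Proof.
move=> r0 a0 rac; rewrite leNgt; apply/negP => r1.
have r10 : 0 < r - 1 by rewrite subr_gt0.
have bern n : 1 + n%:R * (r - 1) <= r ^+ n.
  elim: n => [|n IH]; first by rewrite mul0r addr0.
  rewrite exprS; apply: le_trans (_ : r * (1 + n%:R * (r - 1)) <= _); last first.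
    by rewrite ler_wpM2l.
  rewrite -natr1; have : 0 <= n%:R * (r - 1) * (r - 1) :> R by rewrite !mulr_ge0// ltW.
  by nra.
have arch (x : R) : exists n : nat, x <= n%:R.
  by exists (Num.truncn `|x|).+1; apply/ltW/(le_lt_trans (ler_norm _)); rewrite truncnS_gt.
have [j0 j0P] := arch (2 * a / (r - 1)).
have big j : (j0 <= j)%N -> 2 * a <= r ^+ (2 ^ j).
  move=> j0j; apply: le_trans (bern _); apply: (@le_trans _ _ (j0%:R * (r - 1))).
    by rewrite -ler_pdivrMr.
  rewrite -[leLHS]add0r lerD// ler_wpM2r//; first exact: ltW.
  by rewrite ler_nat (leq_trans j0j)// ltnW// ltn_expl.
have a20 : 0 < 2 * a by rewrite mulr_gt0.
have big2 i : (2 * a) ^+ i <= r ^+ (2 ^ (j0 + i)).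
  elim: i => [|i IH].
    by rewrite expr0 addn0; apply: le_trans (bern _); rewrite lerDl mulr_ge0// ltW.
  rewrite addnS expnS mulnC muln2 -addnn exprD exprS.
  apply: ler_pM => //; [exact: ltW|by rewrite exprn_ge0// ltW|].
  by apply: big; rewrite leq_addr.
have [i iP] := arch (c * a ^+ j0).
have := le_trans (big2 i) (rac _); rewrite exprD mulrA exprMn.
rewrite ler_pM2r ?exprn_gt0// => h.
have : (2 ^ i)%:R <= i%:R :> R by rewrite natrX; apply: (le_trans h).
by rewrite ler_nat leqNgt ltn_expl.
Qed.

End Growth.

Section HaarUnimodular.
Variables (R : realType) (G : topologicalGroupType).
Variable mu : {measure set (borel G) -> \bar R}.
Hypotheses (G_lc : locally_compact_group G) (G_cg : compactly_generated G).
Hypothesis mu_haar : left_haar mu.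
Implicit Types (x y z : G) (K V B O A : set G).
Local Open Scope ereal_scope.

Let G_hd : hausdorff_space G. Proof. by case: G_lc. Qed.

Lemma compact_near_right K O (h : G -> G) x0 : compact K -> open O ->
  {for x0, continuous h} -> (forall k, K k -> O (k * h x0)%g) ->
  \forall x \near x0, forall k, K k -> O (k * h x)%g.
Proof.
move=> /compact_near_coveringP cK oO ch KO.
have /cK : forall k, K k -> \forall k' \near k & x \near nbhs x0,
    (fun x k => O (k * h x)%g) x k'.
  move=> k Kk.
  have cf : {for (k, x0), continuous (fun p : G * G => (p.1 * h p.2)%g)}.
    apply: continuousM_mulg; first exact: cvg_fst.
    by apply: (@continuous_comp _ G G snd h) => //; exact: cvg_snd.
  have : nbhs (k * h x0)%g O by apply: open_nbhs_nbhs; split => //; exact: KO.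
  by move/cf; exact.
by apply: filterS => x Px k Kk; exact: Px.
Qed.

(** Right translation by x0 multiplies the measures of open sets by a common factor, and this
    inequality is the approximate form of that fact. [haar_right_translate_integral] is applied
    twice over a small neighbourhood A of x0, giving [H1] and [H2]; the quantities mu A and mu A^-1
    appear on opposite sides and cancel in their product. *)
Lemma haar_right_ratio_compact K K' B B' x0 :
  compact K -> compact K' -> open B -> open B' ->
  (forall y, K y -> B (y * x0)%g) -> K' `<=` B' ->
  mu K * mu K' <= mu B * mu [set y | B' (y * x0)%g].
Proof.
move=> cK cK' oB oB' KB KB'.
have cKx : compact ((fun y => y * x0)%g @` K).
  by apply: continuous_compact => //; apply: continuous_subspaceT; exact: continuous_mulr.
have [B1 [oB1 sB1 KB1 B1B]] : exists B1, [/\ open B1, sigma_compact B1,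
    (fun y => y * x0)%g @` K `<=` B1 & B1 `<=` B].
  by apply: sigma_compact_between => // _ [y Ky <-]; exact: KB.
have [C [cC K'C CB']] := compact_between G_lc cK' oB' KB'.
have [B2 [oB2 sB2 KB2 B2C]] : exists B2, [/\ open B2, sigma_compact B2,
    K' `<=` B2 & B2 `<=` C^°].
  by apply: sigma_compact_between => //; exact: open_interior.
(* For x in A the first condition makes the section of [B1] contain [K], and the second puts the
   section of [B2] inside that of [B'] over x0, because y x in C yields y x0 = (y x) (x^-1 x0) in
   [B']. *)
have : nbhs x0 [set x | (forall k, K k -> B1 (k * x)%g) /\
    (forall k, C k -> B' (k * (x^-1 * x0))%g)].
  near=> x; split; near: x.
    apply: (@compact_near_right K B1 id) => // k Kk.
    by apply: KB1; exists k.
  apply: (@compact_near_right C B' (fun x => x^-1 * x0)%g) => //.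
    apply: continuousM_mulg; last exact: cvg_cst.
    exact: continuousV_invg.
  by move=> k Ck; rewrite mulVg mulg1; exact: CB'.
rewrite nbhsE => -[N [oN Nx0] NP].
have [D [cD x0D DN]] : exists D, [/\ compact D, [set x0] `<=` D^° & D `<=` N].
  by apply: compact_between => //; [exact: compact_set1|move=> _ ->].
have [A [oA sA x0A AD]] : exists A, [/\ open A, sigma_compact A,
    [set x0] `<=` A & A `<=` D^°].
  by apply: sigma_compact_between => //; [exact: compact_set1|exact: open_interior].
have AD' : A `<=` D by move=> x /AD; exact: interior_subset.
have mA := measurable_open oA.
set a := mu A; set a' := mu [set x | A x^-1%g].
have oA' : open [set x | A x^-1%g].
  by apply: (open_preimage (f := fun x => x^-1%g)) => //; exact: invg_continuous.
have [a0 a'0] : 0 < a /\ 0 < a'.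
  split; apply: (haar_open_gt0 G_cg mu_haar) => //.
    by exists x0; exact: x0A.
  by exists x0^-1%g; rewrite /= invgK; exact: x0A.
have afin : a < +oo.
  apply: (le_lt_trans _ (haar_compact mu_haar cD)).
  by apply: le_measure; rewrite ?inE//; exact: compact_borel.
have a'fin : a' < +oo.
  have cD' : compact ((fun x => x^-1%g) @` D).
    by apply: continuous_compact => //; apply: continuous_subspaceT; exact: invg_continuous.
  apply: (le_lt_trans _ (haar_compact mu_haar cD')).
  apply: le_measure; rewrite ?inE//.
  - exact: measurable_open.
  - exact: compact_borel.
  - by move=> x /= /AD' Dx; exists x^-1%g; rewrite ?invgK.
have afn : a \is a fin_num by rewrite ge0_fin_numE// ltW.
have a'fn : a' \is a fin_num by rewrite ge0_fin_numE// ltW.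
have mF B0 : open B0 -> sigma_compact B0 ->
    measurable_fun [set: borel G] (fun x => mu [set y | A x /\ B0 (y * x)%g]).
  move=> oB0 sB0.
  apply: (measurable_section1 (haar_sigma_finite G_lc G_cg mu_haar)
    (E := [set p | A p.1 /\ B0 (p.2 * p.1)%g])).
  exact: measurable_right_translate_pairs.
have H1 : mu K * a <= mu B * a'.
  apply: (@le_trans _ _ (mu B1 * a')); last first.
    rewrite lee_wpmul2r ?measure_ge0//.
    by apply: le_measure; rewrite ?inE//; exact: measurable_open.
  rewrite -(haar_right_translate_integral G_lc G_cg mu_haar oA sA oB1 sB1).
  apply: integral_section_ge => //; first exact: mF.
  move=> x Ax; apply: le_measure; rewrite ?inE.
  - exact: compact_borel.
  - rewrite (_ : [set _ | _] = [set y | B1 (y * x)%g]); last first.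
      by apply/seteqP; split => y // [].
    by apply: measurable_right_translate; exact: measurable_open.
  - move=> y Ky; split => //.
    by have [+ _] := NP _ (DN _ (AD' _ Ax)); exact.
have H2 : mu K' * a' <= mu [set y | B' (y * x0)%g] * a.
  apply: (@le_trans _ _ (mu B2 * a')).
    rewrite lee_wpmul2r ?measure_ge0//.
    by apply: le_measure; rewrite ?inE//; [exact: compact_borel|exact: measurable_open].
  rewrite -(haar_right_translate_integral G_lc G_cg mu_haar oA sA oB2 sB2).
  apply: integral_section_le => //; first exact: mF.
  - move=> x; have [Ax|nAx] := pselect (A x); last first.
      rewrite (_ : [set _ | _] = set0) ?measure0//.
      by apply/seteqP; split => y // [].
    apply: le_measure; rewrite ?inE.
    + rewrite (_ : [set _ | _] = [set y | B2 (y * x)%g]); last first.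
        by apply/seteqP; split => y // [].
      by apply: measurable_right_translate; exact: measurable_open.
    + by apply: measurable_right_translate; exact: measurable_open.
    + move=> y [_ /B2C /interior_subset] Cyx.
      have [_ /(_ _ Cyx)] := NP _ (DN _ (AD' _ Ax)).
      by rewrite /= mulgA mulgK.
  - move=> x nAx; rewrite (_ : [set _ | _] = set0) ?measure0//.
    by apply/seteqP; split => y // [].
rewrite -(@lee_pmul2r _ (a * a')); last 2 first.
- by rewrite fin_numM.
- by rewrite mule_gt0.
have := lee_pmul (mule_ge0 (measure_ge0 _ _) (ltW a0))
  (mule_ge0 (measure_ge0 _ _) (ltW a'0)) H1 H2.
by rewrite muleACA [leRHS]muleACA [X in _ <= _ * X]muleC.
Unshelve. all: by end_near.
Qed.

Lemma haar_right_ratio_le B B' x0 : open B -> open B' ->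
  mu [set y | B (y * x0)%g] * mu B' <= mu B * mu [set y | B' (y * x0)%g].
Proof.
move=> oB oB'.
have oBx : open [set y | B (y * x0)%g].
  by apply: (open_preimage (f := fun y => y * x0)%g) => //; exact: continuous_mulr.
rewrite (haar_inner mu_haar oBx); apply: ereal_sup_mule_le => //.
- by exists (mu set0), set0 => //; split => //; exact: compact0.
- by move=> _ [K _ <-].
move=> _ [K [cK KB] <-].
rewrite muleC (haar_inner mu_haar oB'); apply: ereal_sup_mule_le => //.
- by exists (mu set0), set0 => //; split => //; exact: compact0.
- by move=> _ [K' _ <-].
move=> _ [K' [cK' KB'] <-]; rewrite muleC.
exact: haar_right_ratio_compact.
Qed.

Lemma haar_right_ratio B B' x0 : open B -> open B' ->
  mu [set y | B (y * x0)%g] * mu B' = mu B * mu [set y | B' (y * x0)%g].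
Proof.
move=> oB oB'; apply/eqP; rewrite eq_le haar_right_ratio_le//=.
by rewrite muleC [leRHS]muleC; exact: haar_right_ratio_le.
Qed.

Lemma set_expgD K m n x y :
  set_expg K m x -> set_expg K n y -> set_expg K (m + n) (x * y)%g.
Proof.
elim: m x => [|m IH] x /=; first by move=> ->; rewrite mul1g.
move=> [a Ka [b Kb <-]] Ky; exists a => //; exists (b * y)%g; last by rewrite mulgA.
exact: IH.
Qed.

Lemma set_expgX K m n x : set_expg K m x -> set_expg K (m * n) (x ^+ n)%g.
Proof.
move=> Kx; elim: n => [|n IH]; first by rewrite muln0.
by rewrite mulnS expgS; exact: set_expgD.
Qed.

Hypothesis G_pg : polynomial_growth mu.

(** By [haar_right_ratio] the ratio [d] does not depend on the open set chosen and is a positive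
    character. Polynomial growth bounds its powers, so [growth_le1] gives d <= 1 everywhere, and d y
    * d y^-1 = 1 forces d = 1. *)
Lemma haar_unimodular_open B x : open B -> mu [set y | B (y * x)%g] = mu B.
Proof.
move=> oB; have [U [C0 [Q [nU [V UV [cV _]] GU mU]]]] := G_pg.
pose B0 := U^°; have oB0 : open B0 by exact: open_interior.
have B0V : B0 `<=` V by move=> y /interior_subset; exact: UV.
have oBx y : open [set z | B0 (z * y)%g].
  by apply: (open_preimage (f := fun z => z * y)%g) => //; exact: continuous_mulr.
pose D y := mu [set z | B0 (z * y)%g].
have Dgt0 y : 0 < D y.
  apply: (haar_open_gt0 G_cg mu_haar) => //.
  by exists y^-1%g; rewrite /= mulVg.
have Dlty y : D y < +oo.
  have cVy : compact ((fun z => z * y^-1)%g @` V).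
    by apply: continuous_compact => //; apply: continuous_subspaceT; exact: continuous_mulr.
  apply: (le_lt_trans _ (haar_compact mu_haar cVy)); apply: le_measure; rewrite ?inE.
  - exact: measurable_open.
  - exact: compact_borel.
  - by move=> z /= /B0V Vz; exists (z * y)%g; rewrite ?mulgK.
have Dfin y : D y \is a fin_num by rewrite ge0_fin_numE// ltW.
have D1 : D 1%g = mu B0.
  by congr (mu _); apply/seteqP; split => z /=; rewrite mulg1.
pose d y := (fine (D y) / fine (D 1%g))%R.
have fD1 : (0 < fine (D 1%g))%R by rewrite fine_gt0// Dgt0 Dlty.
have d_gt0 y : (0 < d y)%R by rewrite divr_gt0// fine_gt0// Dgt0 Dlty.
have dE y : fine (D y) = (d y * fine (D 1%g))%R by rewrite /d divfK// gt_eqF.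
have dM y z : d (y * z)%g = (d y * d z)%R.
  have := haar_right_ratio y (oBx z) oB0; rewrite -D1 -/(D y) -/(D z).
  rewrite (_ : mu _ = D (y * z)%g); last first.
    by congr (mu _); apply/seteqP; split => t /=; rewrite mulgA.
  move=> /(congr1 fine); rewrite !fineM// (dE (y * z)%g) (dE z) (dE y) => h.
  apply: (mulIf (lt0r_neq0 fD1)); apply: (mulIf (lt0r_neq0 fD1)).
  by rewrite h; ring.
have d1 : d 1%g = 1%R by rewrite /d divff// gt_eqF.
have dX y n : d (y ^+ n)%g = (d y ^+ n)%R.
  by elim: n => [|n IH]; rewrite ?expg0 ?expr0// expgS exprS dM IH.
have d_le1 y : (d y <= 1)%R.
  have : [set: G] y^-1%g by [].
  rewrite -GU => -[k _ Uk].
  pose N := (Num.truncn `|Q|).+1.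
  apply: (@growth_le1 _ (d y) (2 ^+ N) (`|C0| * (k.+1%:R) ^+ N / fine (D 1%g)))%R.
  - exact: ltW.
  - by rewrite exprn_gt0.
  move=> j; rewrite -dX -(ler_pM2r fD1) -dE mulrAC divfK ?gt_eqF//.
  (* [D (y ^+ n)] is the measure of B0 y^-n. Since y^-1 lies in U^k and [B0] in [U], this set is
     contained in U^(k n + 1). *)
  have mDn n : (0 < n)%N -> D (y ^+ n)%g <= (C0 * (k * n).+1%:R `^ Q)%:E.
    move=> n0; apply: le_trans (mU (k * n).+1 _) => //.
    rewrite /D -measurable_mu_extE; last exact: measurable_open.
    apply: le_mu_ext => z /= B0z.
    exists (z * y ^+ n)%g; first exact: interior_subset.
    exists (y^-1 ^+ n)%g; first by apply: set_expgX.
    by rewrite expVgn mulgK.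
  have := mDn (2 ^ j)%N; rewrite expn_gt0 => /(_ isT) h.
  rewrite -lee_fin fineK//; apply: (le_trans h); rewrite lee_fin.
  apply: (@le_trans _ _ (`|C0| * (k * 2 ^ j).+1%:R `^ Q))%R.
    by rewrite ler_wpM2r ?powR_ge0// ler_norm.
  rewrite -[leRHS]mulrA ler_wpM2l//.
  apply: (@le_trans _ _ ((k * 2 ^ j).+1%:R `^ N%:R))%R.
    rewrite ler_powR ?ler1n//; apply: (le_trans (ler_norm _)).
    by apply/ltW; rewrite truncnS_gt.
  rewrite powR_mulrn// -(exprM _ N j) (mulnC N) (exprM _ _ N) -exprMn lerXn2r ?nnegrE//.
  by rewrite -natrX -natrM ler_nat mulSn -add1n leq_add// expn_gt0.
have de y : d y = 1%R.
  apply/eqP; rewrite eq_le d_le1//= -d1 -(mulgV y) dM -[leRHS]mulr1.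
  by rewrite ler_pM2l.
have := haar_right_ratio x oB oB0; rewrite -D1 -/(D x).
have -> : D x = D 1%g.
  by rewrite -(fineK (Dfin x)) -(fineK (Dfin 1%g)) dE de mul1r.
by rewrite muleC [RHS]muleC; exact: muleI_fin.
Qed.

Let mu_outer_le A (phi : G -> G) : measurable (A : set (borel G)) ->
  continuous phi -> (forall O, open O -> mu [set y | O (phi y)] = mu O) ->
  mu [set y | A (phi y)] <= mu A.
Proof.
move=> mA cphi phiO; rewrite (haar_outer mu_haar mA).
apply: le_ereal_inf_tmp => _ [ O [oO AO] <-]; rewrite -(phiO _ oO).
apply: le_measure; rewrite ?inE.
- by rewrite -[X in measurable X]setTI; exact: (measurable_fun_continuous cphi).
- by apply: measurable_open; apply: open_preimage.
- by move=> y /=; exact: AO.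
Qed.

(** With right invariance, [haar_right_translate_integral] reads mu B * mu A = mu B * mu A^-1 for
    open sigma-compact sets. A set [B] of finite positive measure cancels; inner regularity extends
    the identity to open sets, outer regularity to measurable ones. *)
Lemma haar_invg A : measurable (A : set (borel G)) ->
  mu [set y | A y^-1%g] = mu A.
Proof.
have [D [cD nD _]] := compact_nbhs_in G_lc openT (Logic.I : [set: G] 1%g).
have [B [oB sB B1 BD]] : exists B, [/\ open B, sigma_compact B,
    [set 1%g] `<=` B & B `<=` D^°].
  by apply: sigma_compact_between => //; [exact: compact_set1|exact: open_interior|move=> _ ->].
have muB0 : 0 < mu B.
  by apply: (haar_open_gt0 G_cg mu_haar) => //; exists 1%g; exact: B1.
have muBfin : mu B \is a fin_num.
  rewrite ge0_fin_numE//; apply: (le_lt_trans _ (haar_compact mu_haar cD)).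
  apply: le_measure; rewrite ?inE//; [exact: measurable_open|exact: compact_borel|].
  by move=> x /BD /interior_subset.
have H1 A' : open A' -> sigma_compact A' -> mu [set y | A' y^-1%g] = mu A'.
  move=> oA sA; have := haar_right_translate_integral G_lc G_cg mu_haar oA sA oB sB.
  rewrite (_ : (fun _ => _) = fun x : borel G => mu B * (\1_A' x)%:E); last first.
    apply/funext => x; rewrite indicE; have [|] := boolP (x \in A').
      rewrite inE mule1 => Ax; rewrite -(haar_unimodular_open x oB).
      by congr (mu _); apply/seteqP; split => y // [].
    rewrite notin_setE mule0 => nAx.
    by rewrite (_ : [set _ | _] = set0) ?measure0//; apply/seteqP; split => y // [].
  rewrite ge0_integralZl//; last first.
    by apply/measurable_EFinP; apply: measurable_indic; exact: measurable_open.
  rewrite integral_indic//; last exact: measurable_open.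
  by rewrite setIT => /esym; exact: muleI_fin.
(* One inequality is enough, because inversion is an involution. *)
have H2 O : open O -> mu [set y | O y^-1%g] <= mu O.
  move=> oO; have oO' : open [set y | O y^-1%g].
    by apply: (open_preimage (f := fun y => y^-1)%g) => //; exact: invg_continuous.
  rewrite (haar_inner mu_haar oO'); apply: ge_ereal_sup => _ [K [cK KO] <-].
  have cK' : compact ((fun y => y^-1)%g @` K).
    by apply: continuous_compact => //; apply: continuous_subspaceT; exact: invg_continuous.
  have [A' [oA' sA' KA' AO]] : exists A', [/\ open A', sigma_compact A',
      (fun y => y^-1)%g @` K `<=` A' & A' `<=` O].
    by apply: sigma_compact_between => // _ [y /KO Oy <-].
  apply: (@le_trans _ _ (mu [set y | A' y^-1%g])).
    apply: le_measure; rewrite ?inE; first exact: compact_borel.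
      by apply: measurable_inverse; exact: measurable_open.
    by move=> y Ky /=; apply: KA'; exists y.
  by rewrite H1//; apply: le_measure; rewrite ?inE//; exact: measurable_open.
have H3 O : open O -> mu [set y | O y^-1%g] = mu O.
  move=> oO; apply/eqP; rewrite eq_le H2//=.
  rewrite [leLHS](_ : _ = mu [set z | [set y | O y^-1%g] z^-1%g]); last first.
    by congr (mu _); apply/seteqP; split => z /=; rewrite invgK.
  apply: H2; apply: (open_preimage (f := fun y => y^-1)%g) => //.
  exact: invg_continuous.
have H4 B' : measurable (B' : set (borel G)) -> mu [set y | B' y^-1%g] <= mu B'.
  move=> mB'; apply: (mu_outer_le (phi := fun z => z^-1)%g) => //.
  exact: invg_continuous.
move=> mA; apply/eqP; rewrite eq_le H4//=.
rewrite [leLHS](_ : _ = mu [set z | [set y | A y^-1%g] z^-1%g]); last first.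
  by congr (mu _); apply/seteqP; split => z /=; rewrite invgK.
by apply: H4; exact: measurable_inverse.
Qed.

(* The set {(z, y) | z^-1 y in B} need not belong to the product sigma-algebra
   when G is not second countable, but it differs from a member of it by a set
   all of whose sections are null. *)
Definition sections_ae_eq (E E' : set (borel G * borel G)) :=
  (forall y, {ae mu, forall z : borel G, E (z, y) <-> E' (z, y)}) /\
  (forall z, {ae mu, forall y : borel G, E (z, y) <-> E' (z, y)}).

(** [O] may have infinite measure, so it is cut by the interiors of compact sets [D n] that exhaust
    [G]. In each piece of finite measure, inner regularity provides open sigma-compact subsets whose
    complement has measure at most 1/(m + 1). *)
Lemma open_inner_approximation O : open O ->
  exists2 B : nat -> set G, (forall n, [/\ open (B n), sigma_compact (B n) & B n `<=` O]) &
    mu (O `\` \bigcup_n B n) = 0.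
Proof.
move=> oO.
have [K cK KT] := compactly_generated_sigma_compact G_cg.
have /choice [D DP] n : exists D, [/\ compact D & K n `<=` D^°].
  have [D [cD KD _]] := compact_between G_lc (cK n) openT (@subsetT _ _).
  by exists D.
have oOD n : open (O `&` (D n)^°) by apply: openI => //; exact: open_interior.
have finOD n : mu (O `&` (D n)^°) \is a fin_num.
  have [cD _] := DP n.
  rewrite ge0_fin_numE//; apply: (le_lt_trans _ (haar_compact mu_haar cD)).
  apply: le_measure; rewrite ?inE//; [exact: measurable_open|exact: compact_borel|].
  by move=> x [_ /interior_subset].
have /choice [B BP] (p : nat * nat) : exists B, [/\ open B, sigma_compact B,
    B `<=` O `&` (D p.1)^° & mu (O `&` (D p.1)^° `\` B) <= (p.2.+1%:R^-1)%:E].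
  have e0 : (0 < p.2.+1%:R^-1 :> R)%R by rewrite invr_gt0.
  have := ub_ereal_sup_adherent e0; move: (finOD p.1).
  rewrite (haar_inner mu_haar (oOD p.1)) => + /(_ [set mu K | K in [set K | compact K /\ K `<=` O `&` (D p.1)^°]]).
  move=> fn /(_ fn) [_ [K' [cK' K'O] <-]]; rewrite -(haar_inner mu_haar (oOD p.1)) => lt.
  have [B [oB sB KB BO]] := sigma_compact_between G_lc cK' (oOD p.1) K'O.
  have mB := measurable_open oB.
  exists B; split => //; rewrite measureD//; last 2 first.
  - exact: measurable_open.
  - by rewrite -ge0_fin_numE// finOD.
  rewrite (setIidr BO).
  apply: (@le_trans _ _ (mu (O `&` (D p.1)^°) - mu K')).
    rewrite leeB//; apply: le_measure; rewrite ?inE//; exact: compact_borel.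
  rewrite leeBlDr; last first.
    rewrite ge0_fin_numE//; exact: (haar_compact mu_haar).
  by rewrite addeC -leeBlDr//; exact: ltW.
pose b k := if unpickle k is Some p then B p else set0.
exists b.
  move=> k; rewrite /b; case: (unpickle k) => [p|].
    have [oB sB BO _] := BP p; split => //.
    by move=> x /BO [].
  split => //; first exact: open0.
  by exists (fun=> set0) => [n|]; [exact: compact0|rewrite bigcup0].
have mb : measurable (\bigcup_n b n : set (borel G)).
  apply: bigcupT_measurable => k; rewrite /b; case: (unpickle k) => [p|//].
  by have [oB _ _ _] := BP p; exact: measurable_open.
apply/eqP; rewrite -measure_le0.
have mN n : measurable ((O `&` (D n)^°) `\` \bigcup_n b n : set (borel G)).
  by apply: measurableD => //; exact: measurable_open.
apply: (le_trans (measure_sigma_subadditive mu mN _ _)).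
- by apply: measurableD => //; exact: measurable_open.
- move=> x [Ox nb]; have : [set: G] x by [].
  by rewrite KT => -[n _ Kx]; exists n => //; split => //; split => //; have [_] := DP n; exact.
rewrite eseries0// => n _ _; apply/eqP; rewrite -measure_le0.
apply/lee_addgt0Pr => e e0; rewrite add0e.
have [m mP] : exists m : nat, (m.+1%:R^-1 <= e)%R.
  exists (Num.truncn e^-1); rewrite invf_ple ?posrE//.
  by apply/ltW; rewrite truncnS_gt.
have [oB sB BO /le_trans] := BP (n, m); rewrite -lee_fin in mP; move=> /(_ _ mP).
apply: le_trans; apply: le_measure; rewrite ?inE//.
- by apply: measurableD; exact: measurable_open.
- apply: setDS => x Bx; exists (pickle (n, m)) => //.
  by rewrite /b pickleK.
Qed.

(** The sets [B] with this property form a sigma-algebra, and it contains the open sets: up to a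
    null set N, an open set is a countable union of open sigma-compact ones. The sections of the
    exceptional set are a translate of N in one variable and a translate of N^-1 in the other, so
    invariance under inversion is what makes both null. *)
Lemma left_quotient_ae_product B : measurable (B : set (borel G)) ->
  exists2 E : set (borel G * borel G), measurable E &
    sections_ae_eq [set p | B (p.1^-1 * p.2)%g] E.
Proof.
pose S : set (set (borel G)) := [set B | exists2 E : set (borel G * borel G),
  measurable E & sections_ae_eq [set p | B (p.1^-1 * p.2)%g] E].
suff /(_ B) : measurable `<=` S by [].
apply: smallest_sub.
  split.
  - exists set0 => //; split=> y; exact: nearW.
  - move=> A [E mE [E1 E2]]; exists (~` E); first exact: measurableC.
    by split => y; [apply: filterS (E1 y)|apply: filterS (E2 y)] => z;
      rewrite /= => zE; split => [[_ nA]|nE]; [move=> /zE|split => // /zE|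
        move=> /zE|split => // /zE].
  - move=> F FS.
    have /choice [E EP] n : exists E : set (borel G * borel G), measurable E /\
        sections_ae_eq [set p | F n (p.1^-1 * p.2)%g] E.
      by have [E] := FS n; exists E.
    exists (\bigcup_n E n); first by apply: bigcupT_measurable => n; exact: (EP n).1.
    split => y.
      have h : {ae mu, forall z : borel G, forall n, F n (z^-1 * y)%g <-> E n (z, y)}.
        by apply: ae_foralln => n; have [_ [h _]] := EP n; exact: h.
      by apply: filterS h => z zE; split => -[n _ /zE]; exists n.
    have h : {ae mu, forall z : borel G, forall n, F n (y^-1 * z)%g <-> E n (y, z)}.
      by apply: ae_foralln => n; have [_ [_ h]] := EP n; exact: h.
    by apply: filterS h => z zE; split => -[n _ /zE]; exists n.
move=> O oO; have [B' BP BO] := open_inner_approximation oO.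
have mB : measurable (\bigcup_n B' n : set (borel G)).
  by apply: bigcupT_measurable => n; apply: measurable_open; have [] := BP n.
have mN : measurable (O `\` \bigcup_n B' n : set (borel G)).
  by apply: measurableD => //; exact: measurable_open.
exists [set p | (\bigcup_n B' n) (p.1^-1 * p.2)%g].
  rewrite (_ : [set _ | _] = \bigcup_n [set p | B' n (p.1^-1 * p.2)%g])//.
  apply: bigcupT_measurable => n; have [oB sB _] := BP n.
  exact: measurable_left_quotient.
have BO' : \bigcup_n B' n `<=` O by move=> x [n _]; have [_ _] := BP n; exact.
have OB q : ~ (O q <-> (\bigcup_n B' n) q) -> (O `\` \bigcup_n B' n) q.
  move=> h; split; first by apply: contrapT => nO; apply: h; split => [/nO|/BO' /nO].
  by move=> Bq; apply: h; split => // _; exact: BO'.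
split => y.
  exists [set z | (O `\` \bigcup_n B' n) (y^-1 * z)^-1%g]; split.
  - rewrite (_ : [set _ | _] = (fun z => y^-1 * z)%g @^-1`
      [set z | (O `\` \bigcup_n B' n) z^-1%g])//.
    rewrite -[X in measurable X]setTI; apply: measurable_mull => //.
    exact: measurable_inverse.
  - rewrite (haar_preimage mu_haar y^-1%g (measurable_inverse mN)).
    by rewrite haar_invg.
  - by move=> z /= /OB; rewrite invgM invgK.
exists [set z | (O `\` \bigcup_n B' n) (y^-1 * z)%g]; split.
- rewrite -[X in measurable X]setTI; exact: measurable_mull.
- by rewrite (haar_preimage mu_haar y^-1%g mN).
- by move=> z /= /OB.
Qed.

(** A real function is the supremum of the rationals below it, so [left_quotient_ae_product] is
    applied to the countably many sets {g > r}. Their null sections add up to a null set, on which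
    [fine] still gives a real value. *)
Lemma left_quotient_fun_ae_product (g : borel G -> R) : measurable_fun setT g ->
  exists g' : borel G * borel G -> R, [/\ measurable_fun setT g',
    forall y, {ae mu, forall z, g' (z, y) = g (z^-1 * y)%g} &
    forall z, {ae mu, forall y, g' (z, y) = g (z^-1 * y)%g}].
Proof.
move=> mg.
have /choice [E EP] (r : rat) : exists E : set (borel G * borel G), measurable E /\
    sections_ae_eq [set p | ratr r < g (p.1^-1 * p.2)%g]%R E.
  have mB : measurable ([set x | ratr r < g x]%R : set (borel G)).
    rewrite -[X in measurable X]setTI (_ : [set x | _] = g @^-1` `]ratr r, +oo[%classic).
      exact: mg.
    by apply/seteqP; split => x /=; rewrite in_itv/= andbT.
  by have [E mE EE] := left_quotient_ae_product mB; exists E.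
pose F n p : \bar R := if unpickle n is Some r then
  if p \in E r then (ratr r)%:E else -oo else -oo.
have mF n : measurable_fun setT (F n).
  rewrite /F; case: (unpickle n) => [r|]; last exact: measurable_cst.
  apply: measurable_fun_ifT => //.
  apply: (measurable_fun_bool true); rewrite setTI.
  rewrite (_ : _ @^-1` _ = E r); first exact: (EP r).1.
  by apply/seteqP; split => p; [exact: set_mem|exact: mem_set].
pose e p := esups (F ^~ p) 0%N.
have me : measurable_fun setT e by exact: measurable_fun_esups.
have eE z y : (forall r, (ratr r < g (z^-1 * y)%g)%R <-> E r (z, y)) ->
    fine (e (z, y)) = g (z^-1 * y)%g.
  move=> h; rewrite (_ : e (z, y) = (g (z^-1 * y)%g)%:E)//.
  apply/eqP; rewrite eq_le; apply/andP; split.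
    apply: ge_ereal_sup => _ [n _ <-]; rewrite /F.
    case: (unpickle n) => [r|]; last exact: leNye.
    by case: ifPn => [/[!inE] /h/ltW|_]; [rewrite lee_fin|exact: leNye].
  apply/lee_addgt0Pr => d d0.
  have [r] : exists r : rat, ratr r \in `]g (z^-1 * y)%g - d, g (z^-1 * y)%g[%R.
    by apply: rat_in_itvoo; rewrite gtrBl.
  rewrite in_itv/= => /andP[dr rg].
  apply: (@le_trans _ _ ((ratr r)%:E + d%:E)).
    by rewrite -EFinD lee_fin -lerBlDr ltW.
  apply: leeD => //; apply: ereal_sup_ubound; exists (pickle r) => //.
  by rewrite /F pickleK ifT// inE; exact/h.
exists (fine \o e); split.
- exact: (measurableT_comp (fine_measurable measurableT)).
- move=> y; have h : {ae mu, forall z : borel G, forall n : nat,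
      if unpickle n is Some r then (ratr r < g (z^-1 * y)%g)%R <-> E r (z, y) else True}.
    apply: ae_foralln => n; case: (unpickle n) => [r|]; last exact: nearW.
    by have [_ [h _]] := EP r; exact: h.
  apply: filterS h => z h; apply: eE => r.
  by have := h (pickle r); rewrite pickleK.
- move=> z; have h : {ae mu, forall y : borel G, forall n : nat,
      if unpickle n is Some r then (ratr r < g (z^-1 * y)%g)%R <-> E r (z, y) else True}.
    apply: ae_foralln => n; case: (unpickle n) => [r|]; last exact: nearW.
    by have [_ [_ h]] := EP r; exact: h.
  apply: filterS h => y h; apply: eE => r.
  by have := h (pickle r); rewrite pickleK.
Qed.

End HaarUnimodular.

(** * Complex-valued functions *)

Local Notation nc := Normc.normc.

Section NormC.
Context (R : realType).
Implicit Types (x y : R[i]).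

Lemma Re_addc x y : complex.Re (x + y) = complex.Re x + complex.Re y.
Proof. by case: x => ? ?; case: y. Qed.

Lemma Im_addc x y : complex.Im (x + y) = complex.Im x + complex.Im y.
Proof. by case: x => ? ?; case: y. Qed.

Lemma Re_mulc x y : complex.Re (x * y) =
  complex.Re x * complex.Re y - complex.Im x * complex.Im y.
Proof. by case: x => ? ?; case: y. Qed.

Lemma Im_mulc x y : complex.Im (x * y) =
  complex.Re x * complex.Im y + complex.Im x * complex.Re y.
Proof. by case: x => ? ?; case: y. Qed.

Lemma normc_sqrt x : nc x = Num.sqrt (complex.Re x ^+ 2 + complex.Im x ^+ 2).
Proof. by case: x. Qed.

Lemma normr_normc x : `|x| = (nc x)%:C.
Proof. by rewrite normc_def normc_sqrt. Qed.

Lemma normc_ge0 x : 0 <= nc x. Proof. by rewrite normc_sqrt sqrtr_ge0. Qed.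

Lemma normc_conj x : nc x^* = nc x.
Proof. by case: x => a b /=; rewrite sqrrN. Qed.

Lemma normc_real (a : R) : nc a%:C = `|a|.
Proof. by rewrite /= expr0n addr0 sqrtr_sqr. Qed.

Lemma normc_sqr x : nc x ^+ 2 = complex.Re x ^+ 2 + complex.Im x ^+ 2.
Proof. by rewrite normc_sqrt sqr_sqrtr// addr_ge0// sqr_ge0. Qed.

Lemma Re_le_normc x : `|complex.Re x| <= nc x.
Proof. by rewrite normc_sqrt -sqrtr_sqr ler_wsqrtr// lerDl sqr_ge0. Qed.

Lemma Im_le_normc x : `|complex.Im x| <= nc x.
Proof. by rewrite normc_sqrt -sqrtr_sqr ler_wsqrtr// lerDr sqr_ge0. Qed.

Lemma conjc_mul_self x : x * x^* = ((nc x) ^+ 2)%:C.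
Proof. by rewrite normc_sqr; case: x => a b; simpc; congr (_ +i* _); ring. Qed.

End NormC.

Section ComplexFunctions.
Variables (R : realType) (G : topologicalGroupType).
Variable mu : {measure set (borel G) -> \bar R}.
Implicit Types (f g : G -> R[i]).

Lemma measurable_normc f : Cmeasurable f ->
  measurable_fun [set: borel G] (fun x : borel G => nc (f x)).
Proof.
move=> [mr mi]; rewrite (_ : (fun _ => _) = fun x => Num.sqrt
  (complex.Re (f x) ^+ 2 + complex.Im (f x) ^+ 2)); last first.
  by apply/funext => x; rewrite normc_sqrt.
apply: measurableT_comp; first by apply: continuous_measurable_fun; exact: sqrt_continuous.
by apply: measurable_funD; exact: measurable_funX.
Qed.

Lemma measurable_normc_EFin f : Cmeasurable f ->
  measurable_fun [set: borel G] (fun x : borel G => (nc (f x))%:E).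
Proof. by move=> mf; apply/measurable_EFinP; exact: measurable_normc. Qed.

Lemma CmeasurableD f g : Cmeasurable f -> Cmeasurable g ->
  Cmeasurable (fun x => f x + g x).
Proof.
move=> [fr fi] [gr gi]; split.
  by under eq_fun do rewrite Re_addc; exact: measurable_funD.
by under eq_fun do rewrite Im_addc; exact: measurable_funD.
Qed.

Lemma CmeasurableM f g : Cmeasurable f -> Cmeasurable g ->
  Cmeasurable (fun x => f x * g x).
Proof.
move=> [fr fi] [gr gi]; split.
  by under eq_fun do rewrite Re_mulc; apply: measurable_funB; exact: measurable_funM.
by under eq_fun do rewrite Im_mulc; apply: measurable_funD; exact: measurable_funM.
Qed.

Lemma Cmeasurable_cst (z : R[i]) : Cmeasurable (fun _ : G => z).
Proof. by split; exact: measurable_cst. Qed.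

Lemma CmeasurableZ (z : R[i]) f : Cmeasurable f -> Cmeasurable (fun x => z * f x).
Proof. by move=> mf; apply: CmeasurableM => //; exact: Cmeasurable_cst. Qed.

Lemma CmeasurableB f g : Cmeasurable f -> Cmeasurable g ->
  Cmeasurable (fun x => f x - g x).
Proof.
move=> mf /(CmeasurableZ (-1)) mg; have := CmeasurableD mf mg.
by under eq_fun do rewrite mulN1r.
Qed.

Lemma Cmeasurable_conj f : Cmeasurable f -> Cmeasurable (fun x => (f x)^*).
Proof.
move=> [fr fi]; split.
  by rewrite (_ : (fun _ => _) = fun x => complex.Re (f x))//; apply/funext => x; case: (f x).
rewrite (_ : (fun _ => _) = fun x => - complex.Im (f x)); last first.
  by apply/funext => x; case: (f x).
exact: measurableT_comp.
Qed.

Lemma Cmeasurable_comp f (phi : G -> G) :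
  measurable_fun [set: borel G] (phi : borel G -> borel G) ->
  Cmeasurable f -> Cmeasurable (fun x => f (phi x)).
Proof.
by move=> mphi [fr fi]; split; [exact: (measurableT_comp fr mphi)|exact: (measurableT_comp fi mphi)].
Qed.

Lemma Cmeasurable_real (h : G -> R) :
  measurable_fun [set: borel G] (h : borel G -> R) -> Cmeasurable (fun x => (h x)%:C).
Proof. by move=> mh; split => //=; exact: measurable_cst. Qed.

Definition Cintegrable f :=
  Cmeasurable f /\ (\int[mu]_x (nc (f x))%:E < +oo)%E.

Lemma Cintegrable_Re f : Cintegrable f ->
  mu.-integrable [set: borel G] (EFin \o (fun x => complex.Re (f x))).
Proof.
move=> [mf fy]; have [mr mi] := mf; apply/integrableP; split.
  exact/measurable_EFinP.
apply: le_lt_trans fy; apply: ge0_le_integral => //.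
- by apply: measurableT_comp => //; exact/measurable_EFinP.
- exact: measurable_normc_EFin.
- by move=> x _; rewrite lee_fin Re_le_normc.
Qed.

Lemma Cintegrable_Im f : Cintegrable f ->
  mu.-integrable [set: borel G] (EFin \o (fun x => complex.Im (f x))).
Proof.
move=> [mf fy]; have [mr mi] := mf; apply/integrableP; split.
  exact/measurable_EFinP.
apply: le_lt_trans fy; apply: ge0_le_integral => //.
- by apply: measurableT_comp => //; exact/measurable_EFinP.
- exact: measurable_normc_EFin.
- by move=> x _; rewrite lee_fin Im_le_normc.
Qed.

Lemma CintegralD f g : Cintegrable f -> Cintegrable g ->
  Cintegral mu (fun x => f x + g x) = Cintegral mu f + Cintegral mu g.
Proof.
move=> If Ig; rewrite /Cintegral; simpc; congr (_ +i* _).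
- under eq_Rintegral do rewrite Re_addc.
  by rewrite RintegralD//; exact: Cintegrable_Re.
- under eq_Rintegral do rewrite Im_addc.
  by rewrite RintegralD//; exact: Cintegrable_Im.
Qed.

(* No integrability is needed when z = 0, because Cintegral is total. *)
Lemma CintegralZ (z : R[i]) f : Cmeasurable f ->
  (\int[mu]_x (nc (z * f x))%:E < +oo)%E ->
  Cintegral mu (fun x => z * f x) = z * Cintegral mu f.
Proof.
move=> mf zf; have [->|z0] := eqVneq z 0.
  rewrite mul0r /Cintegral; under eq_Rintegral do rewrite mul0r /=.
  under [X in _ +i* X]eq_Rintegral do rewrite mul0r /=.
  by rewrite /Rintegral integral0.
have If : Cintegrable f.
  split => //; rewrite (_ : (fun _ => _) = fun x => ((nc z)^-1)%:E * (nc (z * f x))%:E)%E; last first.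
    apply/funext => x; rewrite -EFinM Normc.normcM mulKf//.
    by apply: contra z0 => /eqP/Normc.eq0_normc ->.
  rewrite ge0_integralZl_EFin//.
  - by rewrite lte_mul_pinfty// lee_fin invr_ge0 normc_ge0.
  - by move=> x _; rewrite lee_fin normc_ge0.
  - by apply: measurable_normc_EFin; exact: CmeasurableZ.
  - by rewrite invr_ge0 normc_ge0.
have Ir := Cintegrable_Re If; have Ii := Cintegrable_Im If.
have IZ (h : borel G -> R) (c : R) : mu.-integrable setT (EFin \o h) ->
    mu.-integrable setT (EFin \o (fun x => c * h x)).
  by move=> Ih; exact: (integrableZl measurableT c Ih).
rewrite /Cintegral; case: z {z0 zf} => a b; simpc; congr (_ +i* _).
- rewrite -!RintegralZl// -RintegralB//; last 2 first.
  + exact: IZ.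
  + exact: IZ.
  by apply: eq_Rintegral => x _; case: (f x).
- rewrite -!RintegralZl// -RintegralD//; last 2 first.
  + exact: IZ.
  + exact: IZ.
  by apply: eq_Rintegral => x _; case: (f x).
Qed.

(** Conjugation exchanges the positive and negative parts of the imaginary part. When one of their
    integrals is infinite, [fine] returns 0 on both sides. *)
Lemma Cintegral_conj f :
  Cintegral mu (fun x => (f x)^*) = (Cintegral mu f)^*.
Proof.
rewrite /Cintegral /=; congr (_ +i* _).
  by apply: eq_Rintegral => x _; case: (f x).
transitivity (\int[mu]_x (- complex.Im (f x))).
  by apply: eq_Rintegral => x _; case: (f x).
rewrite /Rintegral integralE [in RHS]integralE.
pose g x := (complex.Im (f x))%:E.
rewrite (_ : (fun x => (- complex.Im (f x))%:E) = (\- g)%E); last first.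
  by apply/funext => x; rewrite /g EFinN.
rewrite funeposN funenegN -/g.
move: (integral _ _ _) (integral _ _ _) => [a| |] [b| |] //=; rewrite ?oppr0//.
by rewrite opprB.
Qed.

(** With I the integral of f, |I|^2 is the real part of the integral of I^* f, hence at most |I|
    times the integral of |f|; then |I| is cancelled. *)
Lemma normc_Cintegral f : Cmeasurable f ->
  ((nc (Cintegral mu f))%:E <= \int[mu]_x (nc (f x))%:E)%E.
Proof.
move=> mf; have [fy|] := ltP (\int[mu]_x (nc (f x))%:E)%E +oo%E; last first.
  by rewrite leye_eq => /eqP ->; exact: leey.
have If : Cintegrable f by [].
set I := Cintegral mu f.
have [I0|I0] := eqVneq (nc I) 0.
  by rewrite I0; apply: integral_ge0 => x _; rewrite lee_fin normc_ge0.
have Ip : 0 < nc I by rewrite lt0r I0 normc_ge0.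
have mIf : Cmeasurable (fun x => I^* * f x) by exact: CmeasurableZ.
have nE x : (nc (I^* * f x))%:E = ((nc I)%:E * (nc (f x))%:E)%E.
  by rewrite Normc.normcM normc_conj EFinM.
have nIf : (\int[mu]_x (nc (I^* * f x))%:E = (nc I)%:E * \int[mu]_x (nc (f x))%:E)%E.
  under eq_integral do rewrite nE.
  rewrite ge0_integralZl_EFin ?normc_ge0//.
  - by move=> x _; rewrite lee_fin normc_ge0.
  - exact: measurable_normc_EFin.
have Iy : (\int[mu]_x (nc (I^* * f x))%:E < +oo)%E.
  by rewrite nIf lte_mul_pinfty// lee_fin normc_ge0.
rewrite -(@lee_pmul2l _ (nc I)%:E)//.
rewrite -nIf -EFinM -expr2.
have -> : nc I ^+ 2 = complex.Re (Cintegral mu (fun x => I^* * f x)).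
  by rewrite CintegralZ// mulrC conjc_mul_self.
have II : Cintegrable (fun x => I^* * f x) by [].
rewrite /Cintegral /= /Rintegral fineK; last first.
  by apply: integrable_fin_num => //; exact: Cintegrable_Re II.
apply: (le_trans (lee_abs _)); apply: (le_trans (le_abse_integral _ _ _)) => //.
  by apply/measurable_EFinP; exact: mIf.1.
apply: ge0_le_integral => //.
- by apply: measurableT_comp => //; apply/measurable_EFinP; exact: mIf.1.
- exact: measurable_normc_EFin.
- by move=> x _; rewrite lee_fin Re_le_normc.
Qed.

Lemma eq_Cintegral f g : f =1 g -> Cintegral mu f = Cintegral mu g.
Proof. by move=> fg; congr Cintegral; exact/funext. Qed.

(* Functions on G and on borel G have convertible types but distinct canonical
   filters, which defeats the generic lemmas on filters. *)
Lemma aeS (P Q : G -> Prop) : (forall x, P x -> Q x) ->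
  (\forall x \ae mu, P x) -> \forall x \ae mu, Q x.
Proof.
move=> PQ [N [mN N0 NP]]; exists N; split => // x nQ; apply: NP => Px.
by apply: nQ; exact: PQ.
Qed.

Lemma aeI (P Q : G -> Prop) : (\forall x \ae mu, P x) ->
  (\forall x \ae mu, Q x) -> \forall x \ae mu, P x /\ Q x.
Proof.
move=> [N [mN N0 NP]] [M [mM M0 MQ]]; exists (N `|` M); split.
- exact: measurableU.
- apply/eqP; rewrite -measure_le0 (le_trans (measureU2 _ _ _))//.
  by rewrite [X in (X + _)%E]N0 [X in (_ + X)%E]M0 adde0.
- move=> x nPQ; have [Px|] := pselect (P x); last by left; exact: NP.
  by right; apply: MQ => Qx; exact: nPQ.
Qed.

Lemma ae_all_nat (P : nat -> G -> Prop) : (forall n, \forall x \ae mu, P n x) ->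
  \forall x \ae mu, forall n, P n x.
Proof. exact: (ae_foralln (mu := mu)). Qed.

Lemma ae_eq_Cintegral f g : Cmeasurable f -> Cmeasurable g ->
  (\forall x \ae mu, f x = g x) -> Cintegral mu f = Cintegral mu g.
Proof.
move=> [fr fi] [gr gi] fg; rewrite /Cintegral /Rintegral.
by congr (fine _ +i* fine _); apply: ae_eq_integral => //; try exact/measurable_EFinP;
  apply: aeS fg => x -> .
Qed.

End ComplexFunctions.

(** * Weighted norms *)

Section PoweR.
Context (R : realType).
Local Open Scope ereal_scope.

Lemma le_poweR (r : R) (x y : \bar R) : (0 <= r)%R -> 0 <= x -> x <= y ->
  x `^ r <= y `^ r.
Proof.
move=> r0 x0 xy; apply: gt0_ler_poweR => //; rewrite in_itv/= leey andbT//.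
exact: le_trans xy.
Qed.

Lemma poweRK (r : R) (x : \bar R) : r != 0%R -> 0 <= x -> (x `^ r) `^ r^-1 = x.
Proof. by move=> r0 x0; rewrite -poweRrM divff// poweRe1. Qed.

Lemma poweRVK (r : R) (x : \bar R) : r != 0%R -> 0 <= x -> (x `^ r^-1) `^ r = x.
Proof. by move=> r0 x0; rewrite -poweRrM mulVf// poweRe1. Qed.

End PoweR.

Section WeightedNorm.
Variables (R : realType) (G : topologicalGroupType).
Variable mu : {measure set (borel G) -> \bar R}.
Variable p : R.
Hypothesis p_gt0 : 0 < p.
Implicit Types (f g : G -> R[i]) (v : G -> R).
Local Open Scope ereal_scope.

Let p0 : p != 0%R. Proof. by rewrite gt_eqF. Qed.

Definition weight v :=
  measurable_fun [set: borel G] (v : borel G -> R) /\ forall x, (0 <= v x)%R.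

Lemma weight1 : weight (cst 1%R).
Proof. by split => [|x]; [exact: measurable_cst|exact: ler01]. Qed.

Lemma measurable_Lpw_integrand f v : Cmeasurable f -> weight v ->
  measurable_fun [set: borel G] (fun x : borel G => (nc (f x) `^ p * v x `^ p)%:E).
Proof.
move=> mf [mv _]; apply/measurable_EFinP; apply: measurable_funM.
  by apply: (measurableT_comp (measurable_powR p)); exact: measurable_normc.
exact: (measurableT_comp (measurable_powR p)).
Qed.

Lemma Lpw_norm_ge0 f v : 0 <= Lpw_norm mu p v f.
Proof. exact: poweR_ge0. Qed.

Lemma Lpw_integral_ge0 f v : 0 <= \int[mu]_x (nc (f x) `^ p * v x `^ p)%:E.
Proof. by apply: integral_ge0 => x _; rewrite lee_fin mulr_ge0// powR_ge0. Qed.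

Lemma Lpw_normX f v :
  Lpw_norm mu p v f `^ p = \int[mu]_x (nc (f x) `^ p * v x `^ p)%:E.
Proof. by rewrite /Lpw_norm poweRVK// Lpw_integral_ge0. Qed.

Lemma Lpw_norm_ltyP f v : Lpw_norm mu p v f < +oo <->
  \int[mu]_x (nc (f x) `^ p * v x `^ p)%:E < +oo.
Proof.
split; last exact: poweR_lty.
by move=> /(poweR_lty p); rewrite Lpw_normX.
Qed.

Lemma Lpw_norm_Lnorm f v : weight v ->
  Lpw_norm mu p v f = 'N[mu]_p%:E[EFin \o (fun x => nc (f x) * v x)%R].
Proof.
move=> [_ v0]; rewrite -[RHS](@poweRK _ p)// ?Lnorm_ge0// powR_Lnorm//.
congr (_ `^ _); apply: eq_integral => x _ /=.
by rewrite -powRM ?normc_ge0// ger0_norm// mulr_ge0// normc_ge0.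
Qed.

Lemma Lpw_norm_ae_le f g v v' : Cmeasurable f -> Cmeasurable g -> weight v -> weight v' ->
  (\forall x \ae mu, (nc (f x) * v x <= nc (g x) * v' x)%R) ->
  Lpw_norm mu p v f <= Lpw_norm mu p v' g.
Proof.
move=> mf mg wv wv' fg; apply: le_poweR; first by rewrite invr_ge0 ltW.
  exact: Lpw_integral_ge0.
apply: ae_ge0_le_integral => //.
- by move=> x _; rewrite lee_fin mulr_ge0// powR_ge0.
- exact: measurable_Lpw_integrand.
- by move=> x _; rewrite lee_fin mulr_ge0// powR_ge0.
- exact: measurable_Lpw_integrand.
- apply: aeS fg => x fgx _; rewrite lee_fin -!powRM ?normc_ge0//; [|exact: wv'.2|exact: wv.2].
  apply: ge0_ler_powR; rewrite ?nnegrE//; first exact: ltW.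
    by rewrite mulr_ge0 ?normc_ge0//; exact: wv.2.
  by rewrite mulr_ge0 ?normc_ge0//; exact: wv'.2.
Qed.

Lemma Lpw_norm_le f g v v' : Cmeasurable f -> Cmeasurable g -> weight v -> weight v' ->
  (forall x, (nc (f x) * v x <= nc (g x) * v' x)%R) ->
  Lpw_norm mu p v f <= Lpw_norm mu p v' g.
Proof. by move=> mf mg wv wv' fg; apply: Lpw_norm_ae_le => //; exact: nearW. Qed.

Lemma Lpw_norm_ae_eq f g v : Cmeasurable f -> Cmeasurable g -> weight v ->
  (\forall x \ae mu, f x = g x) -> Lpw_norm mu p v f = Lpw_norm mu p v g.
Proof.
move=> mf mg wv fg; apply/eqP; rewrite eq_le; apply/andP; split.
  by apply: Lpw_norm_ae_le => //; apply: aeS fg => x ->.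
by apply: Lpw_norm_ae_le => //; apply: aeS fg => x ->.
Qed.

Lemma Lpw_normZ (z : R[i]) f v : Cmeasurable f -> weight v ->
  Lpw_norm mu p v (fun x => z * f x)%R = (nc z)%:E * Lpw_norm mu p v f.
Proof.
move=> mf wv; rewrite /Lpw_norm.
under eq_integral do rewrite Normc.normcM powRM ?normc_ge0// -mulrA EFinM.
rewrite ge0_integralZl_EFin ?powR_ge0//; last 2 first.
- by move=> x _; rewrite lee_fin mulr_ge0// powR_ge0.
- exact: measurable_Lpw_integrand.
rewrite poweRM ?lee_fin ?powR_ge0 ?Lpw_integral_ge0//.
by rewrite poweR_EFin -powRrM divff// powRr1// normc_ge0.
Qed.

Lemma Lpw_norm_eq0 f v : Cmeasurable f -> weight v -> (forall x, (0 < v x)%R) ->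
  Lpw_norm mu p v f = 0 -> \forall x \ae mu, f x = 0%R.
Proof.
move=> mf wv v0 N0; have := Lpw_normX f v; rewrite N0 poweR0r// => /esym I0.
have := (ae_eq_integral_abs mu measurableT (measurable_Lpw_integrand mf wv)).1.
under eq_integral do rewrite gee0_abs ?lee_fin ?mulr_ge0 ?powR_ge0//.
move=> /(_ I0); apply: aeS => x /(_ Logic.I) [] /eqP.
rewrite mulf_eq0 => /orP[|]; rewrite powR_eq0 => /andP[/eqP h _].
  exact: Normc.eq0_normc.
by have := v0 x; rewrite h ltxx.
Qed.

Lemma Lpw_norm0 v : Lpw_norm mu p v (fun=> 0%R) = 0.
Proof.
rewrite /Lpw_norm; under eq_integral do rewrite Normc.normc0 powR0// mul0r.
by rewrite integral0 poweR0r// invr_eq0.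
Qed.

Lemma Lpw_normD f g v : (1 <= p)%R -> Cmeasurable f -> Cmeasurable g -> weight v ->
  Lpw_norm mu p v (fun x => f x + g x)%R <= Lpw_norm mu p v f + Lpw_norm mu p v g.
Proof.
move=> p1 mf mg wv; have [mv v0] := wv.
have mM h : Cmeasurable h -> measurable_fun [set: borel G] (fun x : borel G => nc (h x) * v x)%R.
  by move=> mh; apply: measurable_funM => //; exact: measurable_normc.
have h x : (0 <= nc (f x) * v x + nc (g x) * v x)%R.
  by rewrite addr_ge0// mulr_ge0// normc_ge0.
rewrite !Lpw_norm_Lnorm//.
apply: le_trans (minkowski_EFin mu (mM _ mf) (mM _ mg) p1).
rewrite -[leLHS](@poweRK _ p)// ?Lnorm_ge0// -[leRHS](@poweRK _ p)// ?Lnorm_ge0//.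
apply: le_poweR; first by rewrite invr_ge0 ltW.
  exact: poweR_ge0.
rewrite !powR_Lnorm//; apply: ge0_le_integral => //.
- by move=> x _; exact: poweR_ge0.
- apply: (measurableT_comp (measurable_poweR p)); apply: measurableT_comp => //.
  by apply/measurable_EFinP; apply: mM; exact: CmeasurableD.
- apply: (measurableT_comp (measurable_poweR p)); apply: measurableT_comp => //.
  by apply/measurable_EFinP; apply: measurable_funD; exact: mM.
- move=> x _; apply: le_poweR; [exact: ltW|exact: abse_ge0|].
  rewrite !gee0_abs ?lee_fin ?h// ?mulr_ge0 ?normc_ge0//.
  by rewrite /= -mulrDl ler_wpM2r//; exact: le_normcD.
Qed.

Local Opaque Lpw_norm.

Lemma LpwD f g v : (1 <= p)%R -> weight v -> Lpw mu p v f -> Lpw mu p v g ->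
  Lpw mu p v (fun x => f x + g x)%R.
Proof.
move=> p1 wv [mf fy] [mg gy]; split; first exact: CmeasurableD.
have h := lte_add_pinfty fy gy; apply: le_lt_trans h; exact: Lpw_normD.
Qed.

Lemma LpwZ (z : R[i]) f v : weight v -> Lpw mu p v f -> Lpw mu p v (fun x => z * f x)%R.
Proof.
move=> wv [mf fy]; split; first exact: CmeasurableZ.
by rewrite Lpw_normZ// lte_mul_pinfty// lee_fin normc_ge0.
Qed.

Lemma Lpw_cst0 v : Lpw mu p v (fun=> 0%R).
Proof. by split; [exact: Cmeasurable_cst|rewrite Lpw_norm0]. Qed.

Lemma le_Lpw f g v v' : Cmeasurable f -> weight v -> weight v' -> Lpw mu p v' g ->
  (forall x, (nc (f x) * v x <= nc (g x) * v' x)%R) -> Lpw mu p v f.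
Proof.
move=> mf wv wv' [mg gy] fg; split; first exact: mf.
by apply: le_lt_trans gy; exact: Lpw_norm_le.
Qed.

End WeightedNorm.

(** * Convolution *)

Lemma complex_eq (R : Type) (x y : R[i]) :
  complex.Re x = complex.Re y -> complex.Im x = complex.Im y -> x = y.
Proof. by case: x => a b; case: y => c d /= -> ->. Qed.

Section SectionIntegrals.
Context d (T : measurableType d) (R : realType).
Variable mu : {measure set T -> \bar R}.
Hypothesis mu_sf : sigma_finite [set: T] mu.
Local Open Scope ereal_scope.

Lemma measurable_section_integral1 (f : T * T -> \bar R) : measurable_fun setT f ->
  measurable_fun setT (fun x => \int[mu]_y f (x, y)).
Proof.
move=> mf; rewrite (_ : (fun _ => _) =
  (fun x => \int[mu]_y f^\+ (x, y) - \int[mu]_y f^\- (x, y))).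
  apply: emeasurable_funB; apply: measurable_tonelli1 => //.
  - exact: measurable_funepos.
  - exact: measurable_funeneg.
apply/funext => x; rewrite [LHS]integralE; congr (_ - _).
  by apply: eq_integral => y _; rewrite !funeposE.
by apply: eq_integral => y _; rewrite !funenegE.
Qed.

Lemma measurable_section_integral2 (f : T * T -> \bar R) : measurable_fun setT f ->
  measurable_fun setT (fun y => \int[mu]_x f (x, y)).
Proof.
move=> mf; rewrite (_ : (fun _ => _) =
  (fun y => \int[mu]_x f^\+ (x, y) - \int[mu]_x f^\- (x, y))).
  apply: emeasurable_funB; apply: measurable_tonelli2 => //.
  - exact: measurable_funepos.
  - exact: measurable_funeneg.
apply/funext => x; rewrite [LHS]integralE; congr (_ - _).
  by apply: eq_integral => y _; rewrite !funeposE.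
by apply: eq_integral => y _; rewrite !funenegE.
Qed.

Variable f : T * T -> R.
Hypothesis mf : measurable_fun setT f.

Let mfE : measurable_fun setT (EFin \o f).
Proof. exact/measurable_EFinP. Qed.

Lemma measurable_section_Rintegral1 :
  measurable_fun setT (fun x => (\int[mu]_y f (x, y))%R).
Proof.
apply: (measurableT_comp (fine_measurable measurableT)) => //.
exact: (measurable_section_integral1 mfE).
Qed.

Lemma measurable_section_Rintegral2 :
  measurable_fun setT (fun y => (\int[mu]_x f (x, y))%R).
Proof.
apply: (measurableT_comp (fine_measurable measurableT)) => //.
exact: (measurable_section_integral2 mfE).
Qed.

Lemma Rintegral_fubini :
  \int[mu]_y \int[mu]_x `|f (x, y)|%:E < +oo ->
  (\int[mu]_y \int[mu]_x f (x, y) = \int[mu]_x \int[mu]_y f (x, y))%R.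
Proof.
move=> fy.
pose m := sigma_finite_copy mu_sf.
have intf : (m \x m).-integrable setT (EFin \o f) by apply/integrable21ltyP.
rewrite /Rintegral; congr fine.
transitivity (\int[mu]_y \int[mu]_x (f (x, y))%:E).
  apply: ae_eq_integral => //.
  - by apply/measurable_EFinP; exact: measurable_section_Rintegral2.
  - exact: (measurable_section_integral2 mfE).
  - have := ae_integrable2 intf; apply: filterS => y iy _ /=.
    by rewrite fineK//; exact: (integrable_fin_num measurableT iy).
transitivity (\int[mu]_x \int[mu]_y (f (x, y))%:E).
  by have := Fubini intf; exact: esym.
apply: ae_eq_integral => //.
- exact: (measurable_section_integral1 mfE).
- by apply/measurable_EFinP; exact: measurable_section_Rintegral1.
- have := ae_integrable1 intf; apply: filterS => y iy _ /=.
  by rewrite fineK//; exact: (integrable_fin_num measurableT iy).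
Qed.

End SectionIntegrals.

(* The last field makes up for (z, y) |-> g (z^-1 y) not being measurable for
   the product sigma-algebra when G is not second countable. *)
Record unimodular_haar (R : realType) (G : topologicalGroupType)
    (mu : {measure set (borel G) -> \bar R}) : Prop := {
  haar_sf : sigma_finite [set: borel G] mu ;
  haar_transl : forall (x : G) (A : set G), measurable (A : set (borel G)) ->
    mu [set y | A (x * y)%g] = mu A ;
  haar_inverse : forall A : set G, measurable (A : set (borel G)) ->
    mu [set y | A (y^-1)%g] = mu A ;
  haar_quotient : forall g : borel G -> R, measurable_fun setT g ->
    exists g' : borel G * borel G -> R, [/\ measurable_fun setT g',
      forall y, {ae mu, forall z, g' (z, y) = g (z^-1 * y)%g} &
      forall z, {ae mu, forall y, g' (z, y) = g (z^-1 * y)%g}]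
}.

Lemma left_haar_unimodular (R : realType) (G : topologicalGroupType)
    (mu : {measure set (borel G) -> \bar R}) :
  locally_compact_group G -> compactly_generated G -> left_haar mu ->
  polynomial_growth mu -> unimodular_haar mu.
Proof.
move=> lcG cgG hmu pmu; split.
- exact: haar_sigma_finite.
- by move=> x A; exact: haar_preimage.
- by move=> A; exact: haar_invg.
- by move=> g; exact: left_quotient_fun_ae_product.
Qed.

Section Convolution.
Variables (R : realType) (G : topologicalGroupType).
Variable mu : {measure set (borel G) -> \bar R}.
Hypothesis H : unimodular_haar mu.
Local Open Scope ereal_scope.

Let sf := haar_sf H.

Lemma integral_transl x (f : G -> \bar R) :
  measurable_fun [set: borel G] (f : borel G -> \bar R) ->
  \int[mu]_y f (x * y)%g = \int[mu]_y f y.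
Proof.
move=> mf; apply: (integral_measure_preserving (phi := fun y : borel G => (x * y)%g)) => //.
- exact: measurable_mull.
- by move=> A mA; exact: (haar_transl H).
Qed.

Lemma integral_inverse (f : G -> \bar R) :
  measurable_fun [set: borel G] (f : borel G -> \bar R) ->
  \int[mu]_y f (y^-1)%g = \int[mu]_y f y.
Proof.
move=> mf; apply: (integral_measure_preserving (phi := fun y : borel G => (y^-1)%g)) => //.
- exact: measurable_invg.
- by move=> A mA; exact: (haar_inverse H).
Qed.

Lemma Cintegral_transl x (f : G -> R[i]) : Cmeasurable f ->
  Cintegral mu (fun y => f (x * y)%g) = Cintegral mu f.
Proof.
move=> [mr mi]; rewrite /Cintegral /Rintegral.
by congr (fine _ +i* fine _); [rewrite (integral_transl x (f := fun y => (complex.Re (f y))%:E))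
  |rewrite (integral_transl x (f := fun y => (complex.Im (f y))%:E))] => //;
  exact/measurable_EFinP.
Qed.

Lemma Cintegral_inverse (f : G -> R[i]) : Cmeasurable f ->
  Cintegral mu (fun y => f (y^-1)%g) = Cintegral mu f.
Proof.
move=> [mr mi]; rewrite /Cintegral /Rintegral.
by congr (fine _ +i* fine _); [rewrite (integral_inverse (f := fun y => (complex.Re (f y))%:E))
  |rewrite (integral_inverse (f := fun y => (complex.Im (f y))%:E))] => //;
  exact/measurable_EFinP.
Qed.

Lemma ae_transl x (P : G -> Prop) : (\forall y \ae mu, P y) ->
  \forall y \ae mu, P (x * y)%g.
Proof.
move=> [N [mN N0 NP]]; exists [set y | N (x * y)%g]; split.
- by rewrite -[X in measurable X]setTI; exact: measurable_mull.
- by rewrite (haar_transl H).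
- by move=> y; exact: NP.
Qed.

Lemma ae_inverse (P : G -> Prop) : (\forall y \ae mu, P y) ->
  \forall y \ae mu, P (y^-1)%g.
Proof.
move=> [N [mN N0 NP]]; exists [set y | N (y^-1)%g]; split.
- by rewrite -[X in measurable X]setTI; exact: measurable_invg.
- by rewrite (haar_inverse H).
- by move=> y; exact: NP.
Qed.

Lemma ae_quotient x (P : G -> Prop) : (\forall y \ae mu, P y) ->
  \forall y \ae mu, P (y^-1 * x)%g.
Proof.
move=> /ae_inverse /(ae_transl x^-1%g); apply: aeS => y.
by rewrite invgM invgK.
Qed.

Lemma measurable_quotient x :
  measurable_fun [set: borel G] ((fun y => y^-1 * x)%g : borel G -> borel G).
Proof. exact: (measurableT_comp (measurable_mulr (G := G) x) (@measurable_invg G)). Qed.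

(** Meant for nonnegative functions: the extended value makes sense before any integrability is
    known, and its finiteness at x is what makes the complex convolution at x an absolutely
    convergent integral. *)
Definition aconv (f g : G -> R) (x : G) : \bar R :=
  \int[mu]_y (f y * g (y^-1 * x)%g)%:E.

Section Nonneg.
Variables f g : G -> R.
Hypotheses (mf : measurable_fun [set: borel G] (f : borel G -> R))
  (mg : measurable_fun [set: borel G] (g : borel G -> R)).
Hypotheses (f0 : forall x, (0 <= f x)%R) (g0 : forall x, (0 <= g x)%R).

Lemma aconv_ge0 x : 0 <= aconv f g x.
Proof. by apply: integral_ge0 => y _; rewrite lee_fin mulr_ge0. Qed.

Lemma measurable_aconv_integrand x :
  measurable_fun [set: borel G] (fun y : borel G => (f y * g (y^-1 * x)%g)%:E).
Proof.
apply/measurable_EFinP; apply: measurable_funM => //.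
exact: (measurableT_comp mg (measurable_quotient x)).
Qed.

(** Tonelli, after g (z^-1 y) has been replaced by the product-measurable [g'] of [haar_quotient].
    The modulus of [g'] keeps the integrand nonnegative on the exceptional null sections. The test
    function k = 1 gives the integral of a convolution. *)
Lemma aconv_product (k : G -> R) :
  measurable_fun [set: borel G] (k : borel G -> R) -> (forall x, (0 <= k x)%R) ->
  measurable_fun [set: borel G] (aconv f g : borel G -> \bar R) /\
  \int[mu]_y ((k y)%:E * aconv f g y) =
  \int[mu]_z ((f z)%:E * \int[mu]_y (g (z^-1 * y)%g * k y)%:E).
Proof.
move=> mk k0; have [g' [mg' g'1 g'2]] := haar_quotient H mg.
have m1 (h : borel G -> R) : measurable_fun setT h ->
    measurable_fun setT (fun p : borel G * borel G => h p.1).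
  by move=> mh; exact: (measurableT_comp mh measurable_fst).
have m2 (h : borel G -> R) : measurable_fun setT h ->
    measurable_fun setT (fun p : borel G * borel G => h p.2).
  by move=> mh; exact: (measurableT_comp mh measurable_snd).
have mabs : measurable_fun setT (fun p => `|g' p|)%R by exact: measurableT_comp.
split.
  pose F (p : borel G * borel G) := (f p.1 * `|g' p|)%:E.
  have mF : measurable_fun setT F.
    by apply/measurable_EFinP; apply: measurable_funM => //; exact: m1.
  rewrite (_ : aconv f g = fun y => \int[mu]_z F (z, y)).
    by apply: measurable_tonelli2 => // p; rewrite lee_fin mulr_ge0.
  apply/funext => y; apply: ge0_ae_eq_integral => //.
  - exact: measurable_aconv_integrand.
  - exact: (measurable_fun_pair1 (y : borel G) mF).
  - by move=> z _; rewrite lee_fin mulr_ge0.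
  - by move=> z _; rewrite lee_fin mulr_ge0.
  - apply: aeS (g'1 y) => z /= gz _; rewrite /F/= gz ger0_norm//.
pose F (p : borel G * borel G) := (f p.1 * `|g' p| * k p.2)%:E.
have mF : measurable_fun setT F.
  apply/measurable_EFinP; apply: measurable_funM; last exact: m2.
  by apply: measurable_funM => //; exact: m1.
have F0 p : 0 <= F p by rewrite lee_fin !mulr_ge0.
transitivity (\int[mu]_y \int[mu]_z F (z, y)).
  apply: eq_integral => y _; rewrite -ge0_integralZl_EFin//; last 2 first.
  - by move=> z _; rewrite lee_fin mulr_ge0.
  - exact: measurable_aconv_integrand.
  apply: ge0_ae_eq_integral => //.
  - by apply: emeasurable_funM => //; exact: measurable_aconv_integrand.
  - exact: (measurable_fun_pair1 (y : borel G) mF).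
  - by move=> z _; rewrite -EFinM lee_fin !mulr_ge0.
  - by apply: aeS (g'1 y) => z /= gz _; rewrite /F/= gz ger0_norm// -EFinM mulrC.
rewrite -(tonelli sf mF F0); apply: eq_integral => z _.
rewrite -ge0_integralZl_EFin//; last 2 first.
- by move=> y _; rewrite lee_fin mulr_ge0.
- apply/measurable_EFinP; apply: measurable_funM => //.
  exact: (measurableT_comp mg (measurable_mull (G := G) z^-1%g)).
apply: ge0_ae_eq_integral => //.
- exact: (measurable_fun_pair2 z mF).
- apply: emeasurable_funM => //; apply/measurable_EFinP; apply: measurable_funM => //.
  exact: (measurableT_comp mg (measurable_mull (G := G) z^-1%g)).
- by move=> y _; rewrite -EFinM lee_fin !mulr_ge0.
- by apply: aeS (g'2 z) => y /= gz _; rewrite /F/= gz ger0_norm// -EFinM mulrA.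
Qed.

Lemma measurable_aconv :
  measurable_fun [set: borel G] (aconv f g : borel G -> \bar R).
Proof. by have [|//|] := @aconv_product (cst 0%R); first exact: measurable_cst. Qed.

Lemma integral_aconv :
  \int[mu]_x aconv f g x = \int[mu]_x (f x)%:E * \int[mu]_x (g x)%:E.
Proof.
have [//|x|_] := @aconv_product (cst 1%R); first exact: ler01.
under eq_integral do rewrite mul1e.
move=> ->; under eq_integral => z _.
  under eq_integral do rewrite mulr1.
  rewrite (integral_transl z^-1%g (f := fun y => (g y)%:E)); last exact/measurable_EFinP.
  rewrite muleC.
  over.
rewrite ge0_integralZl//; first by rewrite muleC.
- exact/measurable_EFinP.
- by move=> x _; rewrite lee_fin.
- by apply: integral_ge0 => x _; rewrite lee_fin.
Qed.

End Nonneg.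

Lemma Cmeasurable_convolution (f g : G -> R[i]) : Cmeasurable f -> Cmeasurable g ->
  Cmeasurable (convolution mu f g).
Proof.
move=> mf mg.
have [gr [mgr gr1 _]] := haar_quotient H mg.1.
have [gi [mgi gi1 _]] := haar_quotient H mg.2.
have m1 (h : borel G -> R) : measurable_fun setT h ->
    measurable_fun setT (fun p : borel G * borel G => h p.1).
  by move=> mh; exact: (measurableT_comp mh measurable_fst).
have mg_ y : Cmeasurable (fun z => g (z^-1 * y)%g).
  exact: Cmeasurable_comp (measurable_quotient y) mg.
have [mfr mfi] := mf; split.
  pose F (p : borel G * borel G) :=
    (complex.Re (f p.1) * gr p - complex.Im (f p.1) * gi p)%R.
  have mF : measurable_fun setT F.
    by apply: measurable_funB; apply: measurable_funM => //;
      [exact: (m1 _ mfr)|exact: (m1 _ mfi)].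
  rewrite (_ : (fun _ => _) = fun y => (\int[mu]_z F (z, y))%R).
    exact: measurable_section_Rintegral2.
  apply/funext => y; rewrite /convolution /Cintegral /= /Rintegral; congr fine.
  apply: ae_eq_integral => //.
  - by apply/measurable_EFinP; exact: (CmeasurableM mf (mg_ y)).1.
  - by apply/measurable_EFinP; exact: (measurable_fun_pair1 (y : borel G) mF).
  - by apply: aeS (aeI (gr1 y) (gi1 y)) => z [rE iE] _; rewrite Re_mulc /F /= rE iE.
pose F (p : borel G * borel G) :=
  (complex.Re (f p.1) * gi p + complex.Im (f p.1) * gr p)%R.
have mF : measurable_fun setT F.
  by apply: measurable_funD; apply: measurable_funM => //;
    [exact: (m1 _ mfr)|exact: (m1 _ mfi)].
rewrite (_ : (fun _ => _) = fun y => (\int[mu]_z F (z, y))%R).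
  exact: measurable_section_Rintegral2.
apply/funext => y; rewrite /convolution /Cintegral /= /Rintegral; congr fine.
apply: ae_eq_integral => //.
- by apply/measurable_EFinP; exact: (CmeasurableM mf (mg_ y)).2.
- by apply/measurable_EFinP; exact: (measurable_fun_pair1 (y : borel G) mF).
- by apply: aeS (aeI (gr1 y) (gi1 y)) => z [rE iE] _; rewrite Im_mulc /F /= rE iE.
Qed.

Lemma normc_convolution (f g : G -> R[i]) x : Cmeasurable f -> Cmeasurable g ->
  (nc (convolution mu f g x))%:E <= aconv (fun y => nc (f y)) (fun y => nc (g y)) x.
Proof.
move=> mf mg; apply: le_trans (normc_Cintegral mu _) _.
  by apply: CmeasurableM => //; exact: Cmeasurable_comp (measurable_quotient x) mg.
by rewrite /aconv; under eq_integral do rewrite Normc.normcM.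
Qed.

Section Pairing.
Variables f g h : G -> R[i].
Hypotheses (mf : Cmeasurable f) (mg : Cmeasurable g) (mh : Cmeasurable h).
Hypothesis fgh : \int[mu]_y ((nc (h y))%:E *
  aconv (fun z => nc (f z)) (fun z => nc (g z)) y) < +oo.

(** Fubini for f (z) g (z^-1 y) h (y), again through a product-measurable substitute of g (z^-1 y).
    Both the associativity of convolution and the adjoint of a convolution operator are
    instances. *)
Lemma integral_convolution_pairing :
  Cintegral mu (fun y => h y * convolution mu f g y)%R =
  Cintegral mu (fun z => f z * Cintegral mu (fun y => g (z^-1 * y)%g * h y))%R.
Proof.
have [gr [mgr gr1 gr2]] := haar_quotient H mg.1.
have [gi [mgi gi1 gi2]] := haar_quotient H mg.2.
pose g' (p : borel G * borel G) : R[i] := gr p +i* gi p.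
have g'1 y : \forall z \ae mu, g' (z, y) = g (z^-1 * y)%g.
  by apply: aeS (aeI (gr1 y) (gi1 y)) => z [/= rE iE]; rewrite /g' rE iE; case: (g _).
have g'2 z : \forall y \ae mu, g' (z, y) = g (z^-1 * y)%g.
  by apply: aeS (aeI (gr2 z) (gi2 z)) => y [/= rE iE]; rewrite /g' rE iE; case: (g _).
have mgl z : Cmeasurable (fun y => g (z^-1 * y)%g).
  exact: Cmeasurable_comp (measurable_mull (G := G) z^-1%g) mg.
have mgq y : Cmeasurable (fun z => g (z^-1 * y)%g).
  exact: Cmeasurable_comp (measurable_quotient y) mg.
have m1 (k : borel G -> R) : measurable_fun setT k ->
    measurable_fun setT (fun p : borel G * borel G => k p.1).
  by move=> mk; exact: (measurableT_comp mk measurable_fst).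
have m2 (k : borel G -> R) : measurable_fun setT k ->
    measurable_fun setT (fun p : borel G * borel G => k p.2).
  by move=> mk; exact: (measurableT_comp mk measurable_snd).
pose Cm (F : borel G * borel G -> R[i]) :=
  measurable_fun setT (fun p => complex.Re (F p)) /\
  measurable_fun setT (fun p => complex.Im (F p)).
have CmM F1 F2 : Cm F1 -> Cm F2 -> Cm (fun p => F1 p * F2 p)%R.
  move=> [r1 i1] [r2 i2]; split.
    by under eq_fun do rewrite Re_mulc; apply: measurable_funB; exact: measurable_funM.
  by under eq_fun do rewrite Im_mulc; apply: measurable_funD; exact: measurable_funM.
have Cmg : Cm g' by [].
have Cmf : Cm (fun p => f p.1) by split; [exact: (m1 _ mf.1)|exact: (m1 _ mf.2)].
have Cmh : Cm (fun p => h p.2) by split; [exact: (m2 _ mh.1)|exact: (m2 _ mh.2)].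
pose gh (p : borel G * borel G) := (g' p * h p.2)%R; have Cmgh : Cm gh by exact: CmM.
pose F (p : borel G * borel G) := (f p.1 * gh p)%R; have CmF : Cm F by exact: CmM.
have mFy (y : borel G) : Cmeasurable (fun z => F (z, y)).
  by split; [exact: (measurable_fun_pair1 y CmF.1)|exact: (measurable_fun_pair1 y CmF.2)].
have mFz (z : borel G) : Cmeasurable (fun y => F (z, y)).
  by split; [exact: (measurable_fun_pair2 z CmF.1)|exact: (measurable_fun_pair2 z CmF.2)].
have mghz (z : borel G) : Cmeasurable (fun y => gh (z, y)).
  by split; [exact: (measurable_fun_pair2 z Cmgh.1)|exact: (measurable_fun_pair2 z Cmgh.2)].
have mnF : measurable_fun setT (fun p => (nc (F p))%:E).
  apply/measurable_EFinP; under eq_fun do rewrite normc_sqrt.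
  apply: measurableT_comp; first by apply: continuous_measurable_fun; exact: sqrt_continuous.
  by apply: measurable_funD; apply: measurable_funX; [exact: CmF.1|exact: CmF.2].
have nF0 p : 0 <= (nc (F p))%:E by rewrite lee_fin normc_ge0.
have maconv y := measurable_aconv_integrand (measurable_normc mf) (measurable_normc mg) y.
have intF y : \int[mu]_z (nc (F (z, y)))%:E =
    (nc (h y))%:E * aconv (fun z => nc (f z)) (fun z => nc (g z)) y.
  rewrite -ge0_integralZl_EFin ?normc_ge0//; last first.
    by move=> z _; rewrite lee_fin mulr_ge0// normc_ge0.
  apply: ge0_ae_eq_integral => //.
  - exact: (measurable_fun_pair1 y mnF).
  - by apply: emeasurable_funM => //; exact: maconv.
  - by move=> z _; rewrite -EFinM lee_fin !mulr_ge0// normc_ge0.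
  - apply: aeS (g'1 y) => z gE _; rewrite /F /gh /= gE !Normc.normcM -EFinM.
    by congr EFin; ring.
have Fy : \int[mu]_y \int[mu]_z (nc (F (z, y)))%:E < +oo.
  by under eq_integral do rewrite intF.
have Fz : \int[mu]_z \int[mu]_y (nc (F (z, y)))%:E < +oo.
  by rewrite (tonelli sf mnF nF0).
have aefin (k : G -> \bar R) : measurable_fun [set: borel G] (k : borel G -> \bar R) ->
    (forall x, 0 <= k x) -> \int[mu]_x k x < +oo -> \forall x \ae mu, k x < +oo.
  move=> mk k0 ky; have : mu.-integrable [set: borel G] k.
    by apply/integrableP; split => //; under eq_integral do rewrite gee0_abs//.
  move=> /(integrable_ae measurableT); apply: aeS => x /(_ Logic.I).
  by rewrite fin_numElt => /andP[].
have aey : \forall y \ae mu, \int[mu]_z (nc (F (z, y)))%:E < +oo.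
  apply: (aefin _ (measurable_tonelli2 sf mnF nF0) _ Fy) => y.
  exact: integral_ge0.
have aez : \forall z \ae mu, \int[mu]_y (nc (F (z, y)))%:E < +oo.
  apply: (aefin _ (measurable_tonelli1 sf mnF nF0) _ Fz) => z.
  exact: integral_ge0.
transitivity (Cintegral mu (fun y => Cintegral mu (fun z => F (z, y)))).
  apply: ae_eq_Cintegral.
  - by apply: CmeasurableM => //; exact: Cmeasurable_convolution.
  - by split; [exact: (measurable_section_Rintegral2 sf CmF.1)
      |exact: (measurable_section_Rintegral2 sf CmF.2)].
  - apply: aeS aey => y yF; rewrite -CintegralZ; last 2 first.
    + exact: CmeasurableM.
    + apply: le_lt_trans yF; rewrite intF.
      rewrite -ge0_integralZl_EFin ?normc_ge0//; last first.
    by move=> z _; rewrite lee_fin mulr_ge0// normc_ge0.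
      by under [leLHS]eq_integral do rewrite !Normc.normcM EFinM.
    apply: ae_eq_Cintegral => //.
    + by apply: CmeasurableZ; exact: CmeasurableM.
    + by apply: aeS (g'1 y) => z gE; rewrite /F /gh /= gE; ring.
transitivity (Cintegral mu (fun z => Cintegral mu (fun y => F (z, y)))).
  apply: complex_eq; rewrite /Cintegral /=.
    apply: (Rintegral_fubini sf CmF.1); apply: le_lt_trans Fy.
    apply: ge0_le_integral => //.
    - by move=> y _; apply: integral_ge0 => z _; rewrite lee_fin.
    - apply: (measurable_section_integral2 sf (f := fun p => `|complex.Re (F p)|%:E)).
      by apply/measurable_EFinP; apply: measurableT_comp => //; exact: CmF.1.
    - exact: (measurable_tonelli2 sf mnF nF0).
    - move=> y _; apply: ge0_le_integral => //.
      + by apply/measurable_EFinP; apply: measurableT_comp => //; exact: (mFy y).1.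
      + exact: (measurable_fun_pair1 y mnF).
      + by move=> z _; rewrite lee_fin Re_le_normc.
  apply: (Rintegral_fubini sf CmF.2); apply: le_lt_trans Fy.
  apply: ge0_le_integral => //.
  - by move=> y _; apply: integral_ge0 => z _; rewrite lee_fin.
  - apply: (measurable_section_integral2 sf (f := fun p => `|complex.Im (F p)|%:E)).
    by apply/measurable_EFinP; apply: measurableT_comp => //; exact: CmF.2.
  - exact: (measurable_tonelli2 sf mnF nF0).
  - move=> y _; apply: ge0_le_integral => //.
    + by apply/measurable_EFinP; apply: measurableT_comp => //; exact: (mFy y).2.
    + exact: (measurable_fun_pair1 y mnF).
    + by move=> z _; rewrite lee_fin Im_le_normc.
have ghE z : Cintegral mu (fun y => g (z^-1 * y)%g * h y)%R = Cintegral mu (fun y => gh (z, y)).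
  apply: ae_eq_Cintegral => //; first exact: CmeasurableM.
  by apply: aeS (g'2 z) => y gE; rewrite /gh /= gE.
under [in RHS]eq_Cintegral do rewrite ghE.
apply: ae_eq_Cintegral.
- by split; [exact: (measurable_section_Rintegral1 sf CmF.1)
    |exact: (measurable_section_Rintegral1 sf CmF.2)].
- apply: CmeasurableM => //.
  by split; [exact: (measurable_section_Rintegral1 sf Cmgh.1)
    |exact: (measurable_section_Rintegral1 sf Cmgh.2)].
- by apply: aeS aez => z zF; rewrite -CintegralZ.
Qed.

End Pairing.

End Convolution.

(** * Hölder and Young inequalities for convolutions *)

Section ConvolutionNorm.
Variables (R : realType) (G : topologicalGroupType).
Variable mu : {measure set (borel G) -> \bar R}.
Hypothesis H : unimodular_haar mu.
Local Open Scope ereal_scope.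

Lemma measurable_powR_comp (f : G -> R) (r : R) :
  measurable_fun [set: borel G] (f : borel G -> R) ->
  measurable_fun [set: borel G] ((fun x => f x `^ r)%R : borel G -> R).
Proof. by move=> mf; exact: (measurableT_comp (measurable_powR r) mf). Qed.

Section Hoelder.
Variables p q : R.
Hypotheses (p_gt1 : (1 < p)%R) (q_gt0 : (0 < q)%R) (pq : (p^-1 + q^-1 = 1)%R).

Let p_gt0 : (0 < p)%R. Proof. exact: lt_trans p_gt1. Qed.

Lemma hoelder_nonneg (f g : G -> R) :
  measurable_fun [set: borel G] (f : borel G -> R) ->
  measurable_fun [set: borel G] (g : borel G -> R) ->
  (forall x, (0 <= f x)%R) -> (forall x, (0 <= g x)%R) ->
  \int[mu]_x (f x * g x)%:E <=
  (\int[mu]_x (f x `^ p)%:E) `^ p^-1 * (\int[mu]_x (g x `^ q)%:E) `^ q^-1.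
Proof.
move=> mf mg f0 g0; have := hoelder mu mf mg p_gt0 q_gt0 pq.
have NE (r : R) (k : G -> R) : (0 < r)%R -> (forall x, (0 <= k x)%R) ->
    'N[mu]_r%:E[EFin \o (k : borel G -> R)] = (\int[mu]_x (k x `^ r)%:E) `^ r^-1.
  move=> r0 k0; rewrite -[LHS](@poweRK _ r) ?gt_eqF// ?Lnorm_ge0//.
  rewrite powR_Lnorm; last by rewrite gt_eqF.
  apply: (congr1 (fun t => t `^ r^-1)); apply: eq_integral => x _ /=.
  by rewrite ger0_norm.
rewrite (NE p f p_gt0 f0) (NE q g q_gt0 g0) Lnorm1.
by under [leLHS]eq_integral do rewrite /= ger0_norm ?mulr_ge0//.
Qed.

Variables F K a b v : G -> R.
Hypotheses (mF : measurable_fun [set: borel G] (F : borel G -> R))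
  (mK : measurable_fun [set: borel G] (K : borel G -> R))
  (ma : measurable_fun [set: borel G] (a : borel G -> R))
  (mb : measurable_fun [set: borel G] (b : borel G -> R))
  (mv : measurable_fun [set: borel G] (v : borel G -> R)).
Hypotheses (F0 : forall x, (0 <= F x)%R) (K0 : forall x, (0 <= K x)%R)
  (a0 : forall x, (0 <= a x)%R) (b0 : forall x, (0 <= b x)%R)
  (v0 : forall x, (0 < v x)%R).
Hypothesis abv : forall x,
  aconv mu (fun y => a y `^ q)%R (fun y => b y `^ q)%R x <= (v x `^ (- q))%:E.

(** Hölder splits F a * K b into (F^p * K^p)^(1/p) and (a^q * b^q)^(1/q), and the last factor is at
    most 1/v. Taking a = b = 1/w and v = w gives submultiplicativity of the norm of L^p(G, w);
    taking F = |f|^(1/p), a = |f|^(1/q), b = 1 and v constant gives Young's inequality. *)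
Lemma aconv_hoelder x :
  aconv mu (fun y => F y * a y)%R (fun y => K y * b y)%R x * (v x)%:E <=
  (aconv mu (fun y => F y `^ p)%R (fun y => K y `^ p)%R x) `^ p^-1.
Proof.
have mq (k : G -> R) : measurable_fun [set: borel G] (k : borel G -> R) ->
    measurable_fun [set: borel G] ((fun y => k (y^-1 * x)%g) : borel G -> R).
  by move=> mk; exact: (measurableT_comp mk (measurable_quotient x)).
have h1 : aconv mu (fun y => F y * a y)%R (fun y => K y * b y)%R x <=
    (aconv mu (fun y => F y `^ p)%R (fun y => K y `^ p)%R x) `^ p^-1 *
    (aconv mu (fun y => a y `^ q)%R (fun y => b y `^ q)%R x) `^ q^-1.
  have := @hoelder_nonneg (fun y => F y * K (y^-1 * x)%g)%R (fun y => a y * b (y^-1 * x)%g)%R.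
  move=> /(_ (measurable_funM mF (mq _ mK)) (measurable_funM ma (mq _ mb))).
  move=> /(_ (fun y => mulr_ge0 (F0 y) (K0 _)) (fun y => mulr_ge0 (a0 y) (b0 _))).
  rewrite /aconv; under eq_integral do rewrite mulrACA.
  move=> /le_trans; apply.
  under eq_integral do rewrite powRM//.
  by under [X in _ * X `^ _ <= _]eq_integral do rewrite powRM//.
have h2 : (aconv mu (fun y => a y `^ q)%R (fun y => b y `^ q)%R x) `^ q^-1 <= ((v x)^-1)%:E.
  rewrite -[leRHS](_ : (v x `^ (- q))%:E `^ q^-1 = _).
    apply: le_poweR; [by rewrite invr_ge0 ltW| |exact: abv].
    by apply: aconv_ge0 => y; exact: powR_ge0.
  by rewrite poweR_EFin -powRrM mulNr divff ?gt_eqF// powR_inv1// ltW.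
apply: (@le_trans _ _ ((aconv mu (fun y => F y `^ p)%R (fun y => K y `^ p)%R x) `^ p^-1 *
   ((v x)^-1)%:E * (v x)%:E)).
  apply: lee_wpmul2r; first by rewrite lee_fin ltW.
  by apply: (le_trans h1); apply: lee_wpmul2l h2; exact: poweR_ge0.
by rewrite -muleA -EFinM mulVf ?gt_eqF// mule1.
Qed.

Lemma aconv_lt_pinfty_ae :
  \int[mu]_x (F x `^ p)%:E < +oo -> \int[mu]_x (K x `^ p)%:E < +oo ->
  \forall x \ae mu, aconv mu (fun y => F y * a y)%R (fun y => K y * b y)%R x < +oo.
Proof.
move=> Fy Ky.
have mFp := measurable_powR_comp p mF; have mKp := measurable_powR_comp p mK.
have Fp0 x : (0 <= F x `^ p)%R by exact: powR_ge0.
have Kp0 x : (0 <= K x `^ p)%R by exact: powR_ge0.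
have mA := measurable_aconv H mFp mKp Fp0 Kp0.
have IA := integral_aconv H mFp mKp Fp0 Kp0.
have iA : mu.-integrable [set: borel G] (aconv mu (fun y => F y `^ p)%R (fun y => K y `^ p)%R).
  apply/integrableP; split; first exact: mA.
  under eq_integral do rewrite gee0_abs ?aconv_ge0//.
  have F00 : 0 <= \int[mu]_x (F x `^ p)%:E by apply: integral_ge0 => x _; rewrite lee_fin.
  rewrite IA; apply: lte_mul_pinfty; [exact: F00| |exact: Ky].
  by rewrite (ge0_fin_numE F00); exact: Fy.
apply: aeS (integrable_ae measurableT iA) => x /(_ Logic.I).
rewrite fin_numElt => /andP[_ Ay].
have := le_lt_trans (aconv_hoelder x) (poweR_lty p^-1 Ay).
rewrite -[aconv _ _ _ x < +oo](lte_pmul2r (z := (v x)%:E)) ?lte_fin//.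
by rewrite gt0_mulye ?lte_fin.
Qed.

Lemma Lpw_norm_convolution_hoelder (f g : G -> R[i]) :
  Cmeasurable f -> Cmeasurable g ->
  (forall x, nc (f x) = F x * a x)%R -> (forall x, nc (g x) = K x * b x)%R ->
  Lpw_norm mu p v (convolution mu f g) <=
  (\int[mu]_x (F x `^ p)%:E) `^ p^-1 * (\int[mu]_x (K x `^ p)%:E) `^ p^-1.
Proof.
move=> mf mg fE gE.
have mFp := measurable_powR_comp p mF; have mKp := measurable_powR_comp p mK.
have Fp0 x : (0 <= F x `^ p)%R by exact: powR_ge0.
have Kp0 x : (0 <= K x `^ p)%R by exact: powR_ge0.
have mA := measurable_aconv H mFp mKp Fp0 Kp0.
have IA := integral_aconv H mFp mKp Fp0 Kp0.
rewrite -poweRM; last 2 first.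
- by apply: integral_ge0 => x _; rewrite lee_fin.
- by apply: integral_ge0 => x _; rewrite lee_fin.
rewrite -IA; apply: le_poweR; first by rewrite invr_ge0 ltW.
  by apply: integral_ge0 => x _; rewrite lee_fin mulr_ge0// powR_ge0.
apply: ge0_le_integral => //.
- by move=> x _; rewrite lee_fin mulr_ge0// powR_ge0.
- apply: measurable_Lpw_integrand; first exact: Cmeasurable_convolution.
  by split => // x; exact: ltW.
- move=> x _; rewrite -powRM ?normc_ge0//; last exact: ltW.
  rewrite -poweR_EFin -[leRHS](@poweRVK _ p) ?gt_eqF//; last exact: aconv_ge0.
  apply: le_poweR; first exact: ltW.
    by rewrite lee_fin mulr_ge0 ?normc_ge0//; exact: ltW.
  apply: le_trans (aconv_hoelder x); rewrite EFinM lee_wpmul2r//.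
    by rewrite lee_fin ltW.
  apply: le_trans (normc_convolution mu x mf mg) _.
  rewrite (_ : (fun y => nc (f y)) = fun y => F y * a y)%R; last exact/funext.
  by rewrite (_ : (fun y => nc (g y)) = fun y => K y * b y)%R; last exact/funext.
Qed.

End Hoelder.

Lemma L1_norm (f : G -> R[i]) :
  Lpw_norm mu 1 (cst 1%R) f = \int[mu]_x (nc (f x))%:E.
Proof.
rewrite /Lpw_norm invr1 poweRe1.
  by apply: eq_integral => x _; rewrite !powRr1 ?normc_ge0//= ?mulr1// ler01.
by apply: integral_ge0 => x _; rewrite lee_fin mulr_ge0 ?powR_ge0.
Qed.

Lemma L1_norm_convolution (f g : G -> R[i]) : Cmeasurable f -> Cmeasurable g ->
  Lpw_norm mu 1 (cst 1%R) (convolution mu f g) <=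
  Lpw_norm mu 1 (cst 1%R) f * Lpw_norm mu 1 (cst 1%R) g.
Proof.
move=> mf mg; rewrite !L1_norm.
rewrite -(integral_aconv H (measurable_normc mf) (measurable_normc mg)
  (fun=> normc_ge0 _) (fun=> normc_ge0 _)).
apply: ge0_le_integral => //.
- by move=> x _; rewrite lee_fin normc_ge0.
- by apply: measurable_normc_EFin; exact: Cmeasurable_convolution.
- exact: (measurable_aconv H (measurable_normc mf) (measurable_normc mg)
  (fun=> normc_ge0 _) (fun=> normc_ge0 _)).
- by move=> x _; exact: normc_convolution.
Qed.

Lemma convolution_ae_eq (f f' g g' : G -> R[i]) : Cmeasurable f -> Cmeasurable f' ->
  Cmeasurable g -> Cmeasurable g' ->
  (\forall x \ae mu, f x = f' x) -> (\forall x \ae mu, g x = g' x) ->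
  convolution mu f g = convolution mu f' g'.
Proof.
move=> mf mf' mg mg' ff' gg'; apply/funext => x; apply: ae_eq_Cintegral.
- by apply: CmeasurableM => //; exact: Cmeasurable_comp (measurable_quotient x) mg.
- by apply: CmeasurableM => //; exact: Cmeasurable_comp (measurable_quotient x) mg'.
- by apply: aeS (aeI ff' (ae_quotient H x gg')) => y [-> ->].
Qed.

Lemma convolution0 (g : G -> R[i]) : convolution mu (fun=> 0%R) g = fun=> 0%R.
Proof.
apply/funext => x; rewrite /convolution /Cintegral /Rintegral.
under eq_integral do rewrite mul0r /=.
under [X in _ +i* fine X]eq_integral do rewrite mul0r /=.
by rewrite integral0.
Qed.

Lemma Lpw_norm_cst (p c : R) (f : G -> R[i]) : (0 < p)%R -> (0 <= c)%R -> Cmeasurable f ->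
  Lpw_norm mu p (cst c) f = c%:E * Lpw_norm mu p (cst 1%R) f.
Proof.
move=> p0 c0 mf; transitivity (Lpw_norm mu p (cst 1%R) (fun x => c%:C * f x)%R).
  apply: (congr1 (fun t => t `^ p^-1)); apply: eq_integral => x _ /=.
  by rewrite Normc.normcM normc_real ger0_norm// powRM ?normc_ge0// powR1 mulr1 mulrC.
by rewrite Lpw_normZ ?normc_real ?ger0_norm//; exact: weight1.
Qed.

(** With |f| = |f|^(1/p) |f|^(1/q), the convolution of |f| with 1 is the constant |f|_1, so
    [aconv_hoelder] applies with the constant weight |f|_1^(-1/q). *)
Lemma young_L1 (p : R) (f g : G -> R[i]) : (1 < p)%R ->
  Cmeasurable f -> Cmeasurable g -> Lpw_norm mu 1 (cst 1%R) f < +oo ->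
  Lpw_norm mu p (cst 1%R) (convolution mu f g) <=
  Lpw_norm mu 1 (cst 1%R) f * Lpw_norm mu p (cst 1%R) g.
Proof.
move=> p1 mf mg fy; have p0 : (0 < p)%R by exact: lt_trans p1.
(* The weight must be positive, so a null f is treated apart. Then the right-hand side is 0 even if
   the norm of g is infinite, and the convolution vanishes. *)
have [N0|N0] := eqVneq (Lpw_norm mu 1 (cst 1%R) f) 0.
  have f0 := Lpw_norm_eq0 ltr01 mf (weight1 R G) (fun=> ltr01) N0.
  have gg : \forall x \ae mu, g x = g x by apply: aeS f0.
  rewrite (convolution_ae_eq mf (Cmeasurable_cst G 0%R) mg mg f0 gg).
  by rewrite convolution0 Lpw_norm0// N0 mul0e.
have Nf : Lpw_norm mu 1 (cst 1%R) f \is a fin_num by rewrite ge0_fin_numE ?Lpw_norm_ge0.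
pose m := fine (Lpw_norm mu 1 (cst 1%R) f).
have mE : Lpw_norm mu 1 (cst 1%R) f = m%:E by rewrite fineK.
have m0 : (0 < m)%R by rewrite fine_gt0// fy lt0e N0 Lpw_norm_ge0.
have p1' : (p^-1 < 1)%R by rewrite invf_lt1.
pose q : R := ((1 - p^-1)^-1)%R.
have q0 : (0 < q)%R by rewrite invr_gt0 subr_gt0.
have pq : (p^-1 + q^-1 = 1)%R by rewrite invrK addrC subrK.
have mnf := measurable_normc mf; have mng := measurable_normc mg.
have := @Lpw_norm_convolution_hoelder p q p1 q0 pq (fun x => nc (f x) `^ p^-1)%R
  (fun x => nc (g x)) (fun x => nc (f x) `^ q^-1)%R (cst 1%R) (cst (m `^ - q^-1)%R).
move=> /(_ (measurable_powR_comp _ mnf) mng (measurable_powR_comp _ mnf)).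
move=> /(_ (measurable_cst _) (measurable_cst _)).
move=> /(_ (fun=> powR_ge0 _ _) (fun=> normc_ge0 _) (fun=> powR_ge0 _ _) (fun=> ler01)).
move=> /(_ (fun=> powR_gt0 _ m0)).
have abv x : aconv mu (fun y => (nc (f y) `^ q^-1) `^ q)%R (fun=> 1 `^ q)%R x <=
    ((m `^ - q^-1) `^ (- q))%:E.
  rewrite -powRrM mulrNN mulVf ?gt_eqF// powRr1 ?(ltW m0)// -mE L1_norm /aconv.
  rewrite le_eqVlt; apply/orP; left; apply/eqP; apply: eq_integral => y _.
  by rewrite powR1 mulr1 -powRrM mulVf ?gt_eqF// powRr1// normc_ge0.
move=> /(_ abv f g mf mg).
have fE x : nc (f x) = (nc (f x) `^ p^-1 * nc (f x) `^ q^-1)%R.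
  by rewrite -powRD ?pq ?powRr1 ?normc_ge0// oner_eq0.
move=> /(_ fE (fun=> esym (mulr1 _))).
rewrite Lpw_norm_cst ?powR_ge0//; last exact: Cmeasurable_convolution.
have -> : \int[mu]_x ((nc (f x) `^ p^-1) `^ p)%:E = m%:E.
  rewrite -mE L1_norm; apply: eq_integral => y _.
  by rewrite -powRrM mulVf ?gt_eqF// powRr1// normc_ge0.
have -> : (\int[mu]_x (nc (g x) `^ p)%:E) `^ p^-1 = Lpw_norm mu p (cst 1%R) g.
  apply: (congr1 (fun t => t `^ p^-1)); apply: eq_integral => y _.
  by rewrite powR1 mulr1.
move=> h; rewrite mE.
rewrite -(@lee_pmul2l _ (m `^ - q^-1)%:E)// ?lte_fin ?powR_gt0//.
apply: (le_trans h); rewrite muleA; apply: lee_wpmul2r; first exact: Lpw_norm_ge0.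
rewrite poweR_EFin -EFinM lee_fin -[X in (_ * X)%R](powRr1 (ltW m0)) -powRD.
  by rewrite -pq addrCA [(- _ + _)%R]addrC subrr addr0.
by rewrite (gt_eqF m0) implybT.
Qed.

End ConvolutionNorm.

(** * The convolution algebra of an (LPAlg) weight *)

Lemma convolution_real (R : realType) (G : topologicalGroupType)
    (mu : {measure set (borel G) -> \bar R}) (a b : G -> R) x :
  convolution mu (fun y => (a y)%:C) (fun y => (b y)%:C) x = (fine (aconv mu a b x))%:C.
Proof.
apply: complex_eq => /=; first by apply: eq_Rintegral => y _ /=; rewrite mul0r subr0.
rewrite /Rintegral; under eq_integral do rewrite mulr0 mul0r addr0.
by rewrite integral0.
Qed.

Section WeightedAlgebra.
Variables (R : realType) (G : topologicalGroupType).
Variable mu : {measure set (borel G) -> \bar R}.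
Hypothesis H : unimodular_haar mu.
Variables (p q : R) (w : G -> R).
Hypotheses (p_gt1 : 1 < p) (pq : p^-1 + q^-1 = 1).
Hypotheses (wl : LPAlg mu q w).
Local Open Scope ereal_scope.
Implicit Types f g h : G -> R[i].

Lemma lpalg_p_gt0 : (0 < p)%R. Proof. exact: lt_trans p_gt1. Qed.
Let p_gt0 := lpalg_p_gt0.

Lemma lpalg_q_gt0 : (0 < q)%R.
Proof.
rewrite -invr_gt0 -(addrK p^-1%R q^-1%R) [(q^-1 + _)%R]addrC pq subr_gt0.
by rewrite invf_lt1.
Qed.
Let q_gt0 := lpalg_q_gt0.

Lemma lpalg_gt0 x : (0 < w x)%R.
Proof. exact: lt_le_trans (lpalg_ge1 wl x). Qed.
Let w_gt0 := lpalg_gt0.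

Lemma lpalg_weight : weight w.
Proof. by split => [|x]; [exact: lpalg_measurable wl|exact: ltW]. Qed.
Let ww := lpalg_weight.

Let u x : R := (w x `^ (- 1))%R.

Let mw : measurable_fun [set: borel G] (w : borel G -> R).
Proof. exact: lpalg_measurable wl. Qed.

Let mu_ : measurable_fun [set: borel G] (u : borel G -> R).
Proof. exact: measurable_powR_comp. Qed.

Let u_ge0 x : (0 <= u x)%R. Proof. exact: powR_ge0. Qed.

Let wu x : (w x * u x = 1)%R.
Proof. by rewrite /u powR_inv1 ?divff ?gt_eqF// ltW. Qed.

Let uq x : (u x `^ q = w x `^ (- q))%R.
Proof. by rewrite /u -powRrM mulN1r. Qed.

Let conv_u x : aconv mu (fun y => u y `^ q)%R (fun y => u y `^ q)%R x <= (w x `^ (- q))%:E.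
Proof.
apply: le_trans (lpalg_conv wl x); rewrite /aconv le_eqVlt; apply/orP; left; apply/eqP.
by apply: eq_integral => y _; rewrite !uq.
Qed.

Let mF f : Cmeasurable f ->
  measurable_fun [set: borel G] ((fun x => nc (f x) * w x)%R : borel G -> R).
Proof. by move=> mf; apply: measurable_funM => //; exact: measurable_normc. Qed.

Let F_ge0 f x : (0 <= nc (f x) * w x)%R.
Proof. by rewrite mulr_ge0 ?normc_ge0// ltW. Qed.

Let FE f x : nc (f x) = (nc (f x) * w x * u x)%R.
Proof. by rewrite -mulrA wu mulr1. Qed.

Let FNE f : \int[mu]_x ((nc (f x) * w x) `^ p)%:E = Lpw_norm mu p w f `^ p.
Proof.
rewrite Lpw_normX//; apply: eq_integral => x _.
by rewrite powRM ?normc_ge0// ltW.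
Qed.

Lemma Lpw_norm_convolution f g : Cmeasurable f -> Cmeasurable g ->
  Lpw_norm mu p w (convolution mu f g) <= Lpw_norm mu p w f * Lpw_norm mu p w g.
Proof.
move=> mf mg; have := Lpw_norm_convolution_hoelder H p_gt1 q_gt0 pq (mF mf) (mF mg)
  mu_ mu_ mw (F_ge0 f) (F_ge0 g) u_ge0 u_ge0 w_gt0 conv_u mf mg (FE f) (FE g).
have K k : (Lpw_norm mu p w k `^ p) `^ p^-1 = Lpw_norm mu p w k.
  by apply: poweRK; [exact: lt0r_neq0|exact: Lpw_norm_ge0].
rewrite (FNE f) (FNE g) (K f) (K g); exact.
Qed.

Lemma Lpw_convolution f g : Lpw mu p w f -> Lpw mu p w g ->
  Lpw mu p w (convolution mu f g).
Proof.
move=> [mf fy] [mg gy]; split; first exact: Cmeasurable_convolution.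
apply: le_lt_trans (Lpw_norm_convolution mf mg) _.
apply: lte_mul_pinfty; [exact: Lpw_norm_ge0| |exact: gy].
apply/fin_numPlt/andP; split; last exact: fy.
by apply: lt_le_trans (Lpw_norm_ge0 _ _ _ _); exact: ltNy0.
Qed.

Lemma Cmeasurable_involution f : Cmeasurable f -> Cmeasurable (involution f).
Proof.
move=> mf; apply: Cmeasurable_conj.
by apply: (Cmeasurable_comp (phi := fun x => x^-1%g)) mf; exact: measurable_invg.
Qed.

Lemma Lpw_norm_involution (r : R) (v : G -> R) f : weight v -> (forall x, v x^-1%g = v x) ->
  Cmeasurable f -> Lpw_norm mu r v (involution f) = Lpw_norm mu r v f.
Proof.
move=> wv v_sym mf; apply: (congr1 (fun t => t `^ r^-1)).
rewrite -[RHS](integral_inverse H (f := fun x => (nc (f x) `^ r * v x `^ r)%:E)); last first.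
  exact: measurable_Lpw_integrand.
by apply: eq_integral => x _; rewrite /involution normc_conj v_sym.
Qed.

Lemma Lpw_involution f : Lpw mu p w f -> Lpw mu p w (involution f).
Proof.
move=> [mf fy]; split; first exact: Cmeasurable_involution.
by rewrite (Lpw_norm_involution _ ww (lpalg_sym wl)).
Qed.

Lemma involution_convolution f g : Cmeasurable f -> Cmeasurable g ->
  involution (convolution mu f g) = convolution mu (involution g) (involution f).
Proof.
move=> mf mg; apply/funext => x; rewrite /involution /convolution -Cintegral_conj.
have m : Cmeasurable (fun y => (f y)^* * (g (y^-1 * x^-1)%g)^*)%R.
  apply: CmeasurableM; apply: Cmeasurable_conj => //.
  exact: Cmeasurable_comp (measurable_quotient _) mg.
transitivity (Cintegral mu (fun y => (f y)^* * (g (y^-1 * x^-1)%g)^*)%R).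
  by apply: eq_Cintegral => y; rewrite rmorphM.
rewrite -(Cintegral_transl H x^-1%g m); apply: eq_Cintegral => y.
by rewrite mulrC !invgM !invgK -mulgA mulgV mulg1.
Qed.

Lemma Lpw_aconv_lty f g : Lpw mu p w f -> Lpw mu p w g ->
  \forall x \ae mu, aconv mu (fun y => nc (f y)) (fun y => nc (g y)) x < +oo.
Proof.
move=> [mf fy] [mg gy].
have := aconv_lt_pinfty_ae H p_gt1 q_gt0 pq (mF mf) (mF mg)
  mu_ mu_ (F_ge0 f) (F_ge0 g) u_ge0 u_ge0 w_gt0 conv_u.
rewrite !FNE => /(_ (poweR_lty _ fy) (poweR_lty _ gy)); apply: aeS => x.
rewrite /aconv; under eq_integral do rewrite -!FE.
by [].
Qed.

Lemma Lpw_convolution_Cintegrable f g : Lpw mu p w f -> Lpw mu p w g ->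
  \forall x \ae mu, Cintegrable mu (fun y => f y * g (y^-1 * x)%g)%R.
Proof.
move=> Lf Lg; apply: aeS (Lpw_aconv_lty Lf Lg) => x; rewrite /aconv => Ix; split.
  apply: CmeasurableM; first by case: Lf.
  by apply: Cmeasurable_comp (measurable_quotient x) _; case: Lg.
by under eq_integral do rewrite Normc.normcM.
Qed.

Lemma convolutionDl f g h : Lpw mu p w f -> Lpw mu p w g -> Lpw mu p w h ->
  \forall x \ae mu, convolution mu (fun y => f y + g y)%R h x =
    (convolution mu f h x + convolution mu g h x)%R.
Proof.
move=> Lf Lg Lh.
apply: aeS (aeI (Lpw_convolution_Cintegrable Lf Lh) (Lpw_convolution_Cintegrable Lg Lh)).
move=> x [If Ig]; rewrite /convolution -CintegralD//.
by apply: eq_Cintegral => y; rewrite mulrDl.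
Qed.

Lemma convolutionDr f g h : Lpw mu p w f -> Lpw mu p w g -> Lpw mu p w h ->
  \forall x \ae mu, convolution mu h (fun y => f y + g y)%R x =
    (convolution mu h f x + convolution mu h g x)%R.
Proof.
move=> Lf Lg Lh.
apply: aeS (aeI (Lpw_convolution_Cintegrable Lh Lf) (Lpw_convolution_Cintegrable Lh Lg)).
move=> x [If Ig]; rewrite /convolution -CintegralD//.
by apply: eq_Cintegral => y; rewrite mulrDr.
Qed.

Lemma convolutionZr (z : R[i]) f g : Lpw mu p w f -> Lpw mu p w g ->
  \forall x \ae mu, convolution mu f (fun y => z * g y)%R x = (z * convolution mu f g x)%R.
Proof.
move=> Lf Lg; apply: aeS (Lpw_convolution_Cintegrable Lf Lg) => x [mI Iy].
rewrite /convolution -CintegralZ//; first by apply: eq_Cintegral => y; rewrite mulrCA.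
under eq_integral do rewrite Normc.normcM EFinM.
rewrite ge0_integralZl_EFin ?normc_ge0//; last 2 first.
- by move=> y _; rewrite lee_fin normc_ge0.
- exact: measurable_normc_EFin mI.
by rewrite lte_mul_pinfty// lee_fin normc_ge0.
Qed.

Lemma convolutionZl (z : R[i]) f g : Lpw mu p w f -> Lpw mu p w g ->
  \forall x \ae mu, convolution mu (fun y => z * f y)%R g x = (z * convolution mu f g x)%R.
Proof.
move=> Lf Lg; apply: aeS (convolutionZr z Lf Lg) => x <-.
apply: (eq_Cintegral mu (f := fun y => (z * f y) * g (y^-1 * x)%g)%R) => y.
by rewrite mulrAC mulrA mulrC mulrA.
Qed.

(** At a fixed x this is [integral_convolution_pairing] with the test function y -> h (y^-1 x). Its
    absolute convergence holds for almost every x, because |f| * |g| is again in L^p(G, w) and so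
    (|f| * |g|) * |h| is finite almost everywhere. *)
Lemma convolutionA f g h : Lpw mu p w f -> Lpw mu p w g -> Lpw mu p w h ->
  \forall x \ae mu, convolution mu (convolution mu f g) h x =
    convolution mu f (convolution mu g h) x.
Proof.
move=> Lf Lg Lh; have [mf fy] := Lf; have [mg gy] := Lg; have [mh hy] := Lh.
have abs (k : G -> R[i]) : Lpw mu p w k -> Lpw mu p w (fun x => (nc (k x))%:C).
  move=> Lk; have [mk _] := Lk.
  apply: (le_Lpw p_gt0 _ ww ww Lk); first exact: Cmeasurable_real (measurable_normc mk).
  by move=> x; rewrite normc_real ger0_norm// normc_ge0.
have Lk := Lpw_convolution (abs _ Lf) (abs _ Lg).
set k := convolution mu _ _ in Lk.
have kE : \forall y \ae mu, aconv mu (fun y => nc (f y)) (fun y => nc (g y)) y = (nc (k y))%:E.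
  apply: aeS (Lpw_aconv_lty Lf Lg) => y ay.
  have a0 : 0 <= aconv mu (fun y => nc (f y)) (fun y => nc (g y)) y.
    by apply: aconv_ge0 => x; exact: normc_ge0.
  by rewrite /k convolution_real normc_real ger0_norm ?fine_ge0// fineK// ge0_fin_numE.
apply: aeS (Lpw_aconv_lty Lk Lh) => x xy.
have mhx : Cmeasurable (fun y => h (y^-1 * x)%g).
  exact: Cmeasurable_comp (measurable_quotient x) mh.
have fin : \int[mu]_y ((nc (h (y^-1 * x)%g))%:E *
    aconv mu (fun y => nc (f y)) (fun y => nc (g y)) y) < +oo.
  apply: le_lt_trans xy; rewrite le_eqVlt; apply/orP; left; apply/eqP.
  apply: ae_eq_integral => //.
  - apply: emeasurable_funM; first exact: measurable_normc_EFin.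
    by apply: measurable_aconv => //; [exact: measurable_normc|exact: measurable_normc|
      move=> y; exact: normc_ge0|move=> y; exact: normc_ge0].
  - apply: (measurable_aconv_integrand (f := fun y => nc (k y)) (g := fun y => nc (h y))).
      by apply: measurable_normc; case: Lk.
    exact: measurable_normc.
  - by apply: aeS kE => y -> _; rewrite -EFinM mulrC.
have := integral_convolution_pairing H mf mg mhx fin.
rewrite /convolution => E; transitivity (Cintegral mu (fun y => h (y^-1 * x)%g * convolution mu f g y)%R).
  by apply: eq_Cintegral => y; rewrite mulrC.
rewrite E; apply: eq_Cintegral => z; congr (_ * _)%R.
rewrite -[LHS](Cintegral_transl H z); last first.
  apply: CmeasurableM; last exact: mhx.
  exact: (Cmeasurable_comp (measurable_mull z^-1%g) mg).
by apply: eq_Cintegral => y; rewrite mulKg invgM mulgA.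
Qed.

(** After Tonelli, Cauchy-Schwarz and translation invariance bound the inner integral by |g|_2 |h|_2
    uniformly in z, and f is integrable. *)
Lemma pairing_lty f g h : Cmeasurable f -> Cmeasurable g -> Cmeasurable h ->
  Lpw_norm mu 1 (cst 1%R) f < +oo -> Lpw_norm mu 2 (cst 1%R) g < +oo ->
  Lpw_norm mu 2 (cst 1%R) h < +oo ->
  \int[mu]_y ((nc (h y))%:E * aconv mu (fun z => nc (f z)) (fun z => nc (g z)) y) < +oo.
Proof.
move=> mf mg mh; rewrite L1_norm => fy gy hy.
have [_ ->] := aconv_product H (measurable_normc mf) (measurable_normc mg)
  (fun=> normc_ge0 _) (fun=> normc_ge0 _) (measurable_normc mh) (fun=> normc_ge0 _).
have mgz z : Cmeasurable (fun y => g (z^-1 * y)%g).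
  exact: (Cmeasurable_comp (measurable_mull z^-1%g) mg).
have N2 k : (\int[mu]_x (nc (k x) `^ 2)%:E) `^ 2^-1 = Lpw_norm mu 2 (cst 1%R) k.
  by apply: (congr1 (fun t => t `^ 2^-1)); apply: eq_integral => x _; rewrite powR1 mulr1.
have gz z : \int[mu]_y (nc (g (z^-1 * y)%g) * nc (h y))%:E <=
    Lpw_norm mu 2 (cst 1%R) g * Lpw_norm mu 2 (cst 1%R) h.
  have h2 : (2^-1 + 2^-1 = 1 :> R)%R by field.
  have := hoelder_nonneg mu (ltr1n R 2) (ltr0n R 2) h2 (measurable_normc (mgz z))
    (measurable_normc mh) (fun=> normc_ge0 _) (fun=> normc_ge0 _).
  rewrite !N2 => /le_trans; apply; rewrite -!N2.
  rewrite (integral_transl H z^-1%g (f := fun y => (nc (g y) `^ 2)%:E))//.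
  by apply/measurable_EFinP; apply: measurable_powR_comp; exact: measurable_normc.
have gh_fin : Lpw_norm mu 2 (cst 1%R) g * Lpw_norm mu 2 (cst 1%R) h \is a fin_num.
  have fin k : Lpw_norm mu 2 (cst 1%R) k < +oo -> Lpw_norm mu 2 (cst 1%R) k \is a fin_num.
    by rewrite ge0_fin_numE//; exact: Lpw_norm_ge0.
  by apply: fin_numM; exact: fin.
set c := Lpw_norm mu 2 (cst 1%R) g * _ in gz gh_fin.
have c0 : 0 <= c by apply: mule_ge0; exact: Lpw_norm_ge0.
apply: (@le_lt_trans _ _ (\int[mu]_z ((fine c)%:E * (nc (f z))%:E))); last first.
  rewrite ge0_integralZl_EFin ?fine_ge0//; last 2 first.
  - by move=> x _; rewrite lee_fin normc_ge0.
  - exact: measurable_normc_EFin.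
  by rewrite lte_mul_pinfty ?lee_fin ?fine_ge0.
apply: ge0_le_integral => //.
- move=> z _; apply: mule_ge0; first by rewrite lee_fin normc_ge0.
  by apply: integral_ge0 => y _; rewrite lee_fin mulr_ge0 ?normc_ge0.
- apply: emeasurable_funM; first exact: measurable_normc_EFin.
  rewrite (_ : (fun z => _) = aconv mu (fun y => nc (h y)) (fun y => nc (g y^-1%g))); last first.
    by apply/funext => z; apply: eq_integral => y _; rewrite invgM invgK mulrC.
  apply: (measurable_aconv H); do ?[by move=> y; exact: normc_ge0].
    exact: measurable_normc.
  exact: (measurableT_comp (measurable_normc mg) (@measurable_invg G)).
- apply: emeasurable_funM => //; exact: measurable_normc_EFin.
- move=> z _; rewrite muleC; apply: lee_wpmul2r; first by rewrite lee_fin normc_ge0.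
  by rewrite fineK//; exact: gz.
Qed.

Section Adjoint.
Variables f g k : G -> R[i].
Hypotheses (mf : Cmeasurable f) (mg : Cmeasurable g) (mk : Cmeasurable k).
Hypotheses (fy : Lpw_norm mu 1 (cst 1%R) f < +oo)
  (gy : Lpw_norm mu 2 (cst 1%R) g < +oo) (ky : Lpw_norm mu 2 (cst 1%R) k < +oo).

Lemma convolution_adjoint :
  Cintegral mu (fun t => convolution mu (involution f) k t * (g t)^*%C)%R =
  Cintegral mu (fun t => k t * (convolution mu f g t)^*%C)%R.
Proof.
have mif := Cmeasurable_involution mf; have mig := Cmeasurable_involution mg.
have n1 : weight (cst 1%R : G -> R) by exact: weight1.
have conj_lty j : Lpw_norm mu 2 (cst 1%R) j < +oo ->
    Lpw_norm mu 2 (cst 1%R) (fun x => (j x)^*%C) < +oo.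
  apply: le_lt_trans; rewrite le_eqVlt; apply/orP; left; apply/eqP.
  by apply: (congr1 (fun t => t `^ 2^-1)); apply: eq_integral => x _; rewrite normc_conj.
have ify : Lpw_norm mu 1 (cst 1%R) (involution f) < +oo by rewrite Lpw_norm_involution.
have innerE z : Cintegral mu (fun y => g (z^-1 * y)%g * (k y)^*%C)%R =
    (convolution mu k (involution g) z)^*%C.
  rewrite -Cintegral_conj; apply: eq_Cintegral => y.
  by rewrite rmorphM /= /involution conjcK invgM invgK mulrC.
transitivity (Cintegral mu (fun z => (f z)^*%C * convolution mu k (involution g) z)%R).
  transitivity (Cintegral mu (fun y => (g y)^*%C * convolution mu (involution f) k y)%R).
    by apply: eq_Cintegral => y; rewrite mulrC.
  rewrite (integral_convolution_pairing H mif mk (Cmeasurable_conj mg)); last first.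
    exact: pairing_lty mif mk (Cmeasurable_conj mg) ify ky (conj_lty _ gy).
  rewrite -[RHS](Cintegral_inverse H); last first.
    by apply: CmeasurableM; [exact: Cmeasurable_conj|exact: Cmeasurable_convolution].
  apply: eq_Cintegral => z; rewrite /involution; congr (_ * _)%R.
  rewrite /convolution -[LHS](Cintegral_transl H z); last first.
    apply: CmeasurableM; last exact: Cmeasurable_conj.
    exact: (Cmeasurable_comp (measurable_mull z^-1%g) mk).
  by apply: eq_Cintegral => y; rewrite mulKg !invgM !invgK.
transitivity (Cintegral mu (fun t => (k t)^*%C * convolution mu f g t)%R)^*%C.
  rewrite (integral_convolution_pairing H mf mg (Cmeasurable_conj mk)); last first.
    exact: pairing_lty mf mg (Cmeasurable_conj mk) fy gy (conj_lty _ ky).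
  rewrite -Cintegral_conj; apply: eq_Cintegral => z.
  rewrite innerE rmorphM /=.
  exact: (congr1 (fun t => (f z)^*%C * t)%R (esym (conjcK _))).
rewrite -Cintegral_conj; apply: eq_Cintegral => t.
by rewrite rmorphM /= conjcK.
Qed.

End Adjoint.

Section PolynomialWeight.
Variable C : R.
Hypotheses (C_gt0 : (0 < C)%R) (wC : forall x y, (w (x * y)%g <= C * (w x + w y))%R).

Let v x : R := (w x `^ (- q))%R.

Let mv : measurable_fun [set: borel G] ((fun x => (v x)%:E) : borel G -> \bar R).
Proof. by apply/measurable_EFinP; exact: measurable_powR_comp. Qed.

(** On [S] the polynomial condition gives w (y^-1 x) <= C (1 + M) w x. Inserted in the convolution
    inequality of (LPAlg) at x, this makes the factor w (x)^-q cancel, leaving a bound that depends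
    neither on x nor on [S]. *)
Lemma dual_weight_integral_le (S : set G) (M : R) (x : G) : (0 <= M)%R ->
  measurable (S : set (borel G)) -> (forall y, S y -> w y <= M * w x)%R ->
  \int[mu]_(y in (S : set (borel G))) (v y)%:E <= ((C * (1 + M)) `^ q)%:E.
Proof.
move=> M0 mS Sx; set K := (C * (1 + M))%R.
have K0 : (0 < K)%R by rewrite mulr_gt0// ltr_pwDl.
have Ky y : S y -> (K `^ (- q) * v x <= v (y^-1 * x)%g)%R.
  move=> Sy; rewrite /v -powRM ?(ltW K0) ?(ltW (w_gt0 _))// ![(_ `^ (- q))%R]powRN.
  rewrite lef_pV2 ?posrE ?powR_gt0//; last by rewrite mulr_gt0.
  apply: ge0_ler_powR; rewrite ?nnegrE; [exact: ltW|exact: ltW|by rewrite mulr_ge0 ?ltW|].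
  rewrite (le_trans (wC _ _))// (lpalg_sym wl) /K -mulrA ler_pM2l// mulrDl mul1r addrC.
  by rewrite lerD2l Sx.
have v0 y : (0 < v y)%R by exact: powR_gt0.
have : \int[mu]_(y in (S : set (borel G))) ((K `^ (- q) * v x)%:E * (v y)%:E) <= (v x)%:E.
  apply: le_trans (lpalg_conv wl x).
  apply: (@le_trans _ _ (\int[mu]_(y in (S : set (borel G))) (w y `^ (- q) * w ((y : G)^-1 * x)%g `^ (- q))%:E)).
    apply: ge0_le_integral => //.
    - by move=> y _; rewrite -EFinM lee_fin ltW// mulr_gt0// mulr_gt0// powR_gt0.
    - by apply: emeasurable_funM => //; exact: measurable_funTS.
    - apply: measurable_funTS.
      apply: (measurable_aconv_integrand (f := v) (g := v)).
        exact: measurable_powR_comp.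
      exact: measurable_powR_comp.
    - by move=> y Sy; rewrite -EFinM lee_fin mulrC ler_pM2l// Ky.
  apply: ge0_subset_integral => //.
  - apply: (measurable_aconv_integrand (f := v) (g := v)).
      exact: measurable_powR_comp.
    exact: measurable_powR_comp.
  - by move=> y _; rewrite lee_fin mulr_ge0// powR_ge0.
rewrite ge0_integralZl_EFin//; last 3 first.
- by move=> y _; rewrite lee_fin ltW.
- exact: measurable_funTS.
- by rewrite mulr_ge0 ?powR_ge0.
rewrite -[X in _ <= X -> _]mule1 mulrC EFinM -muleA lee_pmul2l ?lte_fin//.
rewrite -(@lee_pmul2l _ (K `^ q)%:E) ?lte_fin ?powR_gt0// muleA -EFinM powRN divff ?mul1e ?mule1//.
by rewrite gt_eqF// powR_gt0.
Qed.

(** If w is bounded, the previous bound applies to the whole group. Otherwise, for each n some x has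
    w x > n, and the bound with M = 1 holds on {w <= n}; monotone convergence concludes. *)
Lemma dual_weight_integral_lty : \int[mu]_x (w x `^ (- q))%:E < +oo.
Proof.
have [[M wM]|/forallNP unb] := pselect (exists M, forall x, w x <= M)%R.
  have M0 : (0 <= M)%R by apply: le_trans (wM 1%g); rewrite ltW.
  apply: le_lt_trans (dual_weight_integral_le (S := setT) (x := 1%g) M0 _ _) (ltry _) => //.
  move=> y _; apply: (le_trans (wM y)).
  by rewrite ler_peMr//; exact: lpalg_ge1 wl _.
have mB n : measurable ([set x : borel G | (w x <= n%:R)%R]).
  have := mw measurableT (measurable_itv `]-oo, (n%:R : R)]).
  rewrite (_ : [set x : borel G | (w x <= n%:R)%R] = setT `&` w @^-1` `]-oo, n%:R])//.
  by rewrite setTI; apply/seteqP; split => x /=; rewrite in_itv.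
have := @ge0_nondecreasing_set_cvg_integral _ _ _ (fun n => [set x : borel G | (w x <= n%:R)%R])
  (fun x => (v x)%:E) mu.
have mv' n : measurable_fun [set x : borel G | (w x <= n%:R)%R] (fun x : borel G => (v x)%:E).
  exact: measurable_funTS.
move=> /(_ _ mB mv').
have S_homo : {homo (fun n => [set x : borel G | (w x <= n%:R)%R]) : n m / (n <= m)%N >-> (n <= m)%O}.
  move=> m n mn; apply/subsetPset => x /= /le_trans; apply.
  by rewrite ler_nat.
move=> /(_ S_homo) => cv.
have v0 n (x : borel G) : [set x : borel G | (w x <= n%:R)%R] x -> 0 <= (v x)%:E.
  by move=> _; rewrite lee_fin powR_ge0.
have {}cv := cv v0.
have ST : \bigcup_n [set x : borel G | (w x <= n%:R)%R] = setT.
  apply/seteqP; split => // x _; exists (Num.truncn (w x)).+1 => //=.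
  by apply: ltW; exact: truncnS_gt.
rewrite ST in cv.
apply: (@le_lt_trans _ _ ((C * (1 + 1)) `^ q)%:E); last exact: ltry.
rewrite -(cvg_lim (@ereal_hausdorff R) cv).
apply: lime_le; first by apply/cvg_ex; eexists; exact: cv.
apply: nearW => n; have /existsNP[x /negP] := unb n%:R; rewrite -ltNge => nx.
apply: (dual_weight_integral_le (x := x)) => //.
by move=> y /= yn; rewrite mul1r (le_trans yn)// ltW.
Qed.

Lemma L1_norm_le : exists2 c : R, (0 < c)%R & forall f, Cmeasurable f ->
  Lpw_norm mu 1 (cst 1%R) f <= c%:E * Lpw_norm mu p w f.
Proof.
pose I := \int[mu]_x (w x `^ (- q))%:E.
have I0 : 0 <= I by apply: integral_ge0 => x _; rewrite lee_fin powR_ge0.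
have Iq_fin : I `^ q^-1 \is a fin_num.
  by rewrite (ge0_fin_numE (poweR_ge0 _ _)); apply: poweR_lty; exact: dual_weight_integral_lty.
(* The summand 1 only keeps the constant positive. *)
exists (fine (I `^ q^-1) + 1)%R; first by rewrite ltr_wpDl// fine_ge0// poweR_ge0.
move=> f mf; rewrite L1_norm.
have := hoelder_nonneg mu p_gt1 q_gt0 pq (mF mf) mu_ (F_ge0 f) u_ge0.
under eq_integral do rewrite -FE.
rewrite FNE (poweRK (lt0r_neq0 p_gt0) (Lpw_norm_ge0 _ _ _ _)).
under [X in _ <= _ * X `^ _ -> _]eq_integral do rewrite uq.
move=> /le_trans; apply; rewrite muleC; apply: lee_wpmul2r; first exact: Lpw_norm_ge0.
by rewrite -/I -{1}(fineK Iq_fin) lee_fin lerDl.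
Qed.

End PolynomialWeight.
End WeightedAlgebra.

(** * Completeness *)

Section RieszFischer.
Variables (R : realType) (G : topologicalGroupType).
Variable mu : {measure set (borel G) -> \bar R}.
Variables (p : R) (v : G -> R).
Hypotheses (p_ge1 : 1 <= p) (wv : weight v) (v_gt0 : forall x, 0 < v x).
Variable f : nat -> G -> R[i].
Hypothesis Lf : forall n, Lpw mu p v (f n).
Hypothesis fast : forall n,
  (Lpw_norm mu p v (fun x => f n.+1 x - f n x)%R <= (2^-1 ^+ n)%:E)%E.

Let Re_subc (x y : R[i]) : complex.Re (x - y) = complex.Re x - complex.Re y.
Proof. by case: x; case: y. Qed.

Let Im_subc (x y : R[i]) : complex.Im (x - y) = complex.Im x - complex.Im y.
Proof. by case: x; case: y. Qed.

Let p_gt0 : 0 < p. Proof. exact: lt_le_trans p_ge1. Qed.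

Let mf n : Cmeasurable (f n). Proof. by case: (Lf n). Qed.

Let s n k x : R := \sum_(j < k) nc (f (n + j).+1 x - f (n + j)%N x).

Let s_ge0 n k x : 0 <= s n k x. Proof. by apply: sumr_ge0 => j _; exact: normc_ge0. Qed.

Let s_nondecreasing n x : {homo (s n)^~ x : k l / (k <= l)%N >-> k <= l}.
Proof.
apply: homo_leq => [//|k l m|k]; first exact: le_trans.
by rewrite /s big_ord_recr /= lerDl normc_ge0.
Qed.

Let ms n k : measurable_fun [set: borel G] (s n k : borel G -> R).
Proof.
apply: measurable_sum => j; apply: measurable_normc; exact: CmeasurableB.
Qed.

Let s_norm n k : (Lpw_norm mu p v (fun x => (s n k x)%:C)%R <=
  (2^-1 ^+ n * (2 - 2 * 2^-1 ^+ k))%:E)%E.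
Proof.
elim: k => [|k IH].
  rewrite expr0 mulr1 subrr mulr0 (_ : (fun _ => _) = fun=> 0); last first.
    by apply/funext => x; rewrite /s big_ord0.
  by rewrite Lpw_norm0.
have d : Cmeasurable (fun x => f (n + k).+1 x - f (n + k)%N x) by exact: CmeasurableB.
have mg : Cmeasurable (fun x => (nc (f (n + k).+1 x - f (n + k)%N x))%:C).
  exact: Cmeasurable_real (measurable_normc d).
rewrite (_ : (fun _ => _) = fun x => (s n k x)%:C +
    (nc (f (n + k).+1 x - f (n + k)%N x))%:C); last first.
  by apply/funext => x; rewrite /s big_ord_recr rmorphD.
have h := Lpw_normD mu p_gt0 p_ge1 (Cmeasurable_real (ms n k)) mg wv.
apply: (le_trans h).
apply: (@le_trans _ _ ((2^-1 ^+ n * (2 - 2 * 2^-1 ^+ k))%:E + (2^-1 ^+ (n + k))%:E)%E).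
  apply: leeD => //; apply: le_trans (fast (n + k)).
  apply: Lpw_norm_le => // x.
  by rewrite normc_real ger0_norm// normc_ge0.
rewrite -EFinD lee_fin exprD exprS le_eqVlt; apply/orP; left; apply/eqP; by field.
Qed.

Let phi n k x : \bar R := (s n k x `^ p * v x `^ p)%:E.

Let phi_ge0 n k x : (0 <= phi n k x)%E.
Proof. by rewrite lee_fin mulr_ge0// powR_ge0. Qed.

Let mphi n k : measurable_fun [set: borel G] (phi n k : borel G -> \bar R).
Proof.
apply/measurable_EFinP; apply: measurable_funM; apply: measurable_powR_comp => //.
by case: wv.
Qed.

Let phi_nondecreasing n x : {homo (phi n)^~ x : k l / (k <= l)%N >-> (k <= l)%E}.
Proof.
move=> k l kl; rewrite lee_fin ler_wpM2r ?powR_ge0//.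
apply: ge0_ler_powR; rewrite ?nnegrE//; [exact: ltW|exact: s_nondecreasing].
Qed.

(** The limit is taken on p-th powers with the weight included, so that monotone convergence bounds
    its integral by the p-th power of the tail 2 * 2^-n of the geometric series. *)
Let Phi n x : \bar R := limn (fun k => phi n k x).

Let phi_le_Phi n k x : (phi n k x <= Phi n x)%E.
Proof.
rewrite /Phi (cvg_lim _ (ereal_nondecreasing_cvgn (phi_nondecreasing n x)))//.
by apply: ereal_sup_ubound; exists k.
Qed.

Let mPhi n : measurable_fun [set: borel G] (Phi n : borel G -> \bar R).
Proof.
apply: (@emeasurable_fun_cvg _ (borel G) R setT (fun k => phi n k) (Phi n)) => // x _.
by apply: ereal_nondecreasing_is_cvgn; exact: phi_nondecreasing.
Qed.

Let Phi_le n : (\int[mu]_x Phi n x <= ((2 * 2^-1 ^+ n) `^ p)%:E)%E.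
Proof.
rewrite (monotone_convergence mu measurableT (mphi n)) => [|k x _|x _]; last 2 first.
- exact: phi_ge0.
- exact: phi_nondecreasing.
apply: lime_le.
  apply: ereal_nondecreasing_is_cvgn => k l kl.
  by apply: ge0_le_integral => // x _; exact: phi_nondecreasing.
apply: nearW => k.
rewrite (_ : (\int[mu]_x phi n k x)%E = (Lpw_norm mu p v (fun x => (s n k x)%:C)%R `^ p)%E); last first.
  rewrite (Lpw_normX _ p_gt0); apply: eq_integral => x _.
  by rewrite normc_real ger0_norm.
rewrite -poweR_EFin; apply: le_poweR; [exact: ltW|exact: Lpw_norm_ge0|].
apply: le_trans (s_norm n k) _; rewrite lee_fin mulrC ler_wpM2r ?exprn_ge0//.
by rewrite gerBl mulr_ge0 ?exprn_ge0.
Qed.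

Let Phi_lty : \forall x \ae mu, forall n, (Phi n x < +oo)%E.
Proof.
apply: ae_all_nat => n.
have iP : mu.-integrable [set: borel G] (Phi n).
  apply/integrableP; split; first exact: mPhi.
  apply: le_lt_trans (ltry ((2 * 2^-1 ^+ n) `^ p)); apply: le_trans (Phi_le n).
  rewrite le_eqVlt; apply/orP; left; apply/eqP; apply: eq_integral => x _.
  by rewrite gee0_abs// (le_trans (phi_ge0 n 0 x)).
apply: aeS (integrable_ae measurableT iP) => x /(_ Logic.I).
by rewrite fin_numElt => /andP[].
Qed.

Let s_le n k x : (Phi n x < +oo)%E -> s n k x <= (fine (Phi n x) / v x `^ p) `^ p^-1.
Proof.
move=> Py; have P0 : (0 <= Phi n x)%E by apply: le_trans (phi_le_Phi n 0 x).
rewrite -[leLHS](powRr1 (s_ge0 n k x)) -[X in _ `^ X <= _](divff (lt0r_neq0 p_gt0)) powRrM.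
apply: ge0_ler_powR; rewrite ?nnegrE ?powR_ge0//.
- by rewrite invr_ge0 ltW.
- by rewrite divr_ge0 ?fine_ge0 ?powR_ge0.
rewrite ler_pdivlMr ?powR_gt0// -lee_fin fineK; first exact: phi_le_Phi.
by rewrite ge0_fin_numE.
Qed.

Let normc_telescope n k x : nc (f (n + k)%N x - f n x) <= s n k x.
Proof.
elim: k => [|k IH]; first by rewrite addn0 subrr Normc.normc0.
rewrite -(subrKA (f (n + k)%N x)) addrC addnS; apply: le_trans (le_normcD _ _) _.
by rewrite /s big_ord_recr lerD.
Qed.

(** Upper limits exist everywhere and are measurable. They are the actual limits wherever the
    telescoping series converges absolutely, hence almost everywhere. *)
Let F x : R[i] := fine (limn_esup (fun n => (complex.Re (f n x))%:E)) +i*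
  fine (limn_esup (fun n => (complex.Im (f n x))%:E)).

Let mF : Cmeasurable F.
Proof.
split => /=; (apply: measurableT_comp (fine_measurable measurableT) _;
  apply: measurable_fun_limn_esup => n; apply/measurable_EFinP; by have [] := mf n).
Qed.

Let cvg_part (h : R[i] -> R) x : (forall y z, `|h y - h z| <= nc (y - z)) ->
  (Phi 0 x < +oo)%E ->
  h (f n x) @[n --> \oo] --> fine (limn_esup (fun n => (h (f n x))%:E)).
Proof.
move=> hL Py; pose d n := h (f n x).
have cs : cvgn (series (telescope d)).
  apply: normed_cvg; apply: nondecreasing_is_cvgn.
    apply: nondecreasing_series => n _ _; exact: normr_ge0.
  exists ((fine (Phi 0 x) / v x `^ p) `^ p^-1) => _ [k _ <-].
  apply: le_trans (s_le k Py); rewrite /s.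
  have -> : [normed series (telescope d)] k = \sum_(j < k) `|telescope d j|.
    by rewrite -(big_mkord xpredT (fun j => `|telescope d j|)).
  by apply: ler_sum => j _; exact: hL.
have cd : cvgn d.
  rewrite (_ : d = (fun n => d 0%N + series (telescope d) n)); last first.
    by apply/funext => n; rewrite -eq_sum_telescope.
  by apply: is_cvgD => //; exact: is_cvg_cst.
have cdE : (h (f n x))%:E @[n --> \oo] --> (limn d)%:E.
  by apply/fine_cvgP; split; [exact: nearW|exact: cd].
have [_ ->] := cvg_limn_einf_sup cdE.
exact: cd.
Qed.

(** Almost everywhere |F - f_n| is at most (Phi_n / v^p)^(1/p), the sum of the moduli of all later
    increments. The bound on the integral of [Phi] then gives the rate of convergence, and n = 0
    gives membership in the space. *)
Lemma riesz_fischer : exists2 F : G -> R[i], Lpw mu p v F &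
  forall n, (Lpw_norm mu p v (fun x => F x - f n x)%R <= (2 * 2^-1 ^+ n)%:E)%E.
Proof.
have close n : (Lpw_norm mu p v (fun x => F x - f n x)%R <= (2 * 2^-1 ^+ n)%:E)%E.
  have e0 : (0 <= (2 * 2^-1 ^+ n : R)%:E)%E by rewrite lee_fin mulr_ge0 ?exprn_ge0.
  rewrite -(poweRK (lt0r_neq0 p_gt0) e0).
  apply: le_poweR; [by rewrite invr_ge0 ltW|exact: Lpw_integral_ge0|].
  rewrite poweR_EFin; apply: le_trans (Phi_le n).
  apply: ae_ge0_le_integral => //.
  - by move=> x _; rewrite lee_fin mulr_ge0// powR_ge0.
  - by apply: measurable_Lpw_integrand => //; exact: CmeasurableB.
  - by move=> x _; apply: le_trans (phi_le_Phi n 0 x).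
  apply: aeS Phi_lty => x Px _; have Pn := Px n.
  set B := (fine (Phi n x) / v x `^ p) `^ p^-1.
  have P0 : (0 <= Phi n x)%E by apply: le_trans (phi_le_Phi n 0 x).
  have cr : complex.Re (f m x) @[m --> \oo] --> complex.Re (F x).
    by apply: (cvg_part _ (Px 0%N)) => y z; rewrite -Re_subc; exact: Re_le_normc.
  have ci : complex.Im (f m x) @[m --> \oo] --> complex.Im (F x).
    by apply: (cvg_part _ (Px 0%N)) => y z; rewrite -Im_subc; exact: Im_le_normc.
  have B0 : 0 <= B by exact: powR_ge0.
  have FB : nc (F x - f n x) <= B.
    rewrite -(@ler_pXn2r _ 2) ?nnegrE ?normc_ge0// normc_sqr Re_subc Im_subc.
    have sq (a : nat -> R) (b c : R) : a m @[m --> \oo] --> b ->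
        (a m - c) ^+ 2 @[m --> \oo] --> (b - c) ^+ 2.
      move=> ab; have abc : a m - c @[m --> \oo] --> b - c by apply: cvgB ab (cvg_cst _).
      by rewrite expr2; under eq_fun do rewrite expr2; exact: cvgM.
    have c2 : (complex.Re (f m x) - complex.Re (f n x)) ^+ 2 +
        (complex.Im (f m x) - complex.Im (f n x)) ^+ 2 @[m --> \oo] -->
        (complex.Re (F x) - complex.Re (f n x)) ^+ 2 +
        (complex.Im (F x) - complex.Im (f n x)) ^+ 2.
      by apply: cvgD; exact: sq.
    rewrite -(cvg_lim (@Rhausdorff R) c2); apply: limr_le; first by apply/cvg_ex; eexists; exact: c2.
    near=> m; rewrite -Re_subc -Im_subc -normc_sqr ler_pXn2r ?nnegrE ?normc_ge0//.
    have nm : (n <= m)%N by near: m; exact: nbhs_infty_ge.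
    by rewrite -(subnKC nm); apply: le_trans (normc_telescope _ _ _) (s_le _ Pn).
  rewrite -[leRHS]fineK ?ge0_fin_numE// lee_fin.
  rewrite -ler_pdivlMr ?powR_gt0//.
  rewrite -[leRHS]powRr1 ?divr_ge0 ?fine_ge0 ?powR_ge0//.
  rewrite -[X in _ <= _ `^ X](mulVf (lt0r_neq0 p_gt0)) powRrM.
  apply: ge0_ler_powR; rewrite ?nnegrE ?normc_ge0//; exact: ltW.
exists F => //; split; first exact: mF.
have := Lpw_normD mu p_gt0 p_ge1 (CmeasurableB mF (mf 0)) (mf 0) wv.
under eq_fun do rewrite subrK.
move=> /le_lt_trans; apply; apply: lte_add_pinfty; last by case: (Lf 0).
by apply: le_lt_trans (close 0) _; exact: ltry.
Unshelve. all: by end_near.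
Qed.

End RieszFischer.

(** * The Banach *-algebra *)

(* Packs the hypotheses, so that lp_space can carry canonical instances. *)
Record lp_setting (R : realType) (G : topologicalGroupType) := LpSetting {
  lp_mu : {measure set (borel G) -> \bar R} ;
  lp_p : R ;
  lp_q : R ;
  lp_w : G -> R ;
  lp_haar : unimodular_haar lp_mu ;
  lp_p_gt1 : 1 < lp_p ;
  lp_pq : lp_p^-1 + lp_q^-1 = 1 ;
  lp_alg : LPAlg lp_mu lp_q lp_w
}.

Section LpSpace.
Context {R : realType} {G : topologicalGroupType}.
Variable S : lp_setting R G.

Local Notation mu := (lp_mu S).
Local Notation p := (lp_p S).
Local Notation w := (lp_w S).
Local Notation Lp := (Lpw mu p w).
Implicit Types f g : G -> R[i].

Let p_gt1 := lp_p_gt1 S.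
Let p_gt0 : 0 < p. Proof. exact: lt_trans p_gt1. Qed.
Let p_ge1 : 1 <= p. Proof. exact: ltW. Qed.
Let ww : weight w := lpalg_weight (lp_alg S).
Let H := lp_haar S.

Let ae_refl (T : Type) (f : G -> T) : \forall x \ae mu, f x = f x.
Proof. by exists set0; split; [exact: measurable0|exact: measure0|move=> x; case]. Qed.

(** The choice is made from a set that depends only on the class of f, so almost equal functions
    receive the same representative. *)
Definition lp_canon f : G -> R[i] := xget (fun=> 0) [set g | Lp g /\ \forall x \ae mu, f x = g x].

(* A class modulo equality almost everywhere is represented by one chosen
   member, which makes equality of classes Leibniz equality. *)
Definition lp_space : Type := {f | Lp f /\ lp_canon f = f}.

Definition lp_rep (a : lp_space) : G -> R[i] := sval a.

Lemma lp_repP a : Lp (lp_rep a). Proof. by case: a => f []. Qed.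

Lemma lp_canonP f : Lp f -> Lp (lp_canon f) /\ \forall x \ae mu, f x = lp_canon f x.
Proof.
move=> Lf; have [] := @xgetPex _ (fun=> 0) [set g | Lp g /\ \forall x \ae mu, f x = g x].
  by exists f; split; [exact: Lf|exact: ae_refl].
by move=> *; split.
Qed.

Lemma lp_canon_eq f g : (\forall x \ae mu, f x = g x) -> lp_canon f = lp_canon g.
Proof.
move=> fg; rewrite /lp_canon; congr xget; apply/seteqP; split => h [Lh eh]; split => //.
- by apply: aeS (aeI fg eh) => x [<-].
- by apply: aeS (aeI fg eh) => x [->].
Qed.

Lemma lp_canonK f : Lp f -> Lp (lp_canon f) /\ lp_canon (lp_canon f) = lp_canon f.
Proof.
move=> Lf; have [Lc e] := lp_canonP Lf; split => //.
by apply: lp_canon_eq; apply: aeS e => x ->.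
Qed.

Definition lp_cls f : lp_space := match pselect (Lp f) with
  | left Lf => exist _ _ (lp_canonK Lf)
  | right _ => exist _ _ (lp_canonK (Lpw_cst0 mu p_gt0 w))
  end.

Lemma lp_rep_cls f : Lp f -> \forall x \ae mu, lp_rep (lp_cls f) x = f x.
Proof.
move=> Lf; rewrite /lp_cls; case: pselect => // Lf'; rewrite /lp_rep /=.
by apply: aeS (lp_canonP Lf).2 => x ->.
Qed.

Lemma lp_eqP a b : (\forall x \ae mu, lp_rep a x = lp_rep b x) -> a = b.
Proof.
case: a b => [f [Lf cf]] [g [Lg cg]]; rewrite /lp_rep /= => fg.
by apply: eq_exist => /=; rewrite -cf -cg; exact: lp_canon_eq.
Qed.

Lemma lp_cls_eq f a : Lp f -> (\forall x \ae mu, f x = lp_rep a x) -> lp_cls f = a.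
Proof.
by move=> Lf fa; apply: lp_eqP; apply: aeS (aeI (lp_rep_cls Lf) fa) => x [-> ->].
Qed.

Lemma lp_repK a : lp_cls (lp_rep a) = a.
Proof.
apply: lp_cls_eq; first exact: lp_repP.
exact: ae_refl.
Qed.

Definition lp_add (a b : lp_space) := lp_cls (fun x => lp_rep a x + lp_rep b x).
Definition lp_scale (z : R[i]) (a : lp_space) := lp_cls (fun x => z * lp_rep a x).
Definition lp_mul (a b : lp_space) := lp_cls (convolution mu (lp_rep a) (lp_rep b)).
Definition lp_star (a : lp_space) := lp_cls (involution (lp_rep a)).
Definition lp_zero := lp_cls (fun=> 0).
Definition lp_norm (a : lp_space) : R := fine (Lpw_norm mu p w (lp_rep a)).

Lemma lp_rep_add a b : \forall x \ae mu, lp_rep (lp_add a b) x = lp_rep a x + lp_rep b x.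
Proof. by apply: lp_rep_cls; apply: LpwD => //; exact: lp_repP. Qed.

Lemma lp_rep_scale z a : \forall x \ae mu, lp_rep (lp_scale z a) x = z * lp_rep a x.
Proof. by apply: lp_rep_cls; apply: LpwZ => //; exact: lp_repP. Qed.

Lemma lp_rep_zero : \forall x \ae mu, lp_rep lp_zero x = 0.
Proof. by apply: lp_rep_cls; exact: Lpw_cst0. Qed.

Lemma lp_rep_mul a b :
  \forall x \ae mu, lp_rep (lp_mul a b) x = convolution mu (lp_rep a) (lp_rep b) x.
Proof.
apply: lp_rep_cls; apply: (Lpw_convolution H p_gt1 (lp_pq S) (lp_alg S)); exact: lp_repP.
Qed.

Lemma lp_rep_star a : \forall x \ae mu, lp_rep (lp_star a) x = involution (lp_rep a) x.
Proof. by apply: lp_rep_cls; exact: (Lpw_involution H (lp_alg S)) (lp_repP a). Qed.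

Local Opaque lp_rep lp_cls lp_add lp_scale lp_mul lp_star lp_zero.

Local Ltac ae_rewrite :=
  let x := fresh "x" in let h := fresh "h" in intros x h;
  repeat match goal with h : _ /\ _ |- _ => destruct h end;
  repeat match goal with e : _ = _ |- _ => rewrite -> e; clear e end.

Lemma lp_addA : associative lp_add.
Proof.
move=> a b c; apply: lp_eqP.
apply: aeS (aeI (aeI (lp_rep_add a (lp_add b c)) (lp_rep_add b c))
  (aeI (lp_rep_add (lp_add a b) c) (lp_rep_add a b))); ae_rewrite.
by rewrite addrA.
Qed.

Lemma lp_addC : commutative lp_add.
Proof.
move=> a b; apply: lp_eqP; apply: aeS (aeI (lp_rep_add a b) (lp_rep_add b a)); ae_rewrite.
by rewrite addrC.
Qed.

Lemma lp_add0 : left_id lp_zero lp_add.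
Proof.
move=> a; apply: lp_eqP; apply: aeS (aeI (lp_rep_add lp_zero a) lp_rep_zero); ae_rewrite.
by rewrite add0r.
Qed.

Lemma lp_addN : left_inverse lp_zero (lp_scale (-1)) lp_add.
Proof.
move=> a; apply: lp_eqP; apply: aeS (aeI (aeI (lp_rep_add (lp_scale (-1) a) a)
  (lp_rep_scale (-1) a)) lp_rep_zero); ae_rewrite.
by rewrite mulN1r addNr.
Qed.

Lemma lp_scaleA z t a : lp_scale z (lp_scale t a) = lp_scale (z * t) a.
Proof.
apply: lp_eqP; apply: aeS (aeI (aeI (lp_rep_scale z (lp_scale t a)) (lp_rep_scale t a))
  (lp_rep_scale (z * t) a)); ae_rewrite.
by rewrite mulrA.
Qed.

Lemma lp_scale1 : left_id 1 lp_scale.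
Proof. by move=> a; apply: lp_eqP; apply: aeS (lp_rep_scale 1 a); ae_rewrite; rewrite mul1r. Qed.

Lemma lp_scaleDr : right_distributive lp_scale lp_add.
Proof.
move=> z a b; apply: lp_eqP; apply: aeS (aeI (aeI (lp_rep_scale z (lp_add a b)) (lp_rep_add a b))
  (aeI (lp_rep_add (lp_scale z a) (lp_scale z b))
    (aeI (lp_rep_scale z a) (lp_rep_scale z b)))); ae_rewrite.
by rewrite mulrDr.
Qed.

Lemma lp_scaleDl a : {morph lp_scale^~ a : z t / z + t >-> lp_add z t}.
Proof.
move=> z t; apply: lp_eqP; apply: aeS (aeI (lp_rep_scale (z + t) a)
  (aeI (lp_rep_add (lp_scale z a) (lp_scale t a))
    (aeI (lp_rep_scale z a) (lp_rep_scale t a)))); ae_rewrite.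
by rewrite mulrDl.
Qed.

Lemma lp_normE a : Lpw_norm mu p w (lp_rep a) = (lp_norm a)%:E.
Proof.
rewrite fineK//; have [_ ay] := lp_repP a.
by rewrite ge0_fin_numE//; exact: Lpw_norm_ge0.
Qed.

Lemma lp_norm_cls f : Lp f -> Lpw_norm mu p w f = (lp_norm (lp_cls f))%:E.
Proof.
move=> Lf; rewrite -lp_normE; apply: Lpw_norm_ae_eq => //; first by case: Lf.
- by have [] := lp_repP (lp_cls f).
- by apply: aeS (lp_rep_cls Lf); ae_rewrite.
Qed.

Let mrep a : Cmeasurable (lp_rep a). Proof. by case: (lp_repP a). Qed.

Lemma lp_norm_ae a f : Cmeasurable f -> (\forall x \ae mu, lp_rep a x = f x) ->
  Lpw_norm mu p w f = (lp_norm a)%:E.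
Proof.
move=> mf af; rewrite -lp_normE; apply: (Lpw_norm_ae_eq p_gt0 mf (mrep a) ww).
by apply: aeS af; ae_rewrite.
Qed.

Lemma lp_normD a b : lp_norm (lp_add a b) <= lp_norm a + lp_norm b.
Proof.
have e := lp_norm_ae (CmeasurableD (mrep a) (mrep b)) (lp_rep_add a b).
have h := Lpw_normD mu p_gt0 p_ge1 (mrep a) (mrep b) ww.
by rewrite -> e, (lp_normE a), (lp_normE b) in h; rewrite -EFinD lee_fin in h.
Qed.

Lemma lp_normZ z a : lp_norm (lp_scale z a) = nc z * lp_norm a.
Proof.
have e := lp_norm_ae (CmeasurableZ z (mrep a)) (lp_rep_scale z a).
have h := Lpw_normZ mu p_gt0 z (mrep a) ww.
by rewrite -> e, (lp_normE a) in h; rewrite -EFinM in h; case: h.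
Qed.

Lemma lp_norm_eq0 a : lp_norm a = 0 -> a = lp_zero.
Proof.
move=> a0; have := lp_normE a; rewrite a0 => /(Lpw_norm_eq0 p_gt0 (mrep a) ww (lpalg_gt0 (lp_alg S))).
by move=> ae0; apply: lp_eqP; apply: aeS (aeI ae0 lp_rep_zero); ae_rewrite.
Qed.

Lemma lp_normM a b : lp_norm (lp_mul a b) <= lp_norm a * lp_norm b.
Proof.
have e := lp_norm_ae (Cmeasurable_convolution H (mrep a) (mrep b)) (lp_rep_mul a b).
have h := Lpw_norm_convolution H p_gt1 (lp_pq S) (lp_alg S) (mrep a) (mrep b).
by rewrite -> e, (lp_normE a), (lp_normE b) in h; rewrite -EFinM lee_fin in h.
Qed.

Lemma lp_norm_star a : lp_norm (lp_star a) = lp_norm a.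
Proof.
have e := lp_norm_ae (Cmeasurable_involution (mrep a)) (lp_rep_star a).
have h := Lpw_norm_involution H p ww (lpalg_sym (lp_alg S)) (mrep a).
by rewrite -> e, (lp_normE a) in h; case: h.
Qed.

Lemma lp_mul_ae a b f g : Lp f -> Lp g -> (\forall x \ae mu, lp_rep a x = f x) ->
  (\forall x \ae mu, lp_rep b x = g x) ->
  \forall x \ae mu, lp_rep (lp_mul a b) x = convolution mu f g x.
Proof.
move=> [mf _] [mg _] af bg; rewrite -(convolution_ae_eq H (mrep a) mf (mrep b) mg af bg).
exact: lp_rep_mul.
Qed.

Let LpM f g : Lp f -> Lp g -> Lp (convolution mu f g).
Proof. exact: (Lpw_convolution H p_gt1 (lp_pq S) (lp_alg S)). Qed.

Let LpS f : Lp f -> Lp (involution f).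
Proof. exact: (Lpw_involution H (lp_alg S)). Qed.

Lemma lp_mulA : associative lp_mul.
Proof.
move=> a b c; apply: lp_eqP.
have La := lp_repP a; have Lb := lp_repP b; have Lc := lp_repP c.
have h1 := lp_mul_ae La (LpM Lb Lc) (ae_refl (lp_rep a)) (lp_rep_mul b c).
have h2 := lp_mul_ae (LpM La Lb) Lc (lp_rep_mul a b) (ae_refl (lp_rep c)).
have h3 := convolutionA H p_gt1 (lp_pq S) (lp_alg S) La Lb Lc.
by apply: aeS (aeI h1 (aeI h2 h3)); ae_rewrite.
Qed.

Lemma lp_mulDl : left_distributive lp_mul lp_add.
Proof.
move=> a b c; apply: lp_eqP.
have La := lp_repP a; have Lb := lp_repP b; have Lc := lp_repP c.
have h1 := lp_mul_ae (LpwD p_gt0 p_ge1 ww La Lb) Lc (lp_rep_add a b) (ae_refl (lp_rep c)).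
have h2 := aeI (lp_rep_add (lp_mul a c) (lp_mul b c)) (aeI (lp_rep_mul a c) (lp_rep_mul b c)).
have h3 := convolutionDl H p_gt1 (lp_pq S) (lp_alg S) La Lb Lc.
by apply: aeS (aeI h1 (aeI h2 h3)); ae_rewrite.
Qed.

Lemma lp_mulDr : right_distributive lp_mul lp_add.
Proof.
move=> c a b; apply: lp_eqP.
have La := lp_repP a; have Lb := lp_repP b; have Lc := lp_repP c.
have h1 := lp_mul_ae Lc (LpwD p_gt0 p_ge1 ww La Lb) (ae_refl (lp_rep c)) (lp_rep_add a b).
have h2 := aeI (lp_rep_add (lp_mul c a) (lp_mul c b)) (aeI (lp_rep_mul c a) (lp_rep_mul c b)).
have h3 := convolutionDr H p_gt1 (lp_pq S) (lp_alg S) La Lb Lc.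
by apply: aeS (aeI h1 (aeI h2 h3)); ae_rewrite.
Qed.

Lemma lp_mulZl z a b : lp_mul (lp_scale z a) b = lp_scale z (lp_mul a b).
Proof.
apply: lp_eqP; have La := lp_repP a; have Lb := lp_repP b.
have h1 := lp_mul_ae (LpwZ p_gt0 z ww La) Lb (lp_rep_scale z a) (ae_refl (lp_rep b)).
have h2 := aeI (lp_rep_scale z (lp_mul a b)) (lp_rep_mul a b).
have h3 := convolutionZl H p_gt1 (lp_pq S) (lp_alg S) z La Lb.
by apply: aeS (aeI h1 (aeI h2 h3)); ae_rewrite.
Qed.

Lemma lp_mulZr z a b : lp_mul a (lp_scale z b) = lp_scale z (lp_mul a b).
Proof.
apply: lp_eqP; have La := lp_repP a; have Lb := lp_repP b.
have h1 := lp_mul_ae La (LpwZ p_gt0 z ww Lb) (ae_refl (lp_rep a)) (lp_rep_scale z b).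
have h2 := aeI (lp_rep_scale z (lp_mul a b)) (lp_rep_mul a b).
have h3 := convolutionZr H p_gt1 (lp_pq S) (lp_alg S) z La Lb.
by apply: aeS (aeI h1 (aeI h2 h3)); ae_rewrite.
Qed.

Lemma lp_star_ae a f : (\forall x \ae mu, lp_rep a x = f x) ->
  \forall x \ae mu, lp_rep (lp_star a) x = involution f x.
Proof.
move=> af; apply: aeS (aeI (lp_rep_star a) (ae_inverse H af)) => x [e1 e2].
by rewrite -> e1; rewrite /involution; rewrite -> e2.
Qed.

Lemma lp_starK : involutive lp_star.
Proof.
move=> a; apply: lp_eqP; apply: aeS (lp_star_ae (lp_rep_star a)); ae_rewrite.
by rewrite /involution invgK conjcK.
Qed.

Lemma lp_starD : {morph lp_star : a b / lp_add a b}.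
Proof.
move=> a b; apply: lp_eqP; apply: aeS (aeI (lp_star_ae (lp_rep_add a b))
  (aeI (lp_rep_add (lp_star a) (lp_star b)) (aeI (lp_rep_star a) (lp_rep_star b)))).
by ae_rewrite; rewrite /involution rmorphD.
Qed.

Lemma lp_starZ z a : lp_star (lp_scale z a) = lp_scale z^* (lp_star a).
Proof.
apply: lp_eqP; apply: aeS (aeI (lp_star_ae (lp_rep_scale z a))
  (aeI (lp_rep_scale z^* (lp_star a)) (lp_rep_star a))).
by ae_rewrite; rewrite /involution rmorphM.
Qed.

Lemma lp_starM a b : lp_star (lp_mul a b) = lp_mul (lp_star b) (lp_star a).
Proof.
apply: lp_eqP; have La := lp_repP a; have Lb := lp_repP b.
have h1 := lp_star_ae (lp_rep_mul a b).
have h2 := lp_mul_ae (LpS Lb) (LpS La) (lp_rep_star b) (lp_rep_star a).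
apply: aeS (aeI h1 h2); ae_rewrite.
by rewrite (involution_convolution H (mrep a) (mrep b)).
Qed.

Lemma lp_complete (u : nat -> lp_space) :
  (forall n, lp_norm (lp_add (u n.+1) (lp_scale (-1) (u n))) <= 2^-1 ^+ n) ->
  exists a, forall n, lp_norm (lp_add a (lp_scale (-1) (u n))) <= 2 * 2^-1 ^+ n.
Proof.
have diff_ae a b : \forall x \ae mu,
    lp_rep (lp_add a (lp_scale (-1) b)) x = lp_rep a x - lp_rep b x.
  apply: aeS (aeI (lp_rep_add a (lp_scale (-1) b)) (lp_rep_scale (-1) b)); ae_rewrite.
  by rewrite mulN1r.
move=> fast; have [|F LF Fu] := riesz_fischer p_ge1 ww (lpalg_gt0 (lp_alg S))
    (fun n => lp_repP (u n)).
  move=> n; have e := lp_norm_ae (CmeasurableB (mrep _) (mrep _)) (diff_ae (u n.+1) (u n)).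
  by rewrite -> e; rewrite lee_fin.
exists (lp_cls F) => n; have mF : Cmeasurable F by case: LF.
have Fe : \forall x \ae mu, lp_rep (lp_add (lp_cls F) (lp_scale (-1) (u n))) x =
    F x - lp_rep (u n) x.
  by apply: aeS (aeI (diff_ae (lp_cls F) (u n)) (lp_rep_cls LF)); ae_rewrite.
have e := lp_norm_ae (CmeasurableB mF (mrep _)) Fe; have h := Fu n.
by rewrite -> e in h; rewrite lee_fin in h.
Qed.

End LpSpace.

Section FastCauchy.
Context {R : realType} {V : normedModType R[i]}.

(** Reduces completeness for Cauchy filters to the rapidly converging sequences of [riesz_fischer].
    Balls of radius 2^-n / 4 belonging to the filter meet for consecutive n, so their centres form
    such a sequence. *)
Lemma cauchy_cvg_of_fast (F : set_system V) : ProperFilter F ->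
  (forall u : nat -> V, (forall n, `|u n.+1 - u n| <= (2^-1 ^+ n)%:C) ->
    exists a, forall n, `|a - u n| <= (2 * 2^-1 ^+ n)%:C) ->
  cauchy F -> cvg F.
Proof.
move=> FF complete /cauchyP Fc.
have e_gt0 n : 0 < (2^-1 ^+ n / 4)%:C :> R[i] by rewrite ltcR divr_gt0 ?exprn_gt0.
have ex n : exists x : V, F (ball x (2^-1 ^+ n / 4)%:C) by apply: Fc.
pose u n := projT1 (cid (ex n)).
have uF n : F (ball (u n) (2^-1 ^+ n / 4)%:C) by exact: projT2 (cid (ex n)).
have pow n : 0 <= 2^-1 ^+ n :> R by rewrite exprn_ge0.
have [n|a au] := complete u.
  have [y []] := filter_ex (filterI (uF n.+1) (uF n)).
  rewrite -!ball_normE /= => y1 y2; rewrite distrC in y2.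
  rewrite -(subrKA y) (le_trans (ler_normD _ _))//.
  apply: (le_trans (lerD (ltW y1) (ltW y2))).
  rewrite -rmorphD lecR exprS.
  by have := pow n; lra.
apply/cvg_ex; exists a; apply/cvg_ballP => e e0.
have [r er] : exists r : R, e = r%:C.
  by exists (complex.Re e); rewrite RRe_real// gtr0_real.
subst e; rewrite ltcR in e0.
(* The distance from the limit to a point of the n-th ball is at most 2 * 2^-n + 2^-n / 4. *)
have [n nr] : exists n, 3 * 2^-1 ^+ n < r.
  have : 3 * 2^-1 ^+ n @[n --> \oo] --> (3 * 0 : R).
    by apply: cvgM; [exact: cvg_cst|apply: cvg_expr; rewrite ger0_norm// invf_lt1// ltr1n].
  rewrite mulr0 => /cvgr_lt /(_ _ e0) [N _ NP].
  by exists N; apply: NP => /=.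
apply: filterS (uF n) => y; rewrite -!ball_normE /= => uy.
rewrite -(subrKA (u n)) (le_lt_trans (ler_normD _ _))//.
rewrite (le_lt_trans (lerD (au n) (ltW uy)))// -rmorphD ltcR; apply: le_lt_trans nr.
by have := pow n; lra.
Qed.

End FastCauchy.

Section LpAlgebra.
Context {R : realType} {G : topologicalGroupType}.
Variable S : lp_setting R G.

HB.instance Definition _ := gen_eqMixin (lp_space S).
HB.instance Definition _ := gen_choiceMixin (lp_space S).
HB.instance Definition _ := GRing.isZmodule.Build (lp_space S)
  (@lp_addA _ _ S) (@lp_addC _ _ S) (@lp_add0 _ _ S) (@lp_addN _ _ S).
HB.instance Definition _ := GRing.Zmodule_isLmodule.Build R[i] (lp_space S)
  (@lp_scaleA _ _ S) (@lp_scale1 _ _ S) (@lp_scaleDr _ _ S) (@lp_scaleDl _ _ S).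

Lemma lp_cnormD (a b : lp_space S) :
  (lp_norm (a + b))%:C <= (lp_norm a)%:C + (lp_norm b)%:C :> R[i].
Proof. by rewrite -rmorphD lecR; exact: lp_normD. Qed.

Lemma lp_cnormZ z (a : lp_space S) : (lp_norm (z *: a))%:C = `|z| * (lp_norm a)%:C :> R[i].
Proof.
rewrite normr_normc; have -> : lp_norm (z *: a) = nc z * lp_norm a by exact: lp_normZ.
by rewrite rmorphM.
Qed.

Lemma lp_cnorm_eq0 (a : lp_space S) : (lp_norm a)%:C = 0 :> R[i] -> a = 0.
Proof. by move=> /(congr1 (@complex.Re R)) /= /lp_norm_eq0. Qed.

HB.instance Definition _ := Lmodule_isNormed.Build R[i] (lp_space S)
  lp_cnormD lp_cnormZ lp_cnorm_eq0.

Lemma lp_normrE (a : lp_space S) : `|a| = (lp_norm a)%:C. Proof. by []. Qed.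

Lemma lp_cauchy_cvg (F : set_system (lp_space S)) : ProperFilter F -> cauchy F -> cvg F.
Proof.
move=> FF; apply: cauchy_cvg_of_fast => // u fast.
have fast' n : lp_norm (lp_add (u n.+1) (lp_scale (-1) (u n))) <= 2^-1 ^+ n.
  by rewrite -lecR; exact: fast.
have [a au] := lp_complete fast'.
by exists a => n; have := au n; rewrite -lecR.
Qed.

HB.instance Definition _ := Uniform_isComplete.Build (lp_space S) lp_cauchy_cvg.

Lemma lp_cnormM (a b : lp_space S) : `|lp_mul a b| <= `|a| * `|b|.
Proof.
rewrite !lp_normrE; have := lp_normM a b; rewrite -lecR => /le_trans; apply.
by rewrite rmorphM.
Qed.

Lemma lp_cnorm_star (a : lp_space S) : `|lp_star a| = `|a|.
Proof. by rewrite !lp_normrE lp_norm_star. Qed.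

HB.instance Definition _ := isBanachStarAlgebra.Build R (lp_space S)
  (@lp_mulA _ _ S) (@lp_mulDl _ _ S) (@lp_mulDr _ _ S) (@lp_mulZl _ _ S) (@lp_mulZr _ _ S)
  lp_cnormM (@lp_starK _ _ S) (@lp_starD _ _ S) (@lp_starZ _ _ S) (@lp_starM _ _ S)
  lp_cnorm_star.

Local Notation mu := (lp_mu S).
Local Notation p := (lp_p S).
Local Notation w := (lp_w S).

Lemma lp_space_is_Lpw_algebra : is_Lpw_algebra mu p w (@lp_cls _ _ S).
Proof.
have p_gt0 : 0 < p by exact: lt_trans (lp_p_gt1 S).
have p_ge1 : 1 <= p by exact: ltW (lp_p_gt1 S).
have ww := lpalg_weight (lp_alg S).
split.
- move=> f g Lf Lg; split => [fg|fg].
    have hf := lp_rep_cls Lf; have hg := lp_rep_cls Lg; rewrite -> fg in hf.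
    by apply: aeS (aeI hf hg) => x [<- <-].
  apply: (lp_cls_eq Lf); apply: aeS (aeI fg (lp_rep_cls Lg)) => x [e1 e2].
  by rewrite -> e1, e2.
- by move=> a; exists (lp_rep a); [exact: lp_repP|exact: lp_repK].
- move=> f g Lf Lg; have Lfg := LpwD p_gt0 p_ge1 ww Lf Lg; split; first exact: Lfg.
  apply: (lp_cls_eq Lfg); apply: aeS (aeI (lp_rep_add (lp_cls S f) (lp_cls S g))
    (aeI (lp_rep_cls Lf) (lp_rep_cls Lg))) => x [e1 [e2 e3]].
  by rewrite <- e2, <- e3; exact: (esym e1).
- move=> z f Lf; have Lzf := LpwZ p_gt0 z ww Lf; split; first exact: Lzf.
  apply: (lp_cls_eq Lzf); apply: aeS (aeI (lp_rep_scale z (lp_cls S f))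
    (lp_rep_cls Lf)) => x [e1 e2].
  by rewrite <- e2; exact: (esym e1).
- move=> f g Lf Lg.
  have Lfg := Lpw_convolution (lp_haar S) (lp_p_gt1 S) (lp_pq S) (lp_alg S) Lf Lg.
  split; first exact: Lfg.
  apply: (lp_cls_eq Lfg).
  apply: aeS (lp_mul_ae Lf Lg (lp_rep_cls Lf) (lp_rep_cls Lg)) => x e.
  exact: (esym e).
- move=> f Lf; have Lif := Lpw_involution (lp_haar S) (lp_alg S) Lf.
  split; first exact: Lif.
  apply: (lp_cls_eq Lif).
  by apply: aeS (lp_star_ae (lp_rep_cls Lf)) => x e; exact: (esym e).
- by move=> f Lf; rewrite (lp_norm_cls Lf).
Qed.

End LpAlgebra.

(** * Marcinkiewicz interpolation *)

Lemma ler_powR2 (R : realType) (r a b : R) : 0 <= r -> 0 <= a -> a <= b -> a `^ r <= b `^ r.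
Proof.
by move=> r0 a0 ab; apply: ge0_ler_powR; rewrite ?nnegrE//; exact: le_trans ab.
Qed.

Lemma integralZ_EFin (d : measure_display) (T : measurableType d) (R : realType)
    (mu : {measure set T -> \bar R}) (c : R) (f : T -> R) : 0 <= c ->
  measurable_fun setT (fun x => (f x)%:E) -> (forall x, 0 <= f x) ->
  (\int[mu]_x (c * f x)%:E = c%:E * \int[mu]_x (f x)%:E)%E.
Proof.
move=> c0 mf f0; under eq_integral do rewrite EFinM.
by rewrite ge0_integralZl_EFin// => x _; rewrite lee_fin.
Qed.

Lemma powR_div (R : realType) (a b r : R) : 0 <= a -> 0 < b -> (a / b) `^ r = a `^ r * b `^ (- r).
Proof.
by move=> a0 b0; rewrite powRM ?invr_ge0 ?(ltW b0)// -powR_inv1 ?(ltW b0)// -powRrM mulN1r.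
Qed.

Lemma half_powR_lt1 (R : realType) (d : R) : 0 < d -> 2 `^ (- d) < 1 :> R.
Proof.
move=> d0; rewrite powRN invf_lt1 ?powR_gt0//; have e : 1 `^ d = 1 :> R by rewrite powR1.
rewrite -[ltLHS]e.
by apply: gt0_ltr_powR; rewrite ?nnegrE ?ltr1n.
Qed.

Section DyadicSums.
Context {R : realType}.
Variables (l : nat -> R) (d : R).
Hypotheses (l0 : 0 < l 0%N) (lS : forall k, l k.+1 = 2 * l k) (d_gt0 : 0 < d).

Lemma dyadic_gt0 k : 0 < l k.
Proof. by elim: k => [//|k IH]; rewrite lS mulr_gt0. Qed.

Lemma dyadic_level m y : l 0%N <= y < l m -> exists2 k, (k < m)%N & l k <= y < 2 * l k.
Proof.
elim: m => [|m IH] /andP[y0 ym]; first by move: (le_lt_trans y0 ym); rewrite ltxx.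
have [ylt|yge] := ltP y (l m).
  by have [|k km kP] := IH; [rewrite y0|exists k => //; exact: ltnW].
by exists m => //; rewrite yge -lS.
Qed.

Let q := 2 `^ (- d) : R.

Let q_gt0 : 0 < q. Proof. exact: powR_gt0. Qed.
Let q_lt1 : q < 1. Proof. exact: half_powR_lt1. Qed.

Let lqS k : l k `^ d = q * l k.+1 `^ d.
Proof.
by rewrite lS powRM ?ltW ?dyadic_gt0// mulrA /q powRN mulVf ?mul1r// gt_eqF ?powR_gt0.
Qed.

Lemma dyadic_sum_below m Y : 0 <= Y ->
  \sum_(k < m) (l k < Y)%R%:R * l k `^ d <= (1 - q)^-1 * Y `^ d.
Proof.
move=> Y0; rewrite mulrC ler_pdivlMr ?subr_gt0//.
(* A geometric sum is governed by its largest term. The minimum strengthens the induction: while the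
   levels stay below Y the bound l_m^d grows with them, and beyond Y the sum stops. *)
suff : (\sum_(k < m.+1) (l k < Y)%R%:R * l k `^ d) * (1 - q) <= Num.min (Y `^ d) (l m `^ d).
  rewrite big_ord_recr /= mulrDl le_min => /andP[h _]; apply: le_trans h.
  by rewrite lerDl !mulr_ge0 ?powR_ge0// subr_ge0 ltW.
have mono a b : 0 <= a -> a <= b -> a `^ d <= b `^ d.
  by apply: ler_powR2; exact: ltW.
elim: m => [|m IH].
  rewrite big_ord_recr big_ord0 /= add0r.
  case: ltP => lY; last by rewrite /= mulr0n mul0r mul0r le_min !powR_ge0.
  rewrite mul1r le_min; apply/andP; split; last by rewrite ler_piMr ?powR_ge0// gerBl ltW.
  apply: le_trans (mono _ _ (ltW (dyadic_gt0 0)) (ltW lY)).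
  by rewrite ler_piMr ?powR_ge0// gerBl ltW.
rewrite big_ord_recr /= mulrDl; case: ltP => lY.
  rewrite mul1r.
  have -> : Num.min (Y `^ d) (l m.+1 `^ d) = l m.+1 `^ d.
    by apply/min_idPr; apply: mono; [exact/ltW/dyadic_gt0|exact: ltW].
  move: IH; rewrite le_min => /andP[_]; rewrite lqS => IH.
  by apply: le_trans (lerD IH (lexx _)) _; rewrite mulrBr mulr1 [q * _]mulrC addrC subrK.
rewrite /= mulr0n mul0r mul0r addr0; move: IH; rewrite !le_min => /andP[-> IH] /=.
apply: (le_trans IH); apply: mono; first exact/ltW/dyadic_gt0.
by rewrite lS ler_peMl ?ler1n// ltW ?dyadic_gt0.
Qed.

Let lqSN k : l k.+1 `^ (- d) = q * l k `^ (- d).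
Proof. by rewrite lS powRM ?ltW ?dyadic_gt0. Qed.

Lemma dyadic_sum_above m Y : 0 < Y ->
  \sum_(k < m) (Y <= l k)%R%:R * l k `^ (- d) <= (1 - q)^-1 * Y `^ (- d).
Proof.
move=> Y0; rewrite mulrC ler_pdivlMr ?subr_gt0//.
have anti a b : 0 < a -> a <= b -> b `^ (- d) <= a `^ (- d).
  move=> a0 ab; rewrite !powRN lef_pV2 ?posrE ?powR_gt0//; last exact: lt_le_trans ab.
  by apply: ler_powR2 ab; exact: ltW.
(* The subtracted minimum is the part of the geometric series still to come; it makes the induction
   telescope. *)
suff : (\sum_(k < m) (Y <= l k)%R%:R * l k `^ (- d)) * (1 - q) <=
    Y `^ (- d) - Num.min (Y `^ (- d)) (l m `^ (- d)).
  by move=> /le_trans; apply; rewrite gerBl le_min !powR_ge0.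
elim: m => [|m IH]; first by rewrite big_ord0 mul0r subr_ge0 ge_min lexx.
rewrite big_ord_recr /= mulrDl; case: (leP Y (l m)) => lY; last first.
  rewrite /= mulr0n mul0r mul0r addr0; apply: (le_trans IH).
  rewrite (min_idPl _); last by apply: anti; [exact: dyadic_gt0|exact: ltW].
  by rewrite subrr subr_ge0 ge_min lexx.
rewrite mul1r; apply: le_trans (lerD IH (lexx _)) _.
rewrite (min_idPr _); last exact: anti.
rewrite (min_idPr _); last first.
  by apply: anti => //; rewrite lS (le_trans lY)// ler_peMl ?ler1n// ltW ?dyadic_gt0.
by rewrite lqSN mulrBr mulr1 [_ * q]mulrC addrA subrK.
Qed.

End DyadicSums.

Section Marcinkiewicz.
Variables (R : realType) (G : topologicalGroupType).
Variable mu : {measure set (borel G) -> \bar R}.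

Definition cutoff (E : set G) (f : G -> R[i]) : G -> R[i] := fun x => (\1_E x)%:C * f x.

Lemma normc_cutoff E f x : nc (cutoff E f x) = \1_E x * nc (f x).
Proof. by rewrite Normc.normcM normc_real ger0_norm. Qed.

Lemma Cmeasurable_cutoff (E : set G) f : measurable (E : set (borel G)) -> Cmeasurable f ->
  Cmeasurable (cutoff E f).
Proof.
move=> mE mf; apply: CmeasurableM => //; apply: Cmeasurable_real.
exact: (measurable_indic (D := setT) (mE : measurable (E : set (borel G)))).
Qed.

Lemma Lp_normX (r : R) f : 0 < r ->
  (Lpw_norm mu r (cst 1%R) f `^ r = \int[mu]_x (nc (f x) `^ r)%:E)%E.
Proof.
move=> r0; rewrite (Lpw_normX mu r0); apply: eq_integral => x _.
by rewrite powR1 mulr1.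
Qed.

Variables r0 p r1 : R.
Hypotheses (r0_gt0 : 0 < r0) (r0p : r0 < p) (pr1 : p < r1).

Let p_gt0 : 0 < p. Proof. exact: lt_trans r0p. Qed.
Let r1_gt0 : 0 < r1. Proof. exact: lt_trans pr1. Qed.

(** The denominators are those of the geometric series over the levels below and above |g| / s. The
    factors 2 to the power p and r1 come from halving |T g| between two pieces and from the width of
    a dyadic level. Only the exponents enter, so the constant is the same for all powers of an
    operator. *)
Definition marcinkiewicz_cst : R :=
  2 `^ p / (1 - 2 `^ (- (p - r0))) + 2 `^ r1 / (1 - 2 `^ (- (r1 - p))).

Lemma marcinkiewicz_cst_gt0 : 0 < marcinkiewicz_cst.
Proof.
apply: addr_gt0; apply: divr_gt0; rewrite ?powR_gt0// subr_gt0.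
- by rewrite half_powR_lt1// subr_gt0.
- by rewrite half_powR_lt1// subr_gt0.
Qed.

Variables (T : (G -> R[i]) -> (G -> R[i])) (g : G -> R[i]) (M0 M1 s : R).
Hypotheses (M0_gt0 : 0 < M0) (M1_gt0 : 0 < M1) (s_gt0 : 0 < s).
Hypotheses (mg : Cmeasurable g) (mTg : Cmeasurable (T g)).
Hypothesis mT : forall E : set G, measurable (E : set (borel G)) -> Cmeasurable (T (cutoff E g)).
Hypothesis TD : forall E : set G, measurable (E : set (borel G)) ->
  \forall x \ae mu, T g x = T (cutoff E g) x + T (cutoff (~` E) g) x.
Hypothesis T0 : forall E : set G, measurable (E : set (borel G)) ->
  (Lpw_norm mu r0 (cst 1%R) (T (cutoff E g)) <= M0%:E * Lpw_norm mu r0 (cst 1%R) (cutoff E g))%E.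
Hypothesis T1 : forall E : set G, measurable (E : set (borel G)) ->
  (Lpw_norm mu r1 (cst 1%R) (T (cutoff E g)) <= M1%:E * Lpw_norm mu r1 (cst 1%R) (cutoff E g))%E.

Let F x := nc (T g x).
Let c0 := (1 - 2 `^ (- (p - r0)))^-1.
Let c1 := (1 - 2 `^ (- (r1 - p)))^-1.

Section Levels.
Variables (l : nat -> R) (m : nat).
Hypotheses (l0 : 0 < l 0%N) (lS : forall k, l k.+1 = 2 * l k).

Let big k : set G := [set x | s * l k < nc (g x)].

Let mbig k : measurable (big k : set (borel G)).
Proof.
have := measurable_normc mg measurableT (measurable_itv `](s * l k), +oo[).
rewrite (_ : big k = setT `&` (fun x => nc (g x)) @^-1` `](s * l k), +oo[)//.
by rewrite setTI; apply/seteqP; split => x /=; rewrite in_itv/= andbT.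
Qed.

Let h0 k x := nc (T (cutoff (big k) g) x).
Let h1 k x := nc (T (cutoff (~` big k) g) x).

Let l_gt0 k : 0 < l k. Proof. exact: dyadic_gt0. Qed.

(** One of the two pieces has modulus at least F x / 2, and F x is comparable to [l k]. The piece
    from large values of g is measured in L^r0, the other one in L^r1. *)
Let pointwise k x : T g x = T (cutoff (big k) g) x + T (cutoff (~` big k) g) x ->
  l k <= F x < 2 * l k ->
  F x `^ p <= 2 `^ p * l k `^ (p - r0) * h0 k x `^ r0 + 2 `^ r1 * l k `^ (p - r1) * h1 k x `^ r1.
Proof.
move=> Tx /andP[lF F2].
have F_gt0 : 0 < F x by exact: lt_le_trans (l_gt0 k) lF.
have h0_ge0 : 0 <= h0 k x by exact: normc_ge0.
have h1_ge0 : 0 <= h1 k x by exact: normc_ge0.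
have Fh : F x <= h0 k x + h1 k x by rewrite /F Tx; exact: le_normcD.
have [h01|h01] := leP (h1 k x) (h0 k x).
  apply: ler_wpDr; first by rewrite !mulr_ge0 ?powR_ge0.
  have Fh0 : F x <= 2 * h0 k x by apply: (le_trans Fh); rewrite mulr2n mulrDl !mul1r lerD.
  have -> : F x `^ p = F x `^ (p - r0) * F x `^ r0.
    by rewrite -powRD ?subrK// (gt_eqF F_gt0) implybT.
  have -> : 2 `^ p * l k `^ (p - r0) * h0 k x `^ r0 =
      (2 * l k) `^ (p - r0) * (2 * h0 k x) `^ r0.
    have e : 2 `^ p = 2 `^ (p - r0) * 2 `^ r0 :> R.
      by rewrite -powRD ?subrK// pnatr_eq0 implybT.
    by rewrite (powRM _ _ (ltW (l_gt0 k))) // (powRM _ _ h0_ge0)// mulrACA -e mulrA.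
  apply: ler_pM; rewrite ?powR_ge0//.
    by apply: ler_powR2; rewrite ?subr_ge0 ltW.
  by apply: ler_powR2 => //; exact: ltW.
apply: ler_wpDl; first by rewrite !mulr_ge0 ?powR_ge0.
have Fh1 : F x <= 2 * h1 k x.
  by apply: (le_trans Fh); rewrite mulr2n mulrDl !mul1r lerD// ltW.
have -> : F x `^ p = F x `^ (p - r1) * F x `^ r1.
  by rewrite -powRD ?subrK// (gt_eqF F_gt0) implybT.
have -> : 2 `^ r1 * l k `^ (p - r1) * h1 k x `^ r1 = l k `^ (p - r1) * (2 * h1 k x) `^ r1.
  by rewrite powRM// mulrCA mulrA.
apply: ler_pM; rewrite ?powR_ge0//.
  rewrite -opprB !powRN lef_pV2 ?posrE ?powR_gt0//.
  by apply: ler_powR2 lF; rewrite ?subr_ge0 ltW.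
by apply: ler_powR2 => //; exact: ltW.
Qed.

Let D : set G := [set x | l 0%N <= F x < l m].

Let mD : measurable (D : set (borel G)).
Proof.
have := measurable_normc mTg measurableT (measurable_itv `[l 0%N, l m[).
rewrite (_ : D = setT `&` (fun x => nc (T g x)) @^-1` `[l 0%N, l m[)//.
by rewrite setTI; apply/seteqP; split => x /=; rewrite in_itv.
Qed.

Let mpow (f : G -> R[i]) (r c : R) : Cmeasurable f ->
  measurable_fun [set: borel G] (fun x : borel G => (c * nc (f x) `^ r)%:E).
Proof.
move=> mf; apply/measurable_EFinP; apply: measurable_funM => //.
exact: measurable_powR_comp (measurable_normc mf).
Qed.

Let bound (r c M : R) (E : nat -> set G) :
  0 < r -> 0 < M -> (forall k, measurable (E k : set (borel G))) ->
  (forall E : set G, measurable (E : set (borel G)) ->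
    (Lpw_norm mu r (cst 1%R) (T (cutoff E g)) <= M%:E * Lpw_norm mu r (cst 1%R) (cutoff E g))%E) ->
  forall k, (\int[mu]_x (nc (T (cutoff (E k) g) x) `^ r)%:E <=
    (M `^ r)%:E * \int[mu]_x (\1_(E k) x * nc (g x) `^ r)%:E)%E.
Proof.
move=> rp Mp mE TM k; rewrite -Lp_normX//.
have -> : (\int[mu]_x (\1_(E k) x * nc (g x) `^ r)%:E =
    Lpw_norm mu r (cst 1%R) (cutoff (E k) g) `^ r)%E.
  rewrite Lp_normX//; apply: eq_integral => x _; rewrite normc_cutoff powRM ?normc_ge0//.
  rewrite indicE; case: (x \in E k); first by rewrite powR1.
  by rewrite powR0 ?gt_eqF// !mul0r.
rewrite -poweR_EFin -poweRM ?Lpw_norm_ge0 ?lee_fin ?(ltW Mp)//.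
by apply: le_poweR; [exact: ltW|exact: Lpw_norm_ge0|exact: TM].
Qed.

Let I : \bar R := (\int[mu]_x (nc (g x) `^ p)%:E)%E.

Let level_sum (r c K : R) (a : nat -> R) (E : nat -> set G) (M : R) : 0 < r -> 0 <= c -> 0 < M ->
  0 <= K -> (forall k, 0 <= a k) ->
  (forall k, measurable (E k : set (borel G))) ->
  (forall E : set G, measurable (E : set (borel G)) ->
    (Lpw_norm mu r (cst 1%R) (T (cutoff E g)) <= M%:E * Lpw_norm mu r (cst 1%R) (cutoff E g))%E) ->
  (forall x, \sum_(k < m) c * a k * (\1_(E k) x * nc (g x) `^ r) <= K * nc (g x) `^ p) ->
  (\sum_(k < m) \int[mu]_x (c * a k * nc (T (cutoff (E k) g) x) `^ r)%:E <= (M `^ r * K)%:E * I)%E.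
Proof.
move=> rp c_ge0 Mp K0 a0 mE TM EK.
have m1 k : measurable_fun [set: borel G] (fun x : borel G => (\1_(E k) x * nc (g x) `^ r)%:E).
  apply/measurable_EFinP; apply: measurable_funM.
    exact: (measurable_indic (D := setT) (mE k : measurable (E k : set (borel G)))).
  exact: measurable_powR_comp (measurable_normc mg).
have ge1 k x : 0 <= \1_(E k) x * nc (g x) `^ r :> R by rewrite mulr_ge0 ?powR_ge0.
apply: (@le_trans _ _ ((M `^ r)%:E *
    \sum_(k < m) \int[mu]_x (c * a k * (\1_(E k) x * nc (g x) `^ r))%:E)%E).
  rewrite ge0_sume_distrr; last first.
    move=> k _; apply: integral_ge0 => x _; rewrite lee_fin; apply: mulr_ge0 => //.
    exact: mulr_ge0.
  apply: lee_sum => k _; have ca : 0 <= c * a k by exact: mulr_ge0.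
  have m2 : measurable_fun setT (fun x : borel G => (nc (T (cutoff (E k) g) x) `^ r)%:E).
    by have := mpow r 1 (mT (mE k)); under eq_fun do rewrite mul1r.
  rewrite (integralZ_EFin mu ca m2) ?(integralZ_EFin mu ca (m1 k))//; last first.
    by move=> x; exact: powR_ge0.
  by rewrite muleCA; apply: lee_wpmul2l; [rewrite lee_fin|exact: bound].
rewrite EFinM -muleA; apply: lee_wpmul2l; first by rewrite lee_fin powR_ge0.
rewrite -ge0_integral_sum//; last 2 first.
- move=> k; under eq_fun do rewrite EFinM; apply: emeasurable_funM => //.
- by move=> k x _; rewrite lee_fin; apply: mulr_ge0 => //; exact: mulr_ge0.
have mgp : measurable_fun setT (fun x : borel G => (nc (g x) `^ p)%:E).
  by have := mpow p 1 mg; under eq_fun do rewrite mul1r.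
rewrite /I -(integralZ_EFin mu K0 mgp); last by move=> x; exact: powR_ge0.
apply: ge0_le_integral => //.
- by move=> x _; apply: sume_ge0 => k _; rewrite lee_fin; apply: mulr_ge0 => //; exact: mulr_ge0.
- apply: emeasurable_sum => k.
  by under eq_fun do rewrite EFinM; apply: emeasurable_funM.
- exact: mpow p K mg.
- by move=> x _; rewrite sumEFin lee_fin; exact: EK.
Qed.

(** Each x in [D] lies in one dyadic level, and bounding its term by the sum over all levels allows
    the two norm estimates to be integrated level by level. For fixed x, the sum over k of the
    resulting powers of |g x| is a geometric series, comparable to |g x|^p. *)
Lemma marcinkiewicz_levels :
  (\int[mu]_(x in (D : set (borel G))) (F x `^ p)%:E <=
   ((M0 `^ r0 * (2 `^ p * c0 * s `^ (- (p - r0)))) +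
    (M1 `^ r1 * (2 `^ r1 * c1 * s `^ (r1 - p))))%:E * I)%E.
Proof.
have I_ge0 : (0 <= I)%E by apply: integral_ge0 => x _; rewrite lee_fin powR_ge0.
pose H0 k x := (2 `^ p * l k `^ (p - r0) * h0 k x `^ r0)%:E.
pose H1 k x := (2 `^ r1 * l k `^ (p - r1) * h1 k x `^ r1)%:E.
have mbigC k : measurable (~` big k : set (borel G)) by exact: measurableC.
have mH0 k : measurable_fun [set: borel G] (H0 k : borel G -> \bar R).
  by apply: mpow; exact: mT.
have mH1 k : measurable_fun [set: borel G] (H1 k : borel G -> \bar R).
  by apply: mpow; exact: mT.
have H0_ge0 k x : (0 <= H0 k x)%E by rewrite lee_fin !mulr_ge0 ?powR_ge0.
have H1_ge0 k x : (0 <= H1 k x)%E by rewrite lee_fin !mulr_ge0 ?powR_ge0.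
have c0_gt0 : 0 < c0 by rewrite invr_gt0 subr_gt0; rewrite half_powR_lt1// subr_gt0.
have c1_gt0 : 0 < c1 by rewrite invr_gt0 subr_gt0; rewrite half_powR_lt1// subr_gt0.
have mS (H : nat -> G -> \bar R) : (forall k, measurable_fun [set: borel G] (H k : borel G -> \bar R)) ->
    measurable_fun [set: borel G] ((fun x => \sum_(k < m) H k x)%E : borel G -> \bar R).
  by move=> mH; apply: emeasurable_sum => k.
have S_ge0 (H : nat -> G -> \bar R) x : (forall k, 0 <= H k x)%E -> (0 <= \sum_(k < m) H k x)%E.
  by move=> H_ge0; apply: sume_ge0 => k _; exact: H_ge0.
apply: (@le_trans _ _ (\int[mu]_x (\sum_(k < m) H0 k x + \sum_(k < m) H1 k x))%E).
  apply: (@le_trans _ _ (\int[mu]_(x in (D : set (borel G))) (\sum_(k < m) H0 k x + \sum_(k < m) H1 k x))%E).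
    apply: ae_ge0_le_integral => //.
    - by move=> x _; rewrite lee_fin powR_ge0.
    - apply: measurable_funTS; have := mpow p 1 mTg; by under eq_fun do rewrite mul1r.
    - by move=> x _; apply: adde_ge0; exact: S_ge0.
    - by apply: measurable_funTS; apply: emeasurable_funD; exact: mS.
    have ae_all : \forall x \ae mu, forall k, T g x = T (cutoff (big k) g) x + T (cutoff (~` big k) g) x.
      by apply: ae_all_nat => k; exact: TD.
    apply: aeS ae_all => x Tx Dx.
    have [k km kF] := dyadic_level lS Dx.
    have h := pointwise (Tx k) kF.
    apply: (@le_trans _ _ (H0 k x + H1 k x)%E); first by rewrite -EFinD lee_fin.
    apply: leeD.
      by rewrite (bigD1 (Ordinal km))//= leeDl// sume_ge0.
    by rewrite (bigD1 (Ordinal km))//= leeDl// sume_ge0.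
  apply: ge0_subset_integral => //.
  - by apply: emeasurable_funD; exact: mS.
  - by move=> x _; apply: adde_ge0; exact: S_ge0.
rewrite ge0_integralD//; last 4 first.
- by move=> x _; exact: S_ge0.
- exact: mS.
- by move=> x _; exact: S_ge0.
- exact: mS.
rewrite EFinD ge0_muleDl; last 2 first.
- by rewrite lee_fin !mulr_ge0 ?powR_ge0// ltW.
- by rewrite lee_fin !mulr_ge0 ?powR_ge0// ltW.
have g0 x : 0 <= nc (g x) by exact: normc_ge0.
apply: leeD.
  rewrite ge0_integral_sum//.
  apply: (level_sum (a := fun k => l k `^ (p - r0)) (E := big)) => //.
  - by rewrite !mulr_ge0 ?powR_ge0// ltW.
  - by move=> k; exact: powR_ge0.
  move=> x; have [gx0|gx0] := eqVneq (nc (g x)) 0.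
    by rewrite big1 ?mulr_ge0 ?powR_ge0 ?(ltW c0_gt0)// => k _; rewrite gx0 powR0 ?gt_eqF// !mulr0.
  have gx : 0 < nc (g x) by rewrite lt0r gx0 g0.
  have d_gt0 : 0 < p - r0 by rewrite subr_gt0.
  have Y0 : 0 <= nc (g x) / s by rewrite divr_ge0// ltW.
  have h := ler_wpM2l (mulr_ge0 (powR_ge0 2 p) (powR_ge0 (nc (g x)) r0))
    (dyadic_sum_below l0 lS d_gt0 m Y0).
  move: h; rewrite mulr_sumr -/c0 => h; apply: le_trans (le_trans h _).
    rewrite le_eqVlt; apply/orP; left; apply/eqP; apply: eq_bigr => k _.
    have -> : \1_(big k) x = (l k < nc (g x) / s)%R%:R :> R.
      rewrite indicE ltr_pdivlMr// [_ * s]mulrC; congr (nat_of_bool _)%:R.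
      by apply/idP/idP; rewrite inE.
    by move: (_%:R) => b; ring.
  rewrite powR_div// le_eqVlt; apply/orP; left; apply/eqP.
  have -> : nc (g x) `^ p = nc (g x) `^ r0 * nc (g x) `^ (p - r0).
    by rewrite -powRD ?[r0 + _]addrC ?subrK// (gt_eqF gx) implybT.
  by ring.
rewrite ge0_integral_sum//.
apply: (level_sum (a := fun k => l k `^ (p - r1)) (E := fun k => ~` big k)) => //.
- by rewrite !mulr_ge0 ?powR_ge0// ltW.
- by move=> k; exact: powR_ge0.
move=> x; have [gx0|gx0] := eqVneq (nc (g x)) 0.
  by rewrite big1 ?mulr_ge0 ?powR_ge0 ?(ltW c1_gt0)// => k _; rewrite gx0 powR0 ?gt_eqF// !mulr0.
have gx : 0 < nc (g x) by rewrite lt0r gx0 g0.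
have d_gt0 : 0 < r1 - p by rewrite subr_gt0.
have Y0 : 0 < nc (g x) / s by rewrite divr_gt0.
have h := ler_wpM2l (mulr_ge0 (powR_ge0 2 r1) (powR_ge0 (nc (g x)) r1))
  (dyadic_sum_above l0 lS d_gt0 m Y0).
move: h; rewrite mulr_sumr -/c1 opprB => h; apply: le_trans (le_trans h _).
  rewrite le_eqVlt; apply/orP; left; apply/eqP; apply: eq_bigr => k _.
  have -> : \1_(~` big k) x = (nc (g x) / s <= l k)%R%:R :> R.
    rewrite indicE ler_pdivrMr// [_ * s]mulrC leNgt in_setC; congr (nat_of_bool (~~ _))%:R.
    by apply/idP/idP; rewrite inE.
  by move: (_%:R) => b; ring.
rewrite powR_div// opprB le_eqVlt; apply/orP; left; apply/eqP.
have -> : nc (g x) `^ p = nc (g x) `^ r1 * nc (g x) `^ (p - r1).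
  by rewrite -powRD ?[r1 + _]addrC ?subrK// (gt_eqF gx) implybT.
by ring.
Qed.

End Levels.

(** The region {2^-n <= |T g| < 2^n} is covered by 2 n dyadic levels with a bound independent of n,
    and these regions exhaust {T g <> 0}. The threshold [s] is left free, to be chosen so that the
    two terms balance. *)
Lemma marcinkiewicz : (Lpw_norm mu p (cst 1%R) (T g) `^ p <=
  (marcinkiewicz_cst * (M0 `^ r0 * s `^ (r0 - p) + M1 `^ r1 * s `^ (r1 - p)))%:E *
    Lpw_norm mu p (cst 1%R) g `^ p)%E.
Proof.
set B := (X in (_ <= X)%E); rewrite Lp_normX//.
pose D n : set (borel G) := [set x : borel G | (2^-1 ^+ n <= F x < 2 ^+ n)].
have c0_gt0 : 0 < c0 by rewrite invr_gt0 subr_gt0; rewrite half_powR_lt1// subr_gt0.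
have c1_gt0 : 0 < c1 by rewrite invr_gt0 subr_gt0; rewrite half_powR_lt1// subr_gt0.
have mF : measurable_fun [set: borel G] (F : borel G -> R) by exact: measurable_normc.
have mFp : measurable_fun [set: borel G] (fun x : borel G => (F x `^ p)%:E).
  by apply/measurable_EFinP; exact: measurable_powR_comp.
have mD n : measurable (D n).
  have := measurable_normc mTg measurableT (measurable_itv `[(2^-1 ^+ n : R), 2 ^+ n[).
  rewrite (_ : D n = setT `&` (fun x => nc (T g x)) @^-1` `[2^-1 ^+ n, 2 ^+ n[)//.
  by rewrite setTI; apply/seteqP; split => x /=; rewrite in_itv.
have DB n : (\int[mu]_(x in D n) (F x `^ p)%:E <= B)%E.
  have l0 : 0 < (fun k => 2^-1 ^+ n * 2 ^+ k) 0%N :> R by rewrite mulr_gt0 ?exprn_gt0.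
  have lS k : 2^-1 ^+ n * 2 ^+ k.+1 = 2 * (2^-1 ^+ n * 2 ^+ k) :> R by rewrite exprS mulrCA.
  have := marcinkiewicz_levels (n + n) l0 lS.
  rewrite expr0 mulr1 exprD mulrA -exprMn mulVf ?pnatr_eq0// expr1n mul1r.
  move=> /le_trans; apply; rewrite /B Lp_normX//; apply: lee_wpmul2r.
    by apply: integral_ge0 => x _; rewrite lee_fin powR_ge0.
  rewrite lee_fin mulrDr opprB; apply: lerD.
    rewrite (_ : _ * _ = 2 `^ p * c0 * (M0 `^ r0 * s `^ (r0 - p))); last by ring.
    apply: ler_wpM2r; first by rewrite mulr_ge0 ?powR_ge0.
    by rewrite /marcinkiewicz_cst lerDl mulr_ge0 ?powR_ge0// ltW.
  rewrite (_ : _ * _ = 2 `^ r1 * c1 * (M1 `^ r1 * s `^ (r1 - p))); last by ring.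
  apply: ler_wpM2r; first by rewrite mulr_ge0 ?powR_ge0.
  by rewrite /marcinkiewicz_cst lerDr mulr_ge0 ?powR_ge0// ltW.
have D_homo : {homo D : n m / (n <= m)%N >-> (n <= m)%O}.
  move=> n m nm; apply/subsetPset => x /= /andP[nF Fn]; apply/andP; split.
    by apply: le_trans nF; rewrite ler_wiXn2l// invf_le1// ler1n.
  by apply: lt_le_trans Fn _; rewrite ler_eXn2l// ltr1n.
have F_ge0 n (x : borel G) : D n x -> (0 <= (F x `^ p)%:E)%E by move=> _; rewrite lee_fin powR_ge0.
have cv := ge0_nondecreasing_set_cvg_integral (mu := mu) D_homo mD
  (fun n => measurable_funTS mFp) F_ge0.
have pow_gt (y : R) n : (Num.truncn y < n)%N -> y < 2 ^+ n.
  move=> yn; apply: (lt_le_trans (truncnS_gt y)); apply: (@le_trans _ _ n%:R).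
    by rewrite ler_nat.
  by rewrite -natrX ler_nat ltnW// ltn_expl.
have -> : (\int[mu]_x (nc (T g x) `^ p)%:E = \int[mu]_(x in \bigcup_n D n) (F x `^ p)%:E)%E.
  rewrite [RHS]integral_mkcond; apply: eq_integral => x _; rewrite patchE.
  case: ifPn => //; rewrite notin_setE => nx.
  suff F0 : F x = 0 by rewrite -/(F x) F0 powR0 ?gt_eqF.
  apply/eqP; apply: contra_notT nx => Fx0.
  have Fx : 0 < F x by rewrite lt0r Fx0 normc_ge0.
  exists (maxn (Num.truncn (F x)).+1 (Num.truncn (F x)^-1).+1) => //=.
  rewrite /D /= pow_gt ?leq_maxl// andbT exprVn invf_ple ?posrE ?exprn_gt0//.
  by apply: ltW; apply: pow_gt; rewrite leq_maxr.
rewrite -(cvg_lim (@ereal_hausdorff R) cv).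
by apply: lime_le; [apply/cvg_ex; eexists; exact: cv|exact: nearW].
Qed.

End Marcinkiewicz.

(** * Slowly varying weights *)

Section PowerShift.
Context {R : realType}.
Implicit Types d e h : R.

Lemma expr1D_le (n : nat) d : 0 <= d <= 1 -> (1 + d) ^+ n <= 1 + 3 ^+ n * d.
Proof.
move=> /andP[d0 d1]; elim: n => [|n IH]; first by rewrite !expr0 mul1r lerDl.
have p3 : 1 <= 3 ^+ n :> R by rewrite exprn_ege1// ler1n.
rewrite exprSr; apply: (@le_trans _ _ ((1 + 3 ^+ n * d) * (1 + d))).
  by rewrite ler_wpM2r// addr_ge0.
rewrite exprS; set t := 3 ^+ n in p3 *.
have td : t * d * d <= t * d by rewrite ler_piMr// mulr_ge0// (le_trans ler01).
have dt : d <= t * d by rewrite ler_peMl.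
by lra.
Qed.

(** For h >= d / c the shift multiplies h by at most 1 + c, and c is small enough for (1 + c)^n <= 1
    + e. For smaller h the left-hand side is bounded by a constant. *)
Lemma expr_shift (n : nat) d e : 0 <= d -> 0 < e ->
  exists2 D, 0 <= D & forall h, 0 <= h -> (h + d) ^+ n <= (1 + e) * h ^+ n + D.
Proof.
move=> d0 e0; pose c := Num.min 1 (e / 3 ^+ n).
have c0 : 0 < c by rewrite lt_min ltr01 divr_gt0// exprn_gt0.
have c1 : c <= 1 by rewrite ge_min lexx.
have ce : c * 3 ^+ n <= e by rewrite -ler_pdivlMr ?exprn_gt0// ge_min lexx orbT.
exists ((d / c + d) ^+ n); first by rewrite exprn_ge0// addr_ge0// divr_ge0// ltW.
move=> h h0; have [hd|hd] := leP (d / c) h.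
  apply: ler_wpDr; first by rewrite exprn_ge0// addr_ge0// divr_ge0// ltW.
  rewrite ler_pdivrMr// in hd.
  apply: (@le_trans _ _ ((h * (1 + c)) ^+ n)).
    by rewrite lerXn2r ?nnegrE ?addr_ge0 ?mulr_ge0// ?addr_ge0 ?(ltW c0)// mulrDr mulr1 lerD2l.
  rewrite exprMn mulrC ler_wpM2r ?exprn_ge0//.
  by rewrite (le_trans (expr1D_le n _)) ?(ltW c0) ?c1// lerD2l mulrC.
apply: ler_wpDl; first by rewrite mulr_ge0 ?exprn_ge0// addr_ge0// ltW.
by rewrite lerXn2r ?nnegrE ?addr_ge0 ?divr_ge0 ?(ltW c0)// lerD2r ltW.
Qed.

End PowerShift.

Lemma set_expg_split (G : topologicalGroupType) (K : set G) m n x : set_expg K (m + n) x ->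
  exists y z, [/\ set_expg K m y, set_expg K n z & x = (y * z)%g].
Proof.
elim: m x => [|m IH] x; first by exists 1%g, x; split => //; rewrite mul1g.
move=> /= [a Ka [b /IH[y [z [Ky Kz ->]]] <-]].
by exists (a * y)%g, z; split => //; [exists a => //; exists y|rewrite mulgA].
Qed.

Section SlowWeight.
Context {R : realType} {G : topologicalGroupType}.
Variable v : G -> R.
Hypotheses (v_cont : continuous v) (v_ge0 : forall x, 0 <= v x)
  (v_sym : forall x, v x^-1%g = v x)
  (v_quasi : forall x y, v (x * y)%g <= 2 * Num.max (v x) (v y)).
Variable b : R.
Hypothesis b_ge0 : 0 <= b.

Let B : set G := [set x | v x <= b].

(** A word of length at most 2^k is cut into two words of length at most 2^(k-1), and each halving
    costs a factor 2. The constant 2 in [v_quasi] is exactly what makes the growth of v linear in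
    the word length. *)
Let v_pow2 k i x : (0 < i <= 2 ^ k)%N -> set_expg B i x -> v x <= 2 ^+ k * b.
Proof.
elim: k i x => [|k IH] i x /andP[i0 ik].
  have -> : i = 1%N by apply/eqP; rewrite eqn_leq ik i0.
  by move=> /= [y By [z /= -> <-]]; rewrite mulg1 expr0 mul1r.
have [ik'|ik'] := leqP i (2 ^ k).
  move=> /(IH _ _ (_ : (0 < i <= 2 ^ k)%N)); rewrite i0 ik' => /(_ isT) /le_trans; apply.
  by rewrite ler_wpM2r// exprS ler_peMl ?exprn_ge0// ler1n.
rewrite -(subnKC (ltnW ik')) => /set_expg_split [y [z [By Bz ->]]].
apply: (le_trans (v_quasi _ _)); rewrite exprS -mulrA ler_pM2l// ge_max.
rewrite (IH _ _ _ By) ?expn_gt0//= (IH _ _ _ Bz)// subn_gt0 ik' leq_subLR.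
by rewrite expnS mul2n -addnn in ik.
Qed.

Let v_expg i x : (0 < i)%N -> set_expg B i x -> v x <= 2 * b * i%:R.
Proof.
case: i => // -[|i] _ Bx.
  have := @v_pow2 0 1 x isT Bx; rewrite expr0 mul1r mulr1 => /le_trans; apply.
  by rewrite ler_peMl// ler1n.
(* With 2^k the least power of 2 that is at least the word length, 2^k is less than twice that
   length. *)
have /andP[lo hi] := up_log_bounds (ltnSn 1) (ltn0Sn i : 1 < i.+2)%N.
set k := up_log 2 i.+2 in lo hi.
have k0 : (0 < k)%N by rewrite lt0n; apply/eqP => k0; rewrite k0 in hi.
apply: (le_trans (@v_pow2 k i.+2 x _ Bx)); first by rewrite hi.
rewrite -mulrA [b * _]mulrC mulrA ler_wpM2r// -(prednK k0) exprS ler_pM2l//.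
by rewrite -natrX ler_nat ltnW.
Qed.

(* The infimal convolution h of v with 2 b times the word length of B varies by
   at most 2 b under left translation by B; it stays comparable to v because v
   is O(i) on B^i. *)
Let S x : set R := [set r | exists i y, set_expg B i y /\ r = v (y^-1 * x)%g + 2 * b * i%:R].

Let h x := inf (S x).

Let S_ge0 x r : S x r -> 0 <= r.
Proof. by move=> [i [y [_ ->]]]; rewrite addr_ge0// !mulr_ge0. Qed.

Let S_v x : S x (v x).
Proof. by exists 0%N, 1%g; split => //=; rewrite invg1 mul1g mulr0 addr0. Qed.

Let S_inf x : has_inf (S x).
Proof. by split; [exists (v x)|exists 0 => r; exact: S_ge0]. Qed.

Let h_le x r : S x r -> h x <= r.
Proof. by move=> Sr; apply: ge_inf => //; case: (S_inf x). Qed.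

Let h_ge0 x : 0 <= h x.
Proof. by apply: lb_le_inf; [exists (v x)|move=> r; exact: S_ge0]. Qed.

Let h_ge x : v x / 2 <= h x.
Proof.
apply: lb_le_inf; first by exists (v x).
move=> r [i [y [By ->]]]; rewrite ler_pdivrMr// mulrC.
case: i By => [/= ->|i By].
  by rewrite invg1 mul1g mulr0 addr0 ler_peMl// ler1n.
rewrite -[X in v X](mulVKg y) (le_trans (v_quasi _ _))// ler_pM2l// ge_max.
by rewrite lerDl mulr_ge0 ?mulr_ge0// andbT ler_wpDl// v_expg.
Qed.

Let h_shift y x : v y <= b -> h (y * x)%g <= h x + 2 * b.
Proof.
move=> By; rewrite -lerBlDr; apply: lb_le_inf; first by exists (v x).
move=> r [i [z [Bz ->]]]; rewrite lerBlDr; apply: h_le.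
exists i.+1, (y * z)%g; split; first by exists y => //; exists z.
rewrite invgM -mulgA mulKg -[i.+1%:R]natr1 (mulrDr (2 * b)) mulr1; exact: esym (addrA _ _ _).
Qed.

Let h_shiftV y x : v y <= b -> h x <= h (y * x)%g + 2 * b.
Proof. by move=> By; rewrite -[X in h X](mulKg y) h_shift// v_sym. Qed.

(** An infimum over uncountably many words need not be measurable; this one is upper semicontinuous,
    because each sublevel set is a union of open sets. *)
Let h_open r : open [set x | h x < r].
Proof.
rewrite (_ : [set x | h x < r] = \bigcup_(iy in [set iy : nat * G | set_expg B iy.1 iy.2])
    [set x | v (iy.2^-1 * x)%g < r - 2 * b * iy.1%:R]); last first.
  apply/seteqP; split => x /=.
    move=> /(inf_lt (S_inf x).1) [_ [i [y [By ->]]] lt_r].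
    by exists (i, y) => //=; rewrite ltrBrDr.
  move=> [[i y] /= By]; rewrite ltrBrDr; apply: le_lt_trans; apply: h_le.
  by exists i, y.
apply: bigcup_open => -[i y] _ /=.
rewrite (_ : [set _ | _] = (fun x => v (y^-1 * x)%g) @^-1` [set t | t < r - 2 * b * i%:R])//.
apply: open_comp; last exact: open_lt.
move=> x _; apply: continuous_comp; [exact: continuous_mull|exact: v_cont].
Qed.

Lemma slow_quasinorm : exists h : G -> R,
  [/\ measurable_fun [set: borel G] (h : borel G -> R),
      forall x, v x / 2 <= h x <= v x,
      forall y x, v y <= b -> h (y * x)%g <= h x + 2 * b &
      forall y x, v y <= b -> h x <= h (y * x)%g + 2 * b].
Proof.
exists h; split; [|by move=> x; rewrite h_ge h_le|exact: h_shift|exact: h_shiftV].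
apply: (measurability _ (RGenInftyO.measurableE R)).
move=> _ [_ [r ->] <-]; rewrite setTI.
apply: measurable_open.
by rewrite (_ : _ @^-1` _ = [set x | h x < r]) //; apply/seteqP; split => x /=; rewrite in_itv.
Qed.

End SlowWeight.

(** A suitable root v of w satisfies the hypotheses of [slow_quasinorm]. Raising the slow function
    to the n-th power turns its bounded additive variation into a relative error e plus a constant.
    The comparison constant c = 2^-n is fixed before T. *)
Lemma slow_weight (R : realType) (G : topologicalGroupType) (w : G -> R) :
  continuous w -> (forall x, 1 <= w x) -> (forall x, w x^-1%g = w x) -> polynomial_weight w ->
  exists2 c : R, 0 < c & forall T : R, exists w' : G -> R,
    [/\ measurable_fun [set: borel G] (w' : borel G -> R),
        forall x, c * w x <= w' x <= w x &
        forall e, 0 < e -> exists2 D, 0 <= D &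
          forall y x, w y <= T -> `|w' (y * x)%g - w' x| <= e * w' x + D].
Proof.
move=> w_cont w_ge1 w_sym [C C0 wC].
have w_gt0 x : 0 < w x by exact: lt_le_trans (w_ge1 x).
(* Chosen so that 2 C <= 2^n: then w (x y) <= 2 C max (w x) (w y) gives v (x y) <= 2 max (v x) (v y)
   for v = w^(1/n). *)
pose n := (Num.truncn (2 * C)).+1.
have n_gt0 : 0 < n%:R :> R by rewrite ltr0n.
have Cn : 2 * C <= 2 ^+ n.
  apply: (@le_trans _ _ n%:R); first exact: ltW (truncnS_gt _).
  by rewrite -natrX ler_nat ltnW// ltn_expl.
pose v x := w x `^ n%:R^-1.
have vn x : v x ^+ n = w x.
  by rewrite -powR_mulrn ?powR_ge0// -powRrM mulVf ?gt_eqF// powRr1// ltW.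
have v_ge0 x : 0 <= v x by exact: powR_ge0.
have v_cont : continuous v.
  rewrite (_ : v = fun x => expR (n%:R^-1 * ln (w x))); last first.
    by apply/funext => x; rewrite /v /powR gt_eqF.
  move=> x; apply: continuous_comp; last exact: continuous_expR.
  apply: cvgM; first exact: cvg_cst.
  by apply: continuous_comp; [exact: w_cont|exact: continuous_ln].
have v_sym x : v x^-1%g = v x by rewrite /v w_sym.
have v_quasi x y : v (x * y)%g <= 2 * Num.max (v x) (v y).
  have m0 : 0 <= Num.max (v x) (v y) by rewrite le_max v_ge0.
  rewrite -(@ler_pXn2r _ n) ?nnegrE ?mulr_ge0// vn exprMn.
  apply: (le_trans (wC _ _)); apply: (@le_trans _ _ (2 * C * Num.max (v x) (v y) ^+ n)).
    rewrite -[2 * C * _]mulrA mulrCA ler_pM2l// mulr2n mulrDl mul1r -{1}(vn x) -(vn y).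
    by apply: lerD; rewrite lerXn2r ?nnegrE ?v_ge0// le_max lexx ?orbT.
  by rewrite ler_wpM2r// exprn_ge0.
exists (2^-1 ^+ n); first by rewrite exprn_gt0.
move=> T; have b0 : 0 <= T `^ n%:R^-1 by exact: powR_ge0.
have [h [mh h_v h_up h_lo]] := slow_quasinorm v_cont v_ge0 v_sym v_quasi b0.
set d := 2 * _ in h_up h_lo.
have d0 : 0 <= d by rewrite mulr_ge0.
have h0 x : 0 <= h x by have /andP[+ _] := h_v x; apply: le_trans; rewrite divr_ge0.
exists (fun x => h x ^+ n); split.
- by apply: measurable_funX.
- move=> x; have /andP[lo hi] := h_v x; rewrite -vn -exprMn.
  by rewrite !lerXn2r ?nnegrE ?mulr_ge0// mulrC.
(* [expr_shift] bounds each of X = h(x)^n and Y = h(y x)^n by (1 + e1) times the other plus [D].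
   Then X - Y <= e1 Y + D <= e1 (1 + e1) X + (1 + e1) D, which e1 <= 1/3 and 3 e1 <= e bring below e
   X + 2 D. *)
move=> e e0; pose e1 := Num.min e 1 / 3.
have e1_gt0 : 0 < e1 by rewrite divr_gt0// lt_min e0 ltr01.
have [D D0 hD] := expr_shift n d0 e1_gt0.
exists (2 * D); first by rewrite mulr_ge0.
move=> y x wy; have vy : v y <= T `^ n%:R^-1.
  by apply: ge0_ler_powR; rewrite ?nnegrE ?invr_ge0 ?(ltW n_gt0) ?(ltW (w_gt0 y))// (le_trans _ wy)// ltW.
have up : h (y * x)%g ^+ n <= (1 + e1) * h x ^+ n + D.
  by apply: le_trans (hD _ (h0 x)); rewrite lerXn2r ?nnegrE ?addr_ge0// h_up.
have lo : h x ^+ n <= (1 + e1) * h (y * x)%g ^+ n + D.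
  by apply: le_trans (hD _ (h0 _)); rewrite lerXn2r ?nnegrE ?addr_ge0// h_lo.
have e1e : e1 * 3 <= e by rewrite /e1 divfK// ge_min lexx.
have e11 : e1 * 3 <= 1 by rewrite /e1 divfK// ge_min lexx orbT.
have X0 : 0 <= h x ^+ n by rewrite exprn_ge0.
have Y0 : 0 <= h (y * x)%g ^+ n by rewrite exprn_ge0.
move: up lo X0 Y0; move: (h x ^+ n) (h (y * x)%g ^+ n) => X Y up lo X0 Y0.
rewrite ler_norml; apply/andP; split; nra.
Qed.

(** * Weighted and unweighted norms of convolution operators *)

Section Tails.
Variables (R : realType) (G : topologicalGroupType).
Variable mu : {measure set (borel G) -> \bar R}.
Local Open Scope ereal_scope.

Lemma Lpw_norm_tail (r : R) (v u : G -> R) (f : G -> R[i]) (e : R) : (0 < r)%R -> weight v ->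
  measurable_fun [set: borel G] (u : borel G -> R) -> Lpw mu r v f -> (0 < e)%R ->
  exists k : nat, Lpw_norm mu r v (cutoff [set x | (k%:R < u x)%R] f) <= e%:E.
Proof.
move=> r0 wv mu_ [mf fy] e0.
pose phi x : \bar R := (nc (f x) `^ r * v x `^ r)%:E.
have mphi : measurable_fun [set: borel G] (phi : borel G -> \bar R) by exact: measurable_Lpw_integrand.
have phi0 x : 0 <= phi x by rewrite lee_fin mulr_ge0// powR_ge0.
have I_fin : \int[mu]_x phi x \is a fin_num.
  by rewrite ge0_fin_numE ?integral_ge0//; apply/(Lpw_norm_ltyP mu r0).
pose S n : set (borel G) := [set x : borel G | (u x <= n%:R)%R].
have mS n : measurable (S n).
  rewrite (_ : S n = setT `&` u @^-1` `]-oo, n%:R]).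
    by apply: mu_ => //; exact: measurable_itv.
  by rewrite setTI; apply/seteqP; split => x /=; rewrite in_itv.
have S_homo : {homo S : n m / (n <= m)%N >-> (n <= m)%O}.
  by move=> n m nm; apply/subsetPset => x /= /le_trans; apply; rewrite ler_nat.
have ST : \bigcup_n S n = setT.
  apply/seteqP; split => // x _; exists (Num.truncn (u x)).+1 => //=.
  by rewrite /S /=; apply: ltW; exact: truncnS_gt.
have cv := ge0_nondecreasing_set_cvg_integral (mu := mu) S_homo mS
  (fun n => measurable_funTS mphi) (fun n x _ => phi0 x).
rewrite ST in cv.
have nd : {homo (fun n => \int[mu]_(x in S n) phi x) : n m / (n <= m)%N >-> n <= m}.
  move=> n m nm; apply: ge0_subset_integral => //; first exact: measurable_funTS.
  by apply/subsetPset; exact: S_homo.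
have IE := cvg_unique (@ereal_hausdorff R) cv (ereal_nondecreasing_cvgn nd).
have er : (0 < e `^ r)%R by exact: powR_gt0.
have sup_fin : ereal_sup (range (fun n => \int[mu]_(x in S n) phi x)) \is a fin_num by rewrite -IE.
have [_ [k _ <-]] := ub_ereal_sup_adherent er sup_fin.
rewrite -IE => kI; exists k.
have split_I : \int[mu]_x phi x = \int[mu]_(x in S k) phi x + \int[mu]_(x in ~` S k) phi x.
  rewrite -ge0_integral_setU//; first by rewrite setUv.
  - exact: measurableC.
  - by rewrite setUv.
  - exact/disj_set2P/setICr.
have -> : Lpw_norm mu r v (cutoff [set x | (k%:R < u x)%R] f) =
    (\int[mu]_(x in ~` S k) phi x) `^ r^-1.
  apply: (congr1 (fun t => t `^ r^-1)); rewrite [RHS]integral_mkcond.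
  apply: eq_integral => x _; rewrite normc_cutoff patchE.
  have -> : (x \in ~` S k) = (x \in [set x | (k%:R < u x)%R]).
    by apply/idP/idP; rewrite !inE /S /= ltNge => /negP.
  rewrite indicE; case: (x \in _); first by rewrite mul1r.
  by rewrite mul0r powR0 ?gt_eqF// mul0r.
have Sk_fin : \int[mu]_(x in S k) phi x \is a fin_num.
  rewrite ge0_fin_numE ?integral_ge0//; apply: le_lt_trans (_ : \int[mu]_x phi x < _).
    by apply: ge0_subset_integral.
  by rewrite -ge0_fin_numE// integral_ge0.
rewrite -[leRHS](@poweRK _ r) ?gt_eqF//; last by rewrite lee_fin ltW.
apply: le_poweR; [by rewrite invr_ge0 ltW|exact: integral_ge0|].
rewrite poweR_EFin; apply: ltW.
by move: kI; rewrite split_I lteBlDr// lteD2lE.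
Qed.

End Tails.

Section L1Action.
Variables (R : realType) (G : topologicalGroupType).
Variable mu : {measure set (borel G) -> \bar R}.
Hypothesis H : unimodular_haar mu.
Variable p : R.
Hypothesis p_gt1 : 1 < p.
Local Open Scope ereal_scope.
Local Notation L1 f := (Lpw_norm mu 1 (cst 1%R) f).
Local Notation Lp f := (Lpw_norm mu p (cst 1%R) f).

Let p_gt0 : (0 < p)%R. Proof. exact: lt_trans p_gt1. Qed.

Lemma aconv_L1_lty (f g : G -> R[i]) : Cmeasurable f -> Cmeasurable g ->
  L1 f < +oo -> Lp g < +oo ->
  \forall x \ae mu, aconv mu (fun y => nc (f y)) (fun y => nc (g y)) x < +oo.
Proof.
move=> mf mg fy gy.
(* Adding 1 keeps the weight m^(-1/q) positive when f is null. *)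
pose m : R := (fine (L1 f) + 1)%R.
have m0 : (0 < m)%R by rewrite ltr_wpDl// fine_ge0// Lpw_norm_ge0.
have fm : L1 f <= m%:E.
  by rewrite -[L1 f]fineK ?ge0_fin_numE ?Lpw_norm_ge0// lee_fin lerDl.
pose q : R := ((1 - p^-1)^-1)%R.
have q0 : (0 < q)%R by rewrite invr_gt0 subr_gt0 invf_lt1.
have pq : (p^-1 + q^-1 = 1)%R by rewrite invrK addrC subrK.
have mnf := measurable_normc mf; have mng := measurable_normc mg.
have := @aconv_lt_pinfty_ae _ _ _ H p q p_gt1 q0 pq (fun x => nc (f x) `^ p^-1)%R
  (fun x => nc (g x)) (fun x => nc (f x) `^ q^-1)%R (cst 1%R) (cst (m `^ - q^-1)%R).
move=> /(_ (measurable_powR_comp _ mnf) mng (measurable_powR_comp _ mnf) (measurable_cst _)).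
move=> /(_ (fun=> powR_ge0 _ _) (fun=> normc_ge0 _) (fun=> powR_ge0 _ _) (fun=> ler01)).
move=> /(_ (fun=> powR_gt0 _ m0)).
have abv x : aconv mu (fun y => (nc (f y) `^ q^-1) `^ q)%R (fun=> 1 `^ q)%R x <=
    ((m `^ - q^-1) `^ (- q))%:E.
  rewrite -powRrM mulrNN mulVf ?gt_eqF// powRr1 ?(ltW m0)//; apply: le_trans fm.
  rewrite L1_norm /aconv.
  rewrite le_eqVlt; apply/orP; left; apply/eqP; apply: eq_integral => y _.
  by rewrite powR1 mulr1 -powRrM mulVf ?gt_eqF// powRr1// normc_ge0.
move=> /(_ abv).
have -> : \int[mu]_x ((nc (f x) `^ p^-1) `^ p)%:E = L1 f.
  rewrite L1_norm; apply: eq_integral => y _.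
  by rewrite -powRrM mulVf ?gt_eqF// powRr1// normc_ge0.
rewrite -(Lp_normX mu g p_gt0) => /(_ fy (poweR_lty _ gy)); apply: aeS => x.
rewrite /aconv (_ : \int[mu]_y _ = \int[mu]_y (nc (f y) * nc (g (y^-1 * x)%g))%:E)//.
apply: eq_integral => y _; rewrite mulr1 -powRD ?pq ?powRr1 ?normc_ge0//.
by rewrite oner_eq0.
Qed.

(** The element z 1 + f of the unitization, acting by left convolution. *)
Definition act (z : R[i]) (f g : G -> R[i]) : G -> R[i] :=
  fun x => (z * g x + convolution mu f g x)%R.

Lemma Cmeasurable_act z f g : Cmeasurable f -> Cmeasurable g -> Cmeasurable (act z f g).
Proof.
by move=> mf mg; apply: CmeasurableD; [exact: CmeasurableZ|exact: Cmeasurable_convolution].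
Qed.

Lemma act_norm z f g : Cmeasurable f -> Cmeasurable g -> L1 f < +oo ->
  Lp (act z f g) <= ((nc z)%:E + L1 f) * Lp g.
Proof.
move=> mf mg fy; have w1 : weight (cst 1%R : G -> R) by exact: weight1.
have mfg := Cmeasurable_convolution H mf mg.
have h := Lpw_normD mu p_gt0 (ltW p_gt1) (CmeasurableZ z mg) mfg w1.
apply: (le_trans h); rewrite ge0_muleDl ?Lpw_norm_ge0 ?lee_fin ?normc_ge0//.
by rewrite Lpw_normZ//; apply: leeD => //; exact: young_L1.
Qed.

Lemma actD_ae z f g g' : Cmeasurable f -> Cmeasurable g -> Cmeasurable g' ->
  L1 f < +oo -> Lp g < +oo -> Lp g' < +oo ->
  \forall x \ae mu, act z f (fun y => g y + g' y)%R x = (act z f g x + act z f g' x)%R.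
Proof.
move=> mf mg mg' fy gy gy'.
apply: aeS (aeI (aconv_L1_lty mf mg fy gy) (aconv_L1_lty mf mg' fy gy')) => x.
have int k : Cmeasurable k -> aconv mu (fun y => nc (f y)) (fun y => nc (k y)) x < +oo ->
    Cintegrable mu (fun y => f y * k (y^-1 * x)%g)%R.
  move=> mk; rewrite /aconv => ky; split.
    by apply: CmeasurableM mf _; exact: Cmeasurable_comp (measurable_quotient x) mk.
  by under eq_integral do rewrite Normc.normcM.
move=> [/(int _ mg) Ig /(int _ mg') Ig'].
rewrite /act addrACA -mulrDr; congr (_ + _)%R; rewrite /convolution -CintegralD//.
by apply: eq_Cintegral => y; rewrite mulrDr.
Qed.

End L1Action.

Section WeightedAct.
Variables (R : realType) (G : topologicalGroupType).
Variable mu : {measure set (borel G) -> \bar R}.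
Hypothesis H : unimodular_haar mu.
Variables (p q : R) (w : G -> R).
Hypotheses (p_gt1 : 1 < p) (pq : p^-1 + q^-1 = 1).
Hypotheses (wl : LPAlg mu q w) (w_cont : continuous w) (wp : polynomial_weight w).
Local Open Scope ereal_scope.
Local Notation L1 f := (Lpw_norm mu 1 (cst 1%R) f).
Local Notation Lp f := (Lpw_norm mu p (cst 1%R) f).
Local Notation N f := (Lpw_norm mu p w f).
Local Notation act := (act mu).

Let p_gt0 : (0 < p)%R. Proof. exact: lt_trans p_gt1. Qed.
Let ww : weight w := lpalg_weight wl.
Let w1 : weight (cst 1%R : G -> R) := weight1 R G.

Lemma Lpw_L1_lty f : Lpw mu p w f -> L1 f < +oo.
Proof.
move=> [mf fy]; have [C C0 wC] := wp; have [c c0 h] := L1_norm_le p_gt1 pq wl C0 wC.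
by apply: (le_lt_trans (h f mf)); apply: lte_mul_pinfty => //; rewrite lee_fin ltW.
Qed.

Lemma Lpw_Lp_le f : Cmeasurable f -> Lp f <= N f.
Proof.
move=> mf; apply: Lpw_norm_le => // x.
by rewrite ler_wpM2l ?normc_ge0//; exact: lpalg_ge1 wl x.
Qed.

Lemma Lpw_Lp_lty f : Lpw mu p w f -> Lp f < +oo.
Proof. by move=> [mf fy]; apply: le_lt_trans fy; exact: Lpw_Lp_le. Qed.

Let D k : set G := [set x | (k%:R < w x)%R].

Let mw : measurable_fun [set: borel G] (w : borel G -> R).
Proof. exact: lpalg_measurable wl. Qed.

Let mD k : measurable (D k : set (borel G)).
Proof.
rewrite (_ : D k = setT `&` (w : borel G -> R) @^-1` `]k%:R, +oo[).
  by apply: mw => //; exact: measurable_itv.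
by rewrite setTI; apply/seteqP; split => x /=; rewrite in_itv/= andbT.
Qed.

Let cutoff_split k (h : G -> R[i]) : h = (fun x => cutoff (~` D k) h x + cutoff (D k) h x)%R.
Proof.
apply/funext => x; rewrite /cutoff -mulrDl !indicE in_setC.
by case: (x \in D k); rewrite /= ?(add0r, addr0) mul1r.
Qed.

(** An argument of density: the truncations of h to {w <= k} obey the bound [K], and the remainder,
    small in L^p(G), is controlled by Young's inequality. *)
Lemma act_bound_extend (z : R[i]) (f h : G -> R[i]) (K : R) : (0 <= K)%R ->
  Cmeasurable f -> L1 f < +oo ->
  (forall g, Lpw mu p w g -> Lp (act z f g) <= K%:E * Lp g) ->
  Cmeasurable h -> Lp h < +oo ->
  (forall k, Lpw mu p w (cutoff (~` D k) h)) -> Lp (act z f h) <= K%:E * Lp h.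
Proof.
move=> K0 mf fy fK mh hy hk.
have L1_fin : L1 f \is a fin_num by rewrite ge0_fin_numE ?Lpw_norm_ge0.
pose t : R := (nc z + fine (L1 f) + 1)%R.
have t0 : (0 < t)%R by rewrite ltr_wpDl// addr_ge0 ?normc_ge0// fine_ge0// Lpw_norm_ge0.
have le_h E : measurable (E : set (borel G)) -> Lp (cutoff E h) <= Lp h.
  move=> mE; apply: Lpw_norm_le => //; first exact: Cmeasurable_cutoff.
  move=> x; rewrite normc_cutoff !mulr1.
  by rewrite ler_piMl ?normc_ge0// indicE; case: (_ \in _).
apply/lee_addgt0Pr => e e0.
have [k hke] := Lpw_norm_tail p_gt0 w1 mw (conj mh hy) (divr_gt0 e0 t0).
have mDC : measurable (~` D k : set (borel G)) by exact: measurableC.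
have mh1 := Cmeasurable_cutoff mDC mh; have mh2 := Cmeasurable_cutoff (mD k) mh.
have ae := actD_ae H p_gt1 z mf mh1 mh2 fy (le_lt_trans (le_h _ mDC) hy)
  (le_lt_trans (le_h _ (mD k)) hy).
rewrite -cutoff_split in ae.
have ma1 := Cmeasurable_act H z mf mh1; have ma2 := Cmeasurable_act H z mf mh2.
rewrite (Lpw_norm_ae_eq p_gt0 (Cmeasurable_act H z mf mh) (CmeasurableD ma1 ma2) w1 ae).
apply: (le_trans (Lpw_normD mu p_gt0 (ltW p_gt1) ma1 ma2 w1)).
apply: leeD.
  apply: (le_trans (fK _ (hk k))); apply: lee_wpmul2l; first by rewrite lee_fin.
  exact: le_h.
apply: (le_trans (act_norm H p_gt1 z mf mh2 fy)).
apply: (@le_trans _ _ (t%:E * (e / t)%:E)).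
  apply: lee_pmul => //; last 1 first.
  - by rewrite -[L1 f]fineK// -EFinD lee_fin /t lerDl.
  - by apply: adde_ge0; [rewrite lee_fin normc_ge0|exact: Lpw_norm_ge0].
  - exact: Lpw_norm_ge0.
by rewrite -EFinM mulrC divfK// gt_eqF.
Qed.

Lemma Lpw_norm_abs (r : R) v (f : G -> R[i]) :
  Lpw_norm mu r v (fun x => (nc (f x))%:C) = Lpw_norm mu r v f.
Proof.
apply: (congr1 (fun t => t `^ r^-1)); apply: eq_integral => x _.
by rewrite normc_real ger0_norm// normc_ge0.
Qed.

Lemma Lpw_norm_weightM v (f : G -> R[i]) : weight v ->
  Lpw_norm mu p v f = Lp (fun x => (v x)%:C * f x)%R.
Proof.
move=> [_ v0]; apply: (congr1 (fun t => t `^ p^-1)); apply: eq_integral => x _.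
by rewrite Normc.normcM normc_real ger0_norm// powRM ?normc_ge0// powR1 mulr1 mulrC.
Qed.

Section Commutator.
Variables (f g : G -> R[i]) (z : R[i]) (k : nat) (w' : G -> R) (e d : R).
Hypotheses (Lf : Lpw mu p w f) (Lg : Lpw mu p w g).
Hypotheses (mw' : measurable_fun [set: borel G] (w' : borel G -> R)).
Hypotheses (w'_ge0 : forall x, (0 <= w' x)%R) (w'_le : forall x, (w' x <= w x)%R).
Hypotheses (e0 : (0 <= e)%R) (d0 : (0 <= d)%R).
Hypothesis slow : forall y x, (w y <= k%:R)%R -> (`|w' (y * x)%g - w' x| <= e * w' x + d)%R.

Let r := cutoff (D k) f.
Let gw (x : G) : R[i] := ((w' x)%:C * g x)%R.
Let g1 x : R := (e * nc (gw x) + d * nc (g x))%R.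

Let mf : Cmeasurable f. Proof. by case: Lf. Qed.
Let mg : Cmeasurable g. Proof. by case: Lg. Qed.
Let mr : Cmeasurable r. Proof. exact: Cmeasurable_cutoff. Qed.
Let mgw : Cmeasurable gw. Proof. by apply: CmeasurableM => //; exact: Cmeasurable_real. Qed.
Let mg1 : measurable_fun [set: borel G] (g1 : borel G -> R).
Proof.
apply: measurable_funD; apply: measurable_funM => //; exact: measurable_normc.
Qed.
Let g1_ge0 x : (0 <= g1 x)%R.
Proof. by rewrite addr_ge0// mulr_ge0// normc_ge0. Qed.

Let gw_norm x : nc (gw x) = (w' x * nc (g x))%R.
Proof. by rewrite Normc.normcM normc_real ger0_norm. Qed.

Let P1 := convolution mu (fun x => (nc (f x))%:C) (fun x => (g1 x)%:C).
Let P2 := convolution mu (fun x => (nc (r x))%:C) (fun x => (nc (g x))%:C).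
Let P3 := convolution mu (fun x => (nc (r x))%:C) (fun x => (nc (gw x))%:C).

Let gw_lty : Lp gw < +oo.
Proof.
case: Lg => _; apply: le_lt_trans; apply: Lpw_norm_le => // x.
by rewrite gw_norm mulr1 mulrC ler_wpM2l ?normc_ge0.
Qed.

Let g1_lty : Lp (fun x => (g1 x)%:C) <= e%:E * Lp gw + d%:E * Lp g.
Proof.
have -> : (fun x => (g1 x)%:C) = (fun x => e%:C * (nc (gw x))%:C + d%:C * (nc (g x))%:C)%R.
  by apply/funext => x; rewrite /g1 rmorphD !rmorphM.
have ma : Cmeasurable (fun x => (nc (gw x))%:C) by exact: Cmeasurable_real (measurable_normc mgw).
have mb : Cmeasurable (fun x => (nc (g x))%:C) by exact: Cmeasurable_real (measurable_normc mg).
apply: (le_trans (Lpw_normD mu p_gt0 (ltW p_gt1) (CmeasurableZ _ ma) (CmeasurableZ _ mb) w1)).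
rewrite (Lpw_normZ mu p_gt0 _ ma w1) (Lpw_normZ mu p_gt0 _ mb w1) !normc_real.
by rewrite (ger0_norm e0) (ger0_norm d0) (Lpw_norm_abs p (cst 1%R) gw) (Lpw_norm_abs p (cst 1%R) g).
Qed.

(** The left-hand side is the kernel of the commutator of multiplication by w' with convolution by
    f. Where w y <= k, slow variation gives the first term; on the tail [r] of f the difference of
    weights is bounded by the sum of its two terms, giving the other two. *)
Let pointwise x y : (nc (f y) * `|w' x - w' (y^-1 * x)%g| * nc (g (y^-1 * x)%g) <=
  nc (f y) * g1 (y^-1 * x)%g + w' x * (nc (r y) * nc (g (y^-1 * x)%g)) +
  nc (r y) * nc (gw (y^-1 * x)%g))%R.
Proof.
set x0 := (y^-1 * x)%g; have -> : x = (y * x0)%g by rewrite /x0 mulVKg.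
have n0 := normc_ge0; have [wy|wy] := leP (w y) k%:R.
  have -> : nc (r y) = 0%R.
    by rewrite /r normc_cutoff indicE memNset ?mul0r// /D /= ltNge wy.
  rewrite !(mul0r, mulr0) !addr0 -mulrA ler_wpM2l//.
  apply: (le_trans (ler_wpM2r (n0 _ _) (slow x0 wy))).
  by rewrite /g1 gw_norm mulrDl mulrA.
have -> : nc (r y) = nc (f y) by rewrite /r normc_cutoff indicE mem_set ?mul1r.
rewrite -addrA ler_wpDl ?mulr_ge0// mulrCA -mulrDr -mulrA ler_wpM2l//.
by rewrite gw_norm -mulrDl ler_wpM2r// (le_trans (ler_normB _ _))// !ger0_norm.
Qed.

Let commutator_ae : \forall x \ae mu, (nc ((w' x)%:C * act z f g x) <=
  nc (act z f gw x) + (nc (P1 x) + w' x * nc (P2 x) + nc (P3 x)))%R.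
Proof.
have fy := Lpw_L1_lty Lf; have gy := Lpw_Lp_lty Lg.
have ry : L1 r < +oo.
  apply: le_lt_trans fy; apply: Lpw_norm_le => // x; rewrite normc_cutoff !mulr1.
  by rewrite ler_piMl ?normc_ge0// indicE; case: (_ \in _).
have mg1c : Cmeasurable (fun x => (g1 x)%:C) by exact: Cmeasurable_real.
have g1y : Lp (fun x => (g1 x)%:C) < +oo.
  apply: (le_lt_trans g1_lty); apply: lte_add_pinfty.
    by apply: lte_mul_pinfty; [rewrite lee_fin| |exact: gw_lty].
  by apply: lte_mul_pinfty; [rewrite lee_fin| |exact: gy].
have fin (u v : G -> R[i]) : Cmeasurable u -> Cmeasurable v -> L1 u < +oo -> Lp v < +oo ->
    \forall x \ae mu, aconv mu (fun y => nc (u y)) (fun y => nc (v y)) x < +oo.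
  by move=> mu_ mv uy vy; exact: (aconv_L1_lty H p_gt1).
apply: aeS (aeI (aeI (fin _ _ mf mg fy gy) (fin _ _ mf mgw fy gw_lty))
  (aeI (fin _ _ mf mg1c fy g1y) (aeI (fin _ _ mr mg ry gy) (fin _ _ mr mgw ry gw_lty)))).
move=> x [[A1 A2] [A3 [A4 A5]]].
have q1 (v : G -> R[i]) : Cmeasurable v -> Cmeasurable (fun y => v (y^-1 * x)%g).
  by move=> mv; exact: Cmeasurable_comp (measurable_quotient x) mv.
pose B y := (f y * gw (y^-1 * x)%g)%R.
pose E y := (f y * (w' x - w' (y^-1 * x)%g)%:C * g (y^-1 * x)%g)%R.
have mB : Cmeasurable B by exact: (CmeasurableM mf (q1 gw mgw)).
have mE : Cmeasurable E.
  apply: CmeasurableM (q1 _ mg); apply: CmeasurableM mf _; apply: Cmeasurable_real.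
  apply: measurable_funB => //.
  exact: (measurableT_comp mw' (measurable_quotient x)).
have IB : Cintegrable mu B.
  split => //; rewrite /aconv in A2; apply: le_lt_trans A2.
  by rewrite le_eqVlt; apply/orP; left; apply/eqP; apply: eq_integral => y _; rewrite Normc.normcM.
have normE y : nc (E y) = (nc (f y) * `|w' x - w' (y^-1 * x)%g| * nc (g (y^-1 * x)%g))%R.
  by rewrite !Normc.normcM normc_real.
have g1E y : nc ((g1 y)%:C) = g1 y by rewrite normc_real ger0_norm.
rewrite /aconv in A3 A4 A5; have {}A3 : \int[mu]_y (nc (f y) * g1 (y^-1 * x)%g)%:E < +oo.
  by move: A3; under eq_integral do rewrite g1E.
have EI : \int[mu]_y (nc (E y))%:E <=
    aconv mu (fun y => nc (f y)) g1 x + (w' x)%:E * aconv mu (fun y => nc (r y)) (fun y => nc (g y)) x +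
    aconv mu (fun y => nc (r y)) (fun y => nc (gw y)) x.
  have m1 := measurable_aconv_integrand (measurable_normc mf) mg1 x.
  have m2 := measurable_aconv_integrand (measurable_normc mr) (measurable_normc mg) x.
  have m3 := measurable_aconv_integrand (measurable_normc mr) (measurable_normc mgw) x.
  have n0 := @normc_ge0 R.
  have m2' : measurable_fun [set: borel G]
      (fun y : borel G => (w' x * (nc (r y) * nc (g (y^-1 * x)%g)))%:E).
    by under eq_fun do rewrite EFinM; apply: emeasurable_funM.
  rewrite /aconv -(integralZ_EFin mu (w'_ge0 x) m2); last by move=> y; rewrite mulr_ge0.
  rewrite -ge0_integralD//; last 2 first.
  - by move=> y _; rewrite lee_fin mulr_ge0.
  - by move=> y _; rewrite lee_fin !mulr_ge0.
  rewrite -ge0_integralD//; last 3 first.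
  - by move=> y _; rewrite -EFinD lee_fin addr_ge0// !mulr_ge0.
  - exact: emeasurable_funD.
  - by move=> y _; rewrite lee_fin mulr_ge0.
  apply: ge0_le_integral => //.
  - by move=> y _; rewrite lee_fin.
  - exact: measurable_normc_EFin.
  - by apply: emeasurable_funD => //; exact: emeasurable_funD.
  - by move=> y _; rewrite -!EFinD lee_fin normE; exact: pointwise.
have finE (a b : G -> R) : (forall x, (0 <= a x)%R) -> (forall x, (0 <= b x)%R) ->
    \int[mu]_y (a y * b (y^-1 * x)%g)%:E < +oo ->
    aconv mu a b x = (nc (convolution mu (fun y => (a y)%:C) (fun y => (b y)%:C) x))%:E.
  move=> a0 b0 aby; have ab0 : 0 <= aconv mu a b x by exact: aconv_ge0.
  by rewrite convolution_real normc_real ger0_norm ?fine_ge0// fineK// ge0_fin_numE.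
have n0 (u : G -> R[i]) : forall x : G, (0 <= nc (u x))%R by move=> y; exact: normc_ge0.
rewrite (finE _ _ (n0 f) g1_ge0 A3) (finE _ _ (n0 r) (n0 g) A4) (finE _ _ (n0 r) (n0 gw) A5) in EI.
rewrite -/P1 -/P2 -/P3 -!EFinM -!EFinD in EI.
have IE : Cintegrable mu E by split => //; apply: (le_lt_trans EI); exact: ltry.
have key : ((w' x)%:C * act z f g x = act z f gw x + Cintegral mu E)%R.
  rewrite /act /convolution mulrDr -addrA -CintegralD//; congr (_ + _)%R.
    by rewrite /gw mulrCA.
  have ZI : \int[mu]_y (nc ((w' x)%:C * (f y * g (y^-1 * x)%g))%R)%:E < +oo.
    under eq_integral do rewrite Normc.normcM normc_real ger0_norm// Normc.normcM.
    rewrite (integralZ_EFin mu (w'_ge0 x)).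
    - by apply: lte_mul_pinfty => //; rewrite lee_fin.
    - exact: (measurable_aconv_integrand (measurable_normc mf) (measurable_normc mg) x).
    - by move=> y; rewrite mulr_ge0 ?normc_ge0.
  rewrite -CintegralZ//; last by apply: CmeasurableM mf (q1 _ mg).
  apply: eq_Cintegral => y; rewrite /B /E /gw rmorphB /=.
  by ring.
rewrite key (le_trans (le_normcD _ _))// lerD2l -lee_fin.
exact: le_trans (normc_Cintegral mu mE) EI.
Qed.

(** Young's inequality bounds [P1] and [P3] in L^p(G). In [P2] the weight remains outside the
    convolution, so w' <= w and the submultiplicativity of the norm of L^p(G, w) are used
    instead. *)
Lemma commutator_estimate : Lpw_norm mu p w' (act z f g) <=
  Lp (act z f gw) + (L1 f * (e%:E * Lp gw + d%:E * Lp g) + N r * N g + L1 r * Lp gw).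
Proof.
have ww' : weight w' by [].
have cx (u : G -> R[i]) : Cmeasurable u -> Cmeasurable (fun x => (nc (u x))%:C).
  by move=> mu_; exact: Cmeasurable_real (measurable_normc mu_).
have mg1c : Cmeasurable (fun x => (g1 x)%:C) by exact: Cmeasurable_real.
have mP1 : Cmeasurable P1 := Cmeasurable_convolution H (cx _ mf) mg1c.
have mP2 : Cmeasurable P2 := Cmeasurable_convolution H (cx _ mr) (cx _ mg).
have mP3 : Cmeasurable P3 := Cmeasurable_convolution H (cx _ mr) (cx _ mgw).
have ma := Cmeasurable_act H z mf mg; have maw := Cmeasurable_act H z mf mgw.
have mw'c : Cmeasurable (fun x => (w' x)%:C) by exact: Cmeasurable_real.
rewrite (Lpw_norm_weightM _ ww').
pose S x := ((nc (act z f gw x))%:C +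
  ((nc (P1 x))%:C + (w' x)%:C * (nc (P2 x))%:C + (nc (P3 x))%:C))%R.
have m12 := CmeasurableD (cx _ mP1) (CmeasurableM mw'c (cx _ mP2)).
have m123 := CmeasurableD m12 (cx _ mP3).
have mS : Cmeasurable S := CmeasurableD (cx _ maw) m123.
have p1 := ltW p_gt1.
apply: (@le_trans _ _ (Lp S)).
  apply: (Lpw_norm_ae_le p_gt0 (CmeasurableM mw'c ma) mS w1 w1).
  apply: aeS commutator_ae => x h; rewrite !mulr1 /S -rmorphM -!rmorphD normc_real.
  by rewrite ger0_norm// !addr_ge0 ?mulr_ge0 ?normc_ge0.
apply: (le_trans (Lpw_normD mu p_gt0 p1 (cx _ maw) m123 w1)).
rewrite Lpw_norm_abs; apply: leeD; first exact: lexx.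
apply: (le_trans (Lpw_normD mu p_gt0 p1 m12 (cx _ mP3) w1)); apply: leeD; last first.
  rewrite Lpw_norm_abs; have := young_L1 H p_gt1 (cx _ mr) (cx _ mgw).
  rewrite Lpw_norm_abs Lpw_norm_abs; apply.
  apply: le_lt_trans (Lpw_L1_lty Lf); apply: Lpw_norm_le => // x; rewrite normc_cutoff !mulr1.
  by rewrite ler_piMl ?normc_ge0// indicE; case: (_ \in _).
apply: (le_trans (Lpw_normD mu p_gt0 p1 (cx _ mP1) (CmeasurableM mw'c (cx _ mP2)) w1)).
apply: leeD.
  rewrite Lpw_norm_abs; have := young_L1 H p_gt1 (cx _ mf) mg1c.
  rewrite Lpw_norm_abs => /(_ (Lpw_L1_lty Lf)) /le_trans; apply.
  by apply: lee_wpmul2l g1_lty; exact: Lpw_norm_ge0.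
rewrite -(Lpw_norm_weightM _ ww') Lpw_norm_abs.
apply: (@le_trans _ _ (N P2)).
  by apply: Lpw_norm_le => // x; rewrite ler_wpM2l ?normc_ge0.
have := Lpw_norm_convolution H p_gt1 pq wl (cx _ mr) (cx _ mg).
by rewrite !Lpw_norm_abs.
Qed.

End Commutator.

Lemma Lpw_norm_fin (r : R) v (f : G -> R[i]) : Lpw_norm mu r v f < +oo ->
  Lpw_norm mu r v f \is a fin_num.
Proof. by move=> fy; rewrite (ge0_fin_numE (Lpw_norm_ge0 _ _ _ _)). Qed.

Local Opaque Lpw_norm.

(* f is cut at a level of w: translating by the bounded part moves the slowly
   varying weight w' little, and the tail is small in L^1 and in L^p(G, w). *)
Lemma weighted_act (f : G -> R[i]) (z : R[i]) (K e : R) : Lpw mu p w f -> (0 <= K)%R ->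
  (forall g, Lpw mu p w g -> Lp (act z f g) <= K%:E * Lp g) -> (0 < e)%R ->
  exists w' (c d : R), [/\ weight w', (0 < c)%R, forall x, (c * w x <= w' x <= w x)%R, (0 <= d)%R &
    forall g, Lpw mu p w g ->
      Lpw_norm mu p w' (act z f g) <= (K + e)%:E * Lpw_norm mu p w' g + d%:E * Lp g].
Proof.
move=> Lf K0 fK e0; have [mf fy] := Lf.
have [C C0 wC] := wp; have [c1 c1_gt0 L1_le] := L1_norm_le p_gt1 pq wl C0 wC.
have [c c0 slow] := slow_weight w_cont (lpalg_ge1 wl) (lpalg_sym wl) wp.
have L1y := Lpw_L1_lty Lf.
have L1_fin := Lpw_norm_fin L1y.
pose F1 := fine (L1 f); have F1E : L1 f = F1%:E by rewrite fineK.
have F1_ge0 : (0 <= F1)%R by rewrite fine_ge0// Lpw_norm_ge0.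
(* The tail r enters through N r * N g, with N g at most 1/c times the w'-norm of g, and through L1
   r <= c1 * N r. This choice makes the two contributions sum to e / 2. *)
pose dl := (e / 2 / (c^-1 + c1))%R.
have s0 : (0 < c^-1 + c1)%R by rewrite addr_gt0// invr_gt0.
have dl0 : (0 < dl)%R by rewrite !divr_gt0.
have [k Nr] := Lpw_norm_tail p_gt0 ww mw Lf dl0.
have [w' [mw' w'w slow']] := slow k%:R.
(* The slow variation costs F1 * e1 <= e / 2, the other half of e. *)
pose e1 := (e / 2 / (F1 + 1))%R.
have F10 : (0 < F1 + 1)%R by rewrite ltr_wpDl.
have e1_gt0 : (0 < e1)%R by rewrite !divr_gt0.
have [d d0 slow_d] := slow' e1 e1_gt0.
have w'_ge0 x : (0 <= w' x)%R.
  by have /andP[+ _] := w'w x; apply: le_trans; rewrite mulr_ge0 ?(ltW c0)// ltW// (lpalg_gt0 wl).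
have w'_le x : (w' x <= w x)%R by have /andP[] := w'w x.
have ww' : weight w' by [].
exists w', c, (F1 * d)%R; split => //; first by rewrite mulr_ge0.
move=> g Lg; have [mg gy] := Lg.
have Ng_fin : Lpw_norm mu p w' g \is a fin_num.
  apply: Lpw_norm_fin; apply: le_lt_trans gy.
  apply: (Lpw_norm_le mu p_gt0 mg mg ww' ww) => x.
  by apply: ler_wpM2l; [exact: normc_ge0|exact: w'_le].
have Lg_fin := Lpw_norm_fin (Lpw_Lp_lty Lg).
have := commutator_estimate z Lf Lg mw' w'_ge0 w'_le (ltW e1_gt0) d0 slow_d.
set gw := fun x => ((w' x)%:C * g x)%R.
have mgw : Cmeasurable gw by apply: CmeasurableM => //; exact: Cmeasurable_real.
have gwE : Lp gw = Lpw_norm mu p w' g by rewrite (Lpw_norm_weightM _ ww').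
rewrite gwE F1E; set r := cutoff _ f; move=> /le_trans; apply.
have mr : Cmeasurable r by exact: Cmeasurable_cutoff.
(* The hypothesis on [K] concerns elements of L^p(G, w), while w' g is only known to be in L^p(G).
   Its truncation to {w <= n} is bounded by n |g|, which allows the extension by density. *)
have actw : Lp (act z f gw) <= K%:E * Lpw_norm mu p w' g.
  have gwy : Lp gw < +oo by rewrite gwE; move: Ng_fin; rewrite (ge0_fin_numE (Lpw_norm_ge0 _ _ _ _)).
  rewrite -gwE; apply: (act_bound_extend K0 mf L1y fK mgw gwy) => n.
  apply: (le_Lpw p_gt0 _ ww ww (LpwZ p_gt0 n%:R%:C ww Lg)).
    by apply: Cmeasurable_cutoff mgw; exact: measurableC.
  move=> x; rewrite normc_cutoff indicE in_setC.
  case: (boolP (x \in D n)) => [_|]; first by rewrite !mul0r mulr_ge0 ?normc_ge0// ltW// (lpalg_gt0 wl).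
  rewrite notin_setE /D /= => /negP; rewrite -leNgt => wn.
  rewrite mul1r /gw !Normc.normcM !normc_real (ger0_norm (w'_ge0 x)) (ger0_norm (ler0n _ _)).
  apply: ler_wpM2r; first exact: ltW (lpalg_gt0 wl x).
  apply: ler_wpM2r; first exact: normc_ge0.
  exact: le_trans (w'_le x) wn.
have Ng : N g <= (c^-1)%:E * Lpw_norm mu p w' g.
  have c'0 : (0 <= c^-1)%R by rewrite invr_ge0 ltW.
  rewrite -(ger0_norm c'0) -normc_real.
  rewrite -(Lpw_normZ mu p_gt0 (c^-1)%:C mg ww').
  apply: (Lpw_norm_le mu p_gt0 mg (CmeasurableZ _ mg) ww ww') => x.
  rewrite Normc.normcM normc_real (ger0_norm c'0).
  rewrite -mulrA mulrCA; apply: ler_wpM2l; first exact: normc_ge0.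
  rewrite ler_pdivlMl//.
  by have /andP[] := w'w x.
have rL1 : L1 r <= (c1 * dl)%:E.
  apply: (le_trans (L1_le _ mr)); rewrite EFinM; apply: lee_wpmul2l => //.
  by rewrite lee_fin ltW.
move: Ng actw; rewrite -(fineK Ng_fin) -(fineK Lg_fin); set a := fine (Lpw_norm mu p w' g).
set b := fine (Lp g) => Ng actw.
have a0 : (0 <= a)%R by rewrite fine_ge0// Lpw_norm_ge0.
have NN : N r * N g <= (dl * (c^-1 * a))%:E.
  by rewrite EFinM; apply: lee_pmul Nr Ng; exact: Lpw_norm_ge0.
have ra : L1 r * a%:E <= (c1 * dl * a)%:E by rewrite EFinM; apply: lee_wpmul2r; rewrite ?lee_fin.
apply: (le_trans (leeD actw (leeD (leeD (lexx _) NN) ra))).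
have -> : K%:E * a%:E + (F1%:E * (e1%:E * a%:E + d%:E * b%:E) + (dl * (c^-1 * a))%:E +
    (c1 * dl * a)%:E) =
    (K * a + (F1 * (e1 * a + d * b) + dl * (c^-1 * a) + c1 * dl * a))%:E by [].
have -> : (K + e)%:E * a%:E + (F1 * d)%:E * b%:E = ((K + e) * a + F1 * d * b)%:E by [].
rewrite lee_fin.
have de : (dl * (c^-1 + c1) = e / 2)%R by rewrite /dl divfK// gt_eqF.
have e1e : (F1 * e1 <= e / 2)%R.
  by rewrite /e1 mulrA ler_pdivrMr// mulrC ler_wpM2l ?lerDl// ltW// divr_gt0.
have h1 := ler_wpM2r a0 e1e.
have h2 : (dl * (c^-1 * a) + c1 * dl * a = e / 2 * a)%R by rewrite -de; ring.
have -> : (K * a + (F1 * (e1 * a + d * b) + dl * (c^-1 * a) + c1 * dl * a) =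
  K * a + F1 * e1 * a + F1 * d * b + (dl * (c^-1 * a) + c1 * dl * a))%R by ring.
rewrite h2; have -> : ((K + e) * a + F1 * d * b = K * a + e / 2 * a + F1 * d * b + e / 2 * a)%R by field.
by rewrite !lerD2r lerD2l.
Qed.

End WeightedAct.

(** * Contraction in L^2 *)

Section InnerProduct.
Variables (R : realType) (G : topologicalGroupType).
Variable mu : {measure set (borel G) -> \bar R}.
Local Notation L2 f := (Lpw_norm mu 2 (cst 1%R) f).
Implicit Types f g h : G -> R[i].

Definition inner f g : R[i] := Cintegral mu (fun x => f x * (g x)^*%C).

Definition L2fun f := Cmeasurable f /\ (L2 f < +oo)%E.

Let two_gt0 : 0 < 2 :> R. Proof. exact: ltr0n. Qed.
Let w1 : weight (cst 1 : G -> R) := weight1 R G.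

Lemma L2funD f g : L2fun f -> L2fun g -> L2fun (fun x => f x + g x).
Proof. by apply: LpwD => //; exact: ler1n. Qed.

Lemma L2funZ (z : R[i]) f : L2fun f -> L2fun (fun x => z * f x).
Proof. exact: LpwZ. Qed.

Lemma inner_integrable f g : L2fun f -> L2fun g -> Cintegrable mu (fun x => f x * (g x)^*%C).
Proof.
move=> [mf fy] [mg gy]; split; first by apply: CmeasurableM mf _; exact: Cmeasurable_conj.
have h2 : 2^-1 + 2^-1 = 1 :> R by field.
have := hoelder_nonneg mu (ltr1n R 2) two_gt0 h2 (measurable_normc mf)
  (measurable_normc mg) (fun=> normc_ge0 _) (fun=> normc_ge0 _).
have N2 k : ((\int[mu]_x (nc (k x) `^ 2)%:E) `^ 2^-1 = Lpw_norm mu 2 (cst 1%R) k)%E.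
  by apply: (congr1 (fun t => t `^ 2^-1)%E); apply: eq_integral => x _; rewrite powR1 mulr1.
rewrite (N2 f) (N2 g).
under eq_integral do rewrite -(normc_conj (g _)) -Normc.normcM.
move=> /le_lt_trans; apply; apply: lte_mul_pinfty; [exact: Lpw_norm_ge0|exact: Lpw_norm_fin|exact: gy].
Qed.

Lemma innerDl f g h : L2fun f -> L2fun g -> L2fun h ->
  inner (fun x => f x + g x) h = inner f h + inner g h.
Proof.
move=> Lf Lg Lh; rewrite /inner -CintegralD; [|exact: inner_integrable|exact: inner_integrable].
by apply: eq_Cintegral => x; rewrite mulrDl.
Qed.

Lemma innerZl z f h : L2fun f -> L2fun h -> inner (fun x => z * f x) h = z * inner f h.
Proof.
move=> Lf Lh; rewrite /inner -CintegralZ.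
- by apply: eq_Cintegral => x; rewrite mulrA.
- by case: (inner_integrable Lf Lh).
- have [_] := inner_integrable (L2funZ z Lf) Lh.
  by under eq_integral do rewrite -mulrA.
Qed.

Lemma inner_conj f g : inner g f = (inner f g)^*%C.
Proof.
rewrite /inner -Cintegral_conj; apply: eq_Cintegral => x.
rewrite rmorphM /= mulrC.
exact: (congr1 (fun t => (f x)^*%C * t) (esym (conjcK _))).
Qed.

Lemma inner_norm f : L2fun f -> inner f f = (fine (L2 f) ^+ 2)%:C.
Proof.
move=> [mf fy]; rewrite /inner.
have -> : Cintegral mu (fun x => f x * (f x)^*%C) = Cintegral mu (fun x => (nc (f x) ^+ 2)%:C).
  by apply: eq_Cintegral => x; exact: conjc_mul_self.
have e : (fine (L2 f) ^+ 2)%:E = (\int[mu]_x (nc (f x) ^+ 2)%:E)%E.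
  rewrite -(powR_mulrn _ (fine_ge0 (Lpw_norm_ge0 _ _ _ _))) -poweR_EFin fineK; last first.
    by rewrite (ge0_fin_numE (Lpw_norm_ge0 _ _ _ _)).
  rewrite Lp_normX//; apply: eq_integral => x _; rewrite powR_mulrn//; exact: normc_ge0.
apply: complex_eq => /=; first by rewrite /Rintegral -e.
by rewrite /Rintegral integral0.
Qed.

End InnerProduct.

Section L2Contraction.
Local Opaque Lpw_norm inner.
Variables (R : realType) (G : topologicalGroupType).
Variable mu : {measure set (borel G) -> \bar R}.
Hypothesis H : unimodular_haar mu.
Local Notation L1 f := (Lpw_norm mu 1 (cst 1%R) f).
Local Notation L2 f := (Lpw_norm mu 2 (cst 1%R) f).

(** Here d is the L^2 norm to be bounded, n = |z|, h is the norm of the argument, F = |f|_1, and U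
    and K are the L^2 norms of f * h and f^* * f * h. *)
Let absorb (d n h F U K : R) : d ^+ 2 = n ^+ 2 * h ^+ 2 - F ^+ 2 * U ^+ 2 + K ^+ 2 ->
  K <= F * U -> 0 <= K -> 0 <= F -> 0 <= U -> 0 <= h -> 0 <= n -> d <= n * h.
Proof.
move=> E KU K0 F0 U0 h0 n0; have [d0|d0] := leP 0 d; last first.
  by rewrite (le_trans (ltW d0))// mulr_ge0.
rewrite -(@ler_pXn2r _ 2) ?nnegrE ?mulr_ge0// exprMn E.
have : K ^+ 2 <= (F * U) ^+ 2 by rewrite lerXn2r ?nnegrE ?mulr_ge0.
by rewrite exprMn; lra.
Qed.

(* With Re z = |f|_1^2 / 2 the cross term in |z h - f^* * f * h|_2^2 absorbs
   |f^* * f * h|_2^2. *)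
Lemma L2_contraction (f h : G -> R[i]) (z : R[i]) : Cmeasurable f -> (L1 f < +oo)%E ->
  complex.Re z = fine (L1 f) ^+ 2 / 2 -> L2fun mu h ->
  (L2 (fun x => z * h x - convolution mu (involution f) (convolution mu f h) x)%R <=
     (nc z)%:E * L2 h)%E.
Proof.
move=> mf fy zf Lh; have [mh hy] := Lh.
have mif := Cmeasurable_involution mf.
have ify : (L1 (involution f) = L1 f)%E by exact: (Lpw_norm_involution H 1 (weight1 R G) (fun=> erefl) mf).
set u := convolution mu f h; set k := convolution mu _ u.
have mu_ : Cmeasurable u by exact: Cmeasurable_convolution.
have mk : Cmeasurable k by exact: Cmeasurable_convolution.
have yu : (L2 u <= L1 f * L2 h)%E by exact: (young_L1 H (ltr1n R 2) mf mh fy).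
have yk : (L2 k <= L1 f * L2 u)%E by rewrite -ify; apply: (young_L1 H (ltr1n R 2) mif mu_); rewrite ify; exact: fy.
have fin (r : R) (g : G -> R[i]) : (Lpw_norm mu r (cst 1%R) g < +oo)%E ->
    Lpw_norm mu r (cst 1) g = (fine (Lpw_norm mu r (cst 1) g))%:E.
  by move=> gy; rewrite (fineK (Lpw_norm_fin gy)).
have Lu : L2fun mu u.
  split; first exact: mu_.
  by apply: (le_lt_trans yu); rewrite (fin 1 f fy) (fin 2 h hy) -EFinM; exact: ltry.
have Lk : L2fun mu k.
  split; first exact: mk.
  by apply: (le_lt_trans yk); rewrite (fin 1 f fy) (fin 2 u Lu.2) -EFinM; exact: ltry.
have Lzh := L2funZ z Lh; have Lmk := L2funZ (-1) Lk.
have Ld : L2fun mu (fun x => z * h x + (-1) * k x) by exact: L2funD.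
have -> : (fun x => z * h x - k x) = (fun x => z * h x + (-1) * k x).
  by apply/funext => x; rewrite mulN1r.
have kh : inner mu k h = inner mu u u.
  exact: (convolution_adjoint H mf mh mu_ fy hy Lu.2).
have ge0 (r : R) (g : G -> R[i]) : 0 <= fine (Lpw_norm mu r (cst 1) g).
  by apply: fine_ge0; exact: Lpw_norm_ge0.
have E : inner mu (fun x => z * h x + (-1) * k x) (fun x => z * h x + (-1) * k x) =
    z * z^*%C * inner mu h h - (z + z^*%C) * inner mu u u + inner mu k k.
  have d1 g : L2fun mu g -> inner mu (fun x => z * h x + (-1) * k x) g =
      z * inner mu h g - inner mu k g.
    by move=> Lg; rewrite (innerDl Lzh Lmk Lg) (innerZl z Lh Lg) (innerZl (-1) Lk Lg) mulN1r.
  have hk : inner mu h k = inner mu u u.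
    by rewrite inner_conj kh (inner_norm Lu) conjc_real.
  have d2 g : L2fun mu g -> inner mu g (fun x => z * h x + (-1) * k x) =
      z^*%C * inner mu g h - inner mu g k.
    have cj (a b : R[i]) : (z * a - b)^*%C = z^*%C * a^*%C - b^*%C by rewrite rmorphB rmorphM.
    by move=> Lg; rewrite inner_conj (d1 g Lg) cj -(inner_conj mu h g) -(inner_conj mu k g).
  rewrite -> (d1 _ Ld), (d2 h Lh), (d2 k Lk), hk, kh.
  by move: (inner mu h h) (inner mu u u) (inner mu k k) z^*%C => A B D z'; ring.
move: E; rewrite (inner_norm Ld) (inner_norm Lh) (inner_norm Lu) (inner_norm Lk).
move=> /(congr1 (@complex.Re R)).
rewrite conjc_mul_self !Re_addc.
have reM (a : R) (b : R[i]) : complex.Re (b * a%:C) = complex.Re b * a.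
  by rewrite Re_mulc /= mulr0 subr0.
have -> : complex.Re (- ((z + z^*%C) * (fine (L2 u) ^+ 2)%:C)) = - (fine (L1 f) ^+ 2 * fine (L2 u) ^+ 2).
  rewrite (_ : complex.Re (- _) = - complex.Re ((z + z^*%C) * (fine (L2 u) ^+ 2)%:C)); last by case: (_ * _).
  rewrite reM Re_addc (_ : complex.Re (z^*%C) = complex.Re z); last by case: (z).
  by rewrite zf; field.
rewrite reM /= => E.
have KU : fine (L2 k) <= fine (L1 f) * fine (L2 u).
  by move: yk; rewrite (fin 2 k Lk.2) (fin 1 f fy) (fin 2 u Lu.2) -EFinM lee_fin.
rewrite (fin _ _ Ld.2) (fin _ _ hy) -EFinM lee_fin.
exact: (absorb E KU (ge0 2 k) (ge0 1 f) (ge0 2 u) (ge0 2 h) (normc_ge0 z)).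
Qed.

End L2Contraction.

(** * Growth of powers *)

Section Representatives.
Local Opaque Lpw_norm.
Context {R : realType} {G : topologicalGroupType}.
Context {mu : {measure set (borel G) -> \bar R}}.
Hypothesis H : unimodular_haar mu.
Context {p q : R} {w : G -> R}.
Hypotheses (p_gt1 : 1 < p) (pq : p^-1 + q^-1 = 1) (wl : LPAlg mu q w).
Context {A : banachStarAlgType R} {cls : (G -> R[i]) -> A}.
Hypothesis HA : is_Lpw_algebra mu p w cls.
Local Notation Lp f := (Lpw mu p w f).
Implicit Types (a b : A) (f g : G -> R[i]).

Let p_gt0 : 0 < p. Proof. exact: lt_trans p_gt1. Qed.
Let ww : weight w := lpalg_weight wl.

Definition rep a : G -> R[i] := projT1 (cid2 (cls_surj HA a)).

Lemma repP a : Lp (rep a). Proof. by rewrite /rep; case: cid2. Qed.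

Lemma repK a : cls (rep a) = a. Proof. by rewrite /rep; case: cid2. Qed.

Lemma rep_cls f : Lp f -> \forall x \ae mu, rep (cls f) x = f x.
Proof. by move=> Lf; apply/(cls_eq HA (repP _) Lf); rewrite repK. Qed.

Lemma rep_add a b : \forall x \ae mu, rep (a + b) x = rep a x + rep b x.
Proof.
have [L e] := cls_add HA (repP a) (repP b).
by have := rep_cls L; rewrite e !repK.
Qed.

Lemma rep_scale z a : \forall x \ae mu, rep (z *: a) x = z * rep a x.
Proof.
have [L e] := cls_scale HA z (repP a).
by have := rep_cls L; rewrite e !repK.
Qed.

Lemma rep_mul a b f g : Lp f -> Lp g -> cls f = a -> cls g = b ->
  \forall x \ae mu, rep (bmul a b) x = convolution mu f g x.
Proof.
move=> Lf Lg <- <-; have [L e] := cls_conv HA Lf Lg.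
by have := rep_cls L; rewrite e.
Qed.

(** The norm of [A] as a real number; [|a|] itself lives in R[i]. *)
Definition nm a : R := fine (Lpw_norm mu p w (rep a)).

Lemma nmE a : Lpw_norm mu p w (rep a) = (nm a)%:E.
Proof. by rewrite /nm (fineK (Lpw_norm_fin (repP a).2)). Qed.

Lemma normr_nm a : `|a| = (nm a)%:C.
Proof. by rewrite -[in LHS](repK a) (cls_norm HA (repP a)). Qed.

Lemma nm_ge0 a : 0 <= nm a. Proof. by apply: fine_ge0; exact: Lpw_norm_ge0. Qed.

Lemma nmD a b : nm (a + b) <= nm a + nm b.
Proof. by have := ler_normD a b; rewrite !normr_nm -rmorphD lecR. Qed.

Lemma nmZ z a : nm (z *: a) = nc z * nm a.
Proof.
have := normrZ z a; rewrite !normr_nm normr_normc -rmorphM.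
exact: complexI.
Qed.

Lemma nmN a : nm (- a) = nm a.
Proof. by have := normrN a; rewrite !normr_nm; exact: complexI. Qed.

Lemma nmB a b : nm (a - b) <= nm a + nm b.
Proof. by rewrite -(nmN b) nmD. Qed.

Lemma nmM a b : nm (bmul a b) <= nm a * nm b.
Proof. by have := normr_bmul a b; rewrite !normr_nm -rmorphM lecR. Qed.

Lemma nm0 : nm 0 = 0. Proof. by have := normr0 A; rewrite normr_nm; exact: complexI. Qed.

Lemma mrep a : Cmeasurable (rep a). Proof. by case: (repP a). Qed.

End Representatives.

Section BmulLinear.
Context {R : realType} {A : banachStarAlgType R}.
Implicit Types (a b c : A).

Lemma bmul0 a : bmul a 0 = 0.
Proof. by rewrite -[X in bmul a X](scale0r (0 : A)) bmulZr scale0r. Qed.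

Lemma bmul0l a : bmul 0 a = 0.
Proof. by rewrite -[X in bmul X a](scale0r (0 : A)) bmulZl scale0r. Qed.

Lemma bmulNl a b : bmul (- a) b = - bmul a b.
Proof. by rewrite -scaleN1r bmulZl scaleN1r. Qed.

Lemma bmulNr a b : bmul a (- b) = - bmul a b.
Proof. by rewrite -scaleN1r bmulZr scaleN1r. Qed.

Lemma bmulBl a b c : bmul (a - b) c = bmul a c - bmul b c.
Proof. by rewrite bmulDl bmulNl. Qed.

Lemma bmulBr a b c : bmul a (b - c) = bmul a b - bmul a c.
Proof. by rewrite bmulDr bmulNr. Qed.

Variables (z : R[i]) (b : A).

Definition bshift (g : A) : A := z *: g - bmul b g.

(* bshift_elt n is the element f of A such that (z 1 - b)^n = z^n 1 + f. *)
Fixpoint bshift_elt n : A := if n is m.+1 then z *: bshift_elt m - iter m bshift b else 0.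

Lemma iter_bshift n g : iter n bshift g = z ^+ n *: g + bmul (bshift_elt n) g.
Proof.
elim: n g => [|n IH] g; first by rewrite expr0 scale1r bmul0l addr0.
rewrite iterSr IH /= bmulBl bmulZl IH bmulDl bmulZl /bshift.
rewrite scalerBr bmulBr bmulZr bmulA scalerA -exprSr.
by rewrite addrACA -opprD -addrA.
Qed.

Lemma bmul_iter_bshift n : bmul b (iter n bshift b) = bmul (iter n bshift b) b.
Proof.
by elim: n => //= n IH; rewrite /bshift bmulBl bmulBr bmulZl bmulZr -[bmul (bmul b _) b]bmulA -IH.
Qed.

End BmulLinear.

Section Growth.
Local Opaque Lpw_norm.
Context {R : realType} {G : topologicalGroupType}.
Context {mu : {measure set (borel G) -> \bar R}}.
Hypothesis H : unimodular_haar mu.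
Context {p q : R} {w : G -> R}.
Hypotheses (p_gt1 : 1 < p) (pq : p^-1 + q^-1 = 1) (wl : LPAlg mu q w).
Hypotheses (w_cont : continuous w) (wp : polynomial_weight w).
Context {A : banachStarAlgType R} {cls : (G -> R[i]) -> A}.
Hypothesis HA : is_Lpw_algebra mu p w cls.
Local Notation Lp f := (Lpw mu p w f).
Local Notation N r f := (Lpw_norm mu r (cst 1%R) f).
Local Notation rep := (rep HA).
Local Notation nm := (nm HA).
Variables (z : R[i]) (b : A) (y0 : R).
Hypothesis z_le : nc z <= expR y0.
Hypothesis L2_bshift : forall g : A, (N 2 (rep g) < +oo)%E ->
  (N 2 (rep (bshift z b g)) <= (expR y0)%:E * N 2 (rep g))%E.
Local Notation It n g := (iter n (bshift z b) g).
Local Notation elt n := (bshift_elt z b n).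
Local Notation T n f := (act mu (z ^+ n) (rep (elt n)) f).

Let p_gt0 : 0 < p. Proof. exact: lt_trans p_gt1. Qed.
Let ww : weight w := lpalg_weight wl.
Let w1 : weight (cst 1%R : G -> R) := weight1 R G.
Let mrep a : Cmeasurable (rep a). Proof. exact: mrep. Qed.

Lemma normcX (t : R[i]) n : nc (t ^+ n) = nc t ^+ n.
Proof. by elim: n => [|n IH]; rewrite ?expr0 ?Normc.normc1// !exprS Normc.normcM IH. Qed.

Let expRS n (x : R) : expR (n.+1%:R * x) = expR x * expR (n%:R * x).
Proof. by rewrite -expRD -natr1 mulrDl mul1r addrC. Qed.

Let mT n f : Lp f -> Cmeasurable (T n f).
Proof. by move=> [mf _]; exact: Cmeasurable_act. Qed.

Lemma rep_iter n f : Lp f -> \forall x \ae mu, rep (It n (cls f)) x = T n f x.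
Proof.
move=> Lf; rewrite iter_bshift.
have h1 := rep_add HA (z ^+ n *: cls f) (bmul (elt n) (cls f)).
have h2 := rep_scale HA (z ^+ n) (cls f).
have h3 := rep_cls HA Lf.
have h4 := rep_mul HA (repP HA (elt n)) Lf (repK HA _) erefl.
apply: aeS (aeI (aeI h1 h2) (aeI h3 h4)) => x [[e1 e2] [e3 e4]].
by rewrite /act e1 e2 e3 e4.
Qed.

Lemma N_rep_iter r n f : 0 < r -> Lp f -> N r (rep (It n (cls f))) = N r (T n f).
Proof.
by move=> r0 Lf; apply: (Lpw_norm_ae_eq r0 (mrep _) (mT n Lf) w1); exact: rep_iter.
Qed.

Lemma N_rep_cls r f : 0 < r -> Lp f -> N r (rep (cls f)) = N r f.
Proof.
by move=> r0 Lf; apply: (Lpw_norm_ae_eq r0 (mrep _) Lf.1 w1); exact: rep_cls.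
Qed.

Lemma L2_iter n (g : A) : (N 2 (rep g) < +oo)%E ->
  (N 2 (rep (It n g)) <= (expR (n%:R * y0))%:E * N 2 (rep g))%E.
Proof.
move=> gy; elim: n => [|n IH]; first by rewrite mul0r expR0 mul1e.
have Iy : (N 2 (rep (It n g)) < +oo)%E.
  apply: (le_lt_trans IH); apply: lte_mul_pinfty => //.
rewrite iterS expRS EFinM -muleA; apply: (le_trans (L2_bshift Iy)).
by apply: lee_wpmul2l => //; rewrite lee_fin expR_ge0.
Qed.

(** A rate x of (z - b)^n as operators on L^r(G), tested only on functions of L^p(G, w), which
    represent elements of the algebra. *)
Definition opbound (r x : R) := exists2 C, 0 < C & forall n f, Lp f ->
  (N r (T n f) <= (C * expR (n%:R * x))%:E * N r f)%E.

(** The iterates start at b because (z - b)^n need not belong to the algebra, whereas (z - b)^n b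
    does. *)
Definition growth (x : R) := exists2 C, 0 < C & forall n, nm (It n b) <= C * expR (n%:R * x).

Lemma opbound2 : opbound 2 y0.
Proof.
exists 1 => // n f Lf; rewrite mul1r; have two0 : 0 < 2 :> R by exact: ltr0n.
have [fy|] := ltP (N 2 f) +oo%E; last first.
  by rewrite leye_eq => /eqP ->; rewrite gt0_muley ?leey// lte_fin expR_gt0.
have fy' : (N 2 (rep (cls f)) < +oo)%E by rewrite (N_rep_cls two0 Lf).
have := L2_iter n fy'.
by rewrite (N_rep_iter n two0 Lf) (N_rep_cls two0 Lf).
Qed.

(** The recursion f_(n+1) = z f_n - (z - b)^n b has inhomogeneous term of rate x and multiplier |z|
    < e^x. The constant C / d, with d = e^x - |z|, reproduces itself: |z| C / d + C = e^x C / d. *)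
Lemma growth_elt x : y0 < x -> growth x ->
  exists2 C, 0 < C & forall n, nm (elt n) <= C * expR (n%:R * x).
Proof.
move=> yx [C C0 hC]; have ex : expR y0 < expR x by rewrite ltr_expR.
pose d := expR x - nc z; have d0 : 0 < d by rewrite subr_gt0 (le_lt_trans z_le).
exists (C / d); first exact: divr_gt0.
elim=> [|n IH]; first by rewrite /= (nm0 HA) mulr_ge0 ?expR_ge0// divr_ge0 ?ltW.
apply: (le_trans (nmB HA _ _)); rewrite (nmZ HA) expRS.
apply: (le_trans (lerD (ler_wpM2l (normc_ge0 z) IH) (hC n))).
have -> : nc z = expR x - d by rewrite /d opprB addrC subrK.
rewrite mulrA -mulrDl [leRHS]mulrA ler_wpM2r ?expR_ge0//.
by rewrite le_eqVlt; apply/orP; left; apply/eqP; field; rewrite gt_eqF.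
Qed.

Lemma act_norm_ge1 (r : R) t f g : 1 <= r -> Cmeasurable f -> Cmeasurable g ->
  (N 1 f < +oo)%E -> (N r (act mu t f g) <= ((nc t)%:E + N 1 f) * N r g)%E.
Proof.
rewrite le_eqVlt => /orP[/eqP <-|r1] mf mg fy; last exact: act_norm.
have mfg := Cmeasurable_convolution H mf mg.
apply: (le_trans (Lpw_normD mu ltr01 (lexx 1) (CmeasurableZ t mg) mfg w1)).
rewrite ge0_muleDl ?Lpw_norm_ge0 ?lee_fin ?normc_ge0//.
by rewrite (Lpw_normZ mu ltr01 t mg w1); apply: leeD => //; exact: L1_norm_convolution.
Qed.

Lemma growth_opbound r x : 1 <= r -> y0 < x -> growth x -> opbound r x.
Proof.
move=> r1 yx gx; have [C C0 hC] := growth_elt yx gx.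
have [D D0 wD] := wp; have [c c0 L1_le] := L1_norm_le p_gt1 pq wl D0 wD.
exists (1 + c * C); first by rewrite addr_gt0// mulr_gt0.
move=> n f Lf; have L1y := Lpw_L1_lty p_gt1 pq wl wp (repP HA (elt n)).
apply: (le_trans (act_norm_ge1 (z ^+ n) r1 (mrep _) Lf.1 L1y)).
apply: lee_wpmul2r; first exact: Lpw_norm_ge0.
apply: (@le_trans _ _ ((nc (z ^+ n))%:E + c%:E * (nm (elt n))%:E)%E).
  by apply: leeD => //; rewrite -nmE; exact: L1_le.
rewrite -EFinM -EFinD lee_fin mulrDl mul1r; apply: lerD.
  rewrite normcX expRM_natl; apply: lerXn2r; rewrite ?nnegrE ?normc_ge0 ?expR_ge0//.
  by rewrite (le_trans z_le)// ler_expR ltW.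
by rewrite -mulrA ler_wpM2l// ltW.
Qed.

Let expR_powR (x r : R) : expR x `^ r = expR (x * r).
Proof. by rewrite expRM. Qed.

Lemma Lp_cutoff (E : set G) f : measurable (E : set (borel G)) -> Lp f -> Lp (cutoff E f).
Proof.
move=> mE Lf; have [mf _] := Lf.
apply: (le_Lpw p_gt0 _ ww ww Lf); first exact: Cmeasurable_cutoff.
move=> x; rewrite normc_cutoff indicE; case: (x \in E); first by rewrite mul1r.
by rewrite !mul0r; apply: mulr_ge0; [exact: normc_ge0|exact: ltW (lpalg_gt0 wl x)].
Qed.

(** The coefficients of x0 and x1 are 1 - theta and theta, where 1/p = (1 - theta)/r0 + theta/r1.
    The interpolation constant does not depend on n, so it goes into the prefactor and leaves the
    rate intact. *)
Lemma opbound_interpolation r0 r1 x0 x1 : 0 < r0 -> r0 < p -> p < r1 ->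
  opbound r0 x0 -> opbound r1 x1 ->
  opbound p ((r0 * (r1 - p) * x0 + r1 * (p - r0) * x1) / (p * (r1 - r0))).
Proof.
move=> r0_gt0 r0p pr1 [C0 C0_gt0 h0] [C1 C1_gt0 h1].
have r10 : 0 < r1 - r0 by rewrite subr_gt0 (lt_trans r0p).
set x := (_ / (p * _)).
pose K := marcinkiewicz_cst r0 p r1 * (C0 `^ r0 + C1 `^ r1).
have K0 : 0 < K.
  by rewrite mulr_gt0 ?marcinkiewicz_cst_gt0// addr_gt0 ?powR_gt0.
exists (K `^ p^-1); first exact: powR_gt0.
(* The threshold s = e^(n t) gives both terms of [marcinkiewicz] the same exponential rate, namely p
   times the interpolated one. *)
move=> n f Lf; pose t := (r0 * x0 - r1 * x1) / (r1 - r0).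
have M0 : 0 < C0 * expR (n%:R * x0) by rewrite mulr_gt0 ?expR_gt0.
have M1 : 0 < C1 * expR (n%:R * x1) by rewrite mulr_gt0 ?expR_gt0.
have [mf fy] := Lf.
have LD (E : set G) : measurable (E : set (borel G)) ->
    \forall x \ae mu, T n f x = T n (cutoff E f) x + T n (cutoff (~` E) f) x.
  move=> mE; have mEc : measurable (~` E : set (borel G)) by exact: measurableC.
  have LE := Lp_cutoff mE Lf; have LEc := Lp_cutoff mEc Lf.
  have fE : f = (fun x => cutoff E f x + cutoff (~` E) f x).
    apply/funext => y; rewrite /cutoff -mulrDl !indicE in_setC.
    by case: (y \in E); rewrite /= ?(add0r, addr0) mul1r.
  have L1y := Lpw_L1_lty p_gt1 pq wl wp (repP HA (elt n)).
  have := actD_ae H p_gt1 (z ^+ n) (mrep (elt n)) LE.1 LEc.1 L1y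
    (Lpw_Lp_lty p_gt1 wl LE) (Lpw_Lp_lty p_gt1 wl LEc).
  by rewrite -fE.
have := @marcinkiewicz _ _ mu r0 p r1 r0_gt0 r0p pr1 (fun f => T n f) f _ _ _ M0 M1
  (expR_gt0 (n%:R * t)) mf (mT n Lf)
  (fun E mE => mT n (Lp_cutoff mE Lf)) LD
  (fun E mE => h0 n _ (Lp_cutoff mE Lf)) (fun E mE => h1 n _ (Lp_cutoff mE Lf)).
have -> : marcinkiewicz_cst r0 p r1 * ((C0 * expR (n%:R * x0)) `^ r0 * expR (n%:R * t) `^ (r0 - p) +
    (C1 * expR (n%:R * x1)) `^ r1 * expR (n%:R * t) `^ (r1 - p)) = K * expR (n%:R * x) `^ p.
  rewrite !powRM ?expR_ge0 ?(ltW C0_gt0) ?(ltW C1_gt0)// !expR_powR.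
  rewrite -[C0 `^ r0 * _ * _]mulrA -[C1 `^ r1 * _ * _]mulrA -!expRD.
  have e0 : n%:R * x0 * r0 + n%:R * t * (r0 - p) = n%:R * x * p.
    by rewrite /t /x; field; rewrite !gt_eqF.
  have e1 : n%:R * x1 * r1 + n%:R * t * (r1 - p) = n%:R * x * p.
    by rewrite /t /x; field; rewrite !gt_eqF.
  by rewrite e0 e1 -[(C0 `^ r0 * _ + _)]mulrDl mulrA.
move=> h; rewrite -[leLHS](poweRK (lt0r_neq0 p_gt0) (Lpw_norm_ge0 _ _ _ _)).
have -> : ((K `^ p^-1 * expR (n%:R * x))%:E * N p f =
    ((K * expR (n%:R * x) `^ p)%:E * N p f `^ p) `^ p^-1)%E.
  have Ke : 0 <= K * expR (n%:R * x) `^ p by rewrite mulr_ge0 ?powR_ge0// ltW.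
  rewrite poweRM ?lee_fin ?poweR_ge0// (poweRK (lt0r_neq0 p_gt0) (Lpw_norm_ge0 _ _ _ _)).
  rewrite poweR_EFin powRM ?powR_ge0 ?(ltW K0)// -powRrM divff ?gt_eqF// powRr1 ?expR_ge0//.
by apply: le_poweR h; [rewrite invr_ge0 ltW|exact: poweR_ge0].
Qed.

(* A power n0 absorbing the constant of opbound makes [weighted_act] a linear
   recursion for the weighted norm, driven by the unweighted one. *)
Lemma opbound_growth x x' : y0 <= x -> x < x' -> opbound p x -> growth x'.
Proof.
move=> yx xx' [C C0 hC]; pose x1 := (x + x') / 2.
have xx1 : x < x1 by rewrite /x1; lra.
have x1x' : x1 < x' by rewrite /x1; lra.
(* Then C < n0 (x1 - x) < e^(n0 (x1 - x)), so C e^(n0 x) is strictly below k = e^(n0 x1); the gap k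
   - K is the error granted to [weighted_act]. *)
pose n0 := (Num.truncn (C / (x1 - x))).+1.
have n0_gt0 : 0 < n0%:R :> R by rewrite ltr0n.
have n0C : C < expR (n0%:R * (x1 - x)).
  have h : C < n0%:R * (x1 - x) by rewrite -ltr_pdivrMr ?subr_gt0//; exact: truncnS_gt.
  by apply: (lt_trans h); apply: lt_le_trans (expR_ge1Dx _); rewrite ltrDr.
pose k := expR (n0%:R * x1); pose k' := expR (n0%:R * x').
pose K := C * expR (n0%:R * x).
have Kk : K < k.
  have -> : k = expR (n0%:R * (x1 - x)) * expR (n0%:R * x) by rewrite -expRD -mulrDr subrK.
  by rewrite ltr_pM2r ?expR_gt0.
have kk' : k < k' by rewrite ltr_expR ltr_pM2l.
have xk : expR (n0%:R * x) <= k' by rewrite ler_expR ler_pM2l// ltW.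
have k'_gt0 : 0 < k' by exact: expR_gt0.
have K0 : 0 <= K by rewrite mulr_ge0 ?expR_ge0// ltW.
have e0 : 0 < k - K by rewrite subr_gt0.
have [w' [c [d [ww' c0 w'w d0 hw']]]] := weighted_act H p_gt1 pq wl w_cont wp
  (repP HA (elt n0)) K0 (hC n0) e0.
pose Nw g := Lpw_norm mu p w' (rep g).
have Nw_le g : (Nw g <= (nm g)%:E)%E.
  rewrite -nmE; apply: (Lpw_norm_le mu p_gt0 (mrep g) (mrep g) ww' ww) => y.
  by apply: ler_wpM2l; [exact: normc_ge0|have /andP[] := w'w y].
have Nw_ge g : ((nm g)%:E <= (c^-1)%:E * Nw g)%E.
  have c'0 : 0 <= c^-1 by rewrite invr_ge0 ltW.
  rewrite -nmE /Nw -(ger0_norm c'0) -normc_real -(Lpw_normZ mu p_gt0 (c^-1)%:C (mrep g) ww').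
  apply: (Lpw_norm_le mu p_gt0 (mrep g) (CmeasurableZ _ (mrep g)) ww ww') => y.
  rewrite Normc.normcM normc_real (ger0_norm c'0) -mulrA mulrCA; apply: ler_wpM2l.
    exact: normc_ge0.
  by rewrite ler_pdivlMl//; have /andP[] := w'w y.
have Np_le g : (N p (rep g) <= (nm g)%:E)%E.
  by rewrite -nmE; exact: (Lpw_Lp_le p_gt1 wl (mrep g)).
have Nw_fin g : Nw g = (fine (Nw g))%:E.
  rewrite fineK// (ge0_fin_numE (Lpw_norm_ge0 _ _ _ _)).
  exact: le_lt_trans (Nw_le g) (ltry _).
have step g : (Nw (It n0 g) <= k%:E * Nw g + d%:E * N p (rep g))%E.
  have e : Nw (It n0 g) = Lpw_norm mu p w' (T n0 (rep g)).
    rewrite -{1}(repK HA g); apply: (Lpw_norm_ae_eq p_gt0 (mrep _) (mT n0 (repP HA g)) ww').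
    exact: rep_iter (repP HA g).
  by rewrite e; have := hw' _ (repP HA g); rewrite (addrC K) subrK.
have opN n g : (N p (rep (It n g)) <= (C * expR (n%:R * x) * nm g)%:E)%E.
  rewrite -{1}(repK HA g) (N_rep_iter n p_gt0 (repP HA g)) EFinM.
  apply: (le_trans (hC n _ (repP HA g))); apply: lee_wpmul2l (Np_le g).
  by rewrite lee_fin mulr_ge0 ?expR_ge0// ltW.
(* One step multiplies the weighted norm by k and adds at most d C k'^m times the norm of g. This
   value of [D] makes k'^m (1 + D) stable, since D (k' - k) = d C. *)
pose D := d * C / (k' - k).
have kk0 : 0 < k' - k by rewrite subr_gt0.
have D0 : 0 <= D by rewrite divr_ge0 ?mulr_ge0 ?(ltW C0)// ltW.
have iterE m g : It (n0 * m.+1) g = It n0 (It (n0 * m) g) by rewrite mulnS iterD.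
have bound m g : (Nw (It (n0 * m) g) <= (k' ^+ m * ((1 + D) * nm g))%:E)%E.
  elim: m => [|m IH].
    rewrite muln0 expr0 mul1r; apply: (le_trans (Nw_le g)).
    by rewrite lee_fin ler_peMl ?nm_ge0// lerDl.
  rewrite iterE; apply: (le_trans (step _)).
  apply: (@le_trans _ _ (k%:E * (k' ^+ m * ((1 + D) * nm g))%:E +
      d%:E * (C * k' ^+ m * nm g)%:E)%E).
    apply: leeD; first by apply: lee_wpmul2l IH; rewrite lee_fin expR_ge0.
    apply: lee_wpmul2l; first by rewrite lee_fin.
    apply: (le_trans (opN _ _)); rewrite lee_fin; apply: ler_wpM2r; first exact: nm_ge0.
    apply: ler_wpM2l; first exact: ltW.
    rewrite natrM -mulrA [_%:R * x]mulrC mulrA [(_ * x) * _]mulrC expRM_natl.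
    by apply: lerXn2r; rewrite ?nnegrE ?expR_ge0// mulrC.
  rewrite -!EFinM -EFinD lee_fin exprS.
  have -> : d * (C * k' ^+ m * nm g) = k' ^+ m * nm g * (D * (k' - k)).
    by rewrite /D divfK ?gt_eqF//; ring.
  have X0 : 0 <= k' ^+ m * nm g by rewrite mulr_ge0 ?nm_ge0 ?exprn_ge0 ?ltW.
  have kX : k * (k' ^+ m * nm g) <= k' * (k' ^+ m * nm g) by rewrite ler_wpM2r// ltW.
  rewrite (_ : k * (k' ^+ m * _) + _ = k * (k' ^+ m * nm g) + k' * (D * (k' ^+ m * nm g))); last by ring.
  by rewrite (_ : k' * k' ^+ m * _ = k' * (k' ^+ m * nm g) + k' * (D * (k' ^+ m * nm g))) ?lerD2r//; ring.
pose B := \sum_(j < n0) nm (It j b).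
have B0 : 0 <= B by apply: sumr_ge0 => j _; exact: nm_ge0.
have Bj j : (j < n0)%N -> nm (It j b) <= B.
  move=> jn; rewrite /B (bigD1 (Ordinal jn))//= lerDl.
  by apply: sumr_ge0 => i _; exact: nm_ge0.
(* Writing n = n0 m + j with j < n0, [B] dominates the first j iterates, and the last factor
   compensates e^(j x'), which is small when x' is negative. *)
exists ((c^-1 * ((1 + D) * B) + 1) * expR (n0%:R * `|x'|)).
  rewrite mulr_gt0 ?expR_gt0// ltr_wpDl// !mulr_ge0// ?invr_ge0 ?(ltW c0)//.
  by rewrite addr_ge0.
move=> n; rewrite (divn_eq n n0) mulnC iterD.
set m := (n %/ n0)%N; set j := (n %% n0)%N; have jn : (j < n0)%N by rewrite ltn_mod.
have h : nm (It (n0 * m) (It j b)) <= c^-1 * (k' ^+ m * ((1 + D) * B)).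
  rewrite -lee_fin; apply: (le_trans (Nw_ge _)); rewrite EFinM; apply: lee_wpmul2l.
    by rewrite lee_fin invr_ge0 ltW.
  apply: (le_trans (bound m _)); rewrite lee_fin; apply: ler_wpM2l.
    by rewrite exprn_ge0// ltW.
  by apply: ler_wpM2l; [rewrite addr_ge0|exact: Bj].
apply: (le_trans h).
have kE : k' ^+ m = expR ((n0 * m)%:R * x').
  by rewrite /k' -expRM_natl natrM mulrA [m%:R * _]mulrC.
rewrite natrD [(_ + _) * x']mulrDl expRD -kE.
have hj : 1 <= expR (n0%:R * `|x'|) * expR (j%:R * x').
  rewrite -expRD -[leLHS]expR0 ler_expR.
  have h1 : j%:R * `|x'| <= n0%:R * `|x'| by rewrite ler_wpM2r// ler_nat ltnW.
  have h2 : - `|x'| <= x' by rewrite lerNl ler_normr lexx orbT.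
  have h3 := ler_wpM2l (ler0n R j) h2.
  by rewrite mulrN in h3; lra.
have km0 : 0 <= k' ^+ m by rewrite exprn_ge0// ltW.
have Q0 : 0 <= c^-1 * ((1 + D) * B).
  by rewrite !mulr_ge0 ?invr_ge0 ?(ltW c0)// addr_ge0.
rewrite [leLHS](_ : _ = k' ^+ m * (c^-1 * ((1 + D) * B))); last by rewrite mulrCA.
move: Q0; move: (c^-1 * ((1 + D) * B)) => Q Q0.
apply: (@le_trans _ _ (k' ^+ m * (Q + 1))); first by rewrite ler_wpM2l// lerDl.
rewrite (_ : (Q + 1) * _ * _ = k' ^+ m * (Q + 1) * (expR (n0%:R * `|x'|) * expR (j%:R * x'))); last by ring.
by rewrite ler_peMr// mulr_ge0// addr_ge0.
Qed.

(** L^p lies between L^1 and L^2 when p < 2, and between L^2 and L^(2p) when p > 2. The weight of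
    the L^2 rate is then 2 (p - 1) / p, respectively 1 / (p - 1), and depends on p alone. *)
Lemma growth_opbound_interp : exists2 t, 0 < t <= 1 &
  forall x, y0 < x -> growth x -> opbound p ((1 - t) * x + t * y0).
Proof.
have [p2|p2|p2] := ltgtP p 2.
- exists (2 * (p - 1) / p).
    by rewrite divr_gt0 ?mulr_gt0 ?subr_gt0//= ler_pdivrMr// mul1r; lra.
  move=> x yx gx; have h1 := growth_opbound (lexx 1) yx gx.
  have := opbound_interpolation ltr01 p_gt1 p2 h1 opbound2.
  congr opbound; field; rewrite gt_eqF//=.
- exists (p - 1)^-1.
    by rewrite invr_gt0 subr_gt0 p_gt1/= invf_le1 ?subr_gt0//; lra.
  move=> x yx gx; have p21 : 1 <= 2 * p by lra.
  have p2p : p < 2 * p by lra.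
  have := opbound_interpolation (ltr0n R 2) p2 p2p opbound2 (growth_opbound p21 yx gx).
  congr opbound; field; rewrite !gt_eqF//= ?mulr_gt0 ?subr_gt0//; lra.
- exists 1; first by rewrite ltr01 lexx.
  by move=> x _ _; rewrite subrr mul0r add0r mul1r p2; exact: opbound2.
Qed.

Lemma growth_initial x : expR x >= nc z + nm b -> growth x.
Proof.
move=> xz; exists (nm b + 1); first by rewrite ltr_wpDl// nm_ge0.
elim=> [|n IH]; first by rewrite mul0r expR0 mulr1 lerDl.
rewrite iterS expRS; apply: (le_trans (nmB HA _ _)); rewrite (nmZ HA).
apply: (le_trans (lerD (lexx _) (nmM HA _ _))); rewrite -mulrDl mulrCA.
by apply: ler_pM => //; rewrite ?nm_ge0// addr_ge0 ?normc_ge0 ?nm_ge0.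
Qed.

Lemma growth_weaken x x' : x <= x' -> growth x -> growth x'.
Proof.
move=> xx' [C C0 h]; exists C => // n; apply: (le_trans (h n)).
by rewrite ler_wpM2l ?(ltW C0)// ler_expR ler_wpM2l.
Qed.

(* Interpolation followed by [opbound_growth] contracts the distance of the
   exponent to y0 by a fixed factor. *)
Lemma growth_spectral x : y0 < x -> growth x.
Proof.
move=> yx; have [t /andP[t0 t1] interp] := growth_opbound_interp.
pose E := nc z + nm b + 1.
have E0 : 0 < E by rewrite ltr_wpDl// addr_ge0 ?normc_ge0 ?nm_ge0.
pose s := `|ln E - y0| + 1; have s0 : 0 < s by rewrite ltr_wpDl.
(* Interpolation takes y0 + r to y0 + (1 - t) r. The strictly larger y0 + (1 - t/2) r leaves the
   room that [opbound_growth] needs to return to the weighted norm. *)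
have contract k : growth (y0 + (1 - t / 2) ^+ k * s).
  have c0 : 0 < 1 - t / 2 by lra.
  elim: k => [|k IH].
    rewrite expr0 mul1r; apply: growth_initial; apply: (@le_trans _ _ E).
      by rewrite /E lerDl.
    rewrite -[leLHS](lnK E0) ler_expR /s.
    by have := ler_norm (ln E - y0); lra.
  have sk : 0 < (1 - t / 2) ^+ k * s by rewrite mulr_gt0 ?exprn_gt0.
  rewrite exprS -mulrA; move: sk IH; move: ((1 - t / 2) ^+ k * s) => r r0 IH.
  have yr : y0 < y0 + r by rewrite ltrDl.
  have := interp _ yr IH; apply: opbound_growth; nra.
have : (1 - t / 2) ^+ k * s @[k --> \oo] --> 0 * s.
  apply: cvgM; last exact: cvg_cst.
  by apply: cvg_expr; rewrite ger0_norm; lra.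
rewrite mul0r => /cvgr_lt /(_ (x - y0)); rewrite subr_gt0 => /(_ yx) [k _ /(_ k (leqnn k)) kx].
by apply: growth_weaken (contract k); rewrite -lerBrDl ltW.
Qed.

End Growth.

(** * Symmetry *)

Section GeometricLimit.
Context {R : realType} {V : completeNormedModType R[i]}.

Lemma pow_lt_eventually (C k e : R) : 0 <= k -> k < 1 -> 0 < e -> exists n, C * k ^+ n < e.
Proof.
move=> k0 k1 e0; have : C * k ^+ n @[n --> \oo] --> C * 0.
  by apply: cvgM; [exact: cvg_cst|apply: cvg_expr; rewrite ger0_norm].
rewrite mulr0 => /cvgr_lt /(_ _ e0) [n _ /(_ n (leqnn n)) h].
by exists n.
Qed.

Lemma gt0_complex (e : R[i]) : 0 < e -> exists2 r : R, 0 < r & e = r%:C.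
Proof.
move=> e0; have er : e = (complex.Re e)%:C by rewrite RRe_real// gtr0_real.
by exists (complex.Re e) => //; rewrite -ltcR -er.
Qed.

Lemma eq0_of_geometric (x : V) (C k : R) : 0 <= k -> k < 1 ->
  (forall n, `|x| <= (C * k ^+ n)%:C) -> x = 0.
Proof.
move=> k0 k1 h; apply/eqP; rewrite -normr_le0; apply: contraT => nx.
have x0 : 0 < `|x| by rewrite lt0r normr_ge0 andbT; apply: contra nx => /eqP ->.
have [r r0 xr] := gt0_complex x0.
have [n] := pow_lt_eventually C k0 k1 r0.
by have := h n; rewrite xr lecR => /le_lt_trans /[apply]; rewrite ltxx.
Qed.

Lemma geometric_limit (u : nat -> V) (C k : R) : 0 <= C -> 0 <= k -> k < 1 ->
  (forall n, `|u n.+1 - u n| <= (C * k ^+ n)%:C) ->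
  exists l, forall n, `|l - u n| <= (C / (1 - k) * k ^+ n)%:C.
Proof.
move=> C0 k0 k1 hu; have k1' : 0 < 1 - k by rewrite subr_gt0.
have tail n m : `|u (n + m)%N - u n| <= (C / (1 - k) * k ^+ n * (1 - k ^+ m))%:C.
  elim: m => [|m IH]; first by rewrite addn0 subrr normr0 expr0 subrr mulr0.
  rewrite -(subrKA (u (n + m)%N)) addnS (le_trans (ler_normD _ _))//.
  rewrite (le_trans (lerD (hu _) IH))// -rmorphD lecR exprD exprS.
  by rewrite le_eqVlt; apply/orP; left; apply/eqP; field; rewrite gt_eqF.
have {}tail n m : (n <= m)%N -> `|u m - u n| <= (C / (1 - k) * k ^+ n)%:C.
  move=> nm; rewrite -(subnKC nm) (le_trans (tail _ _))// lecR ler_piMr//.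
    by rewrite mulr_ge0 ?exprn_ge0// divr_ge0// ltW.
  by rewrite gerBl exprn_ge0.
have : cauchy (u n @[n --> \oo]).
  apply: cauchy_exP => e /gt0_complex [r r0 ->].
  have [n nr] := pow_lt_eventually (C / (1 - k)) k0 k1 r0.
  exists (u n); exists n => // m /= nm; rewrite -ball_normE /= distrC.
  by rewrite (le_lt_trans (tail n m nm))// ltcR.
move=> /cauchy_cvg /cvg_ex [l ul]; exists l => n.
apply/ler_addgt0Pr => e e0.
have [N _ hN] : \forall m \near \oo, `|l - u m| < e by exact: cvgr_dist_lt.
have := hN (maxn N n) (leq_maxl _ _) => /= lN.
rewrite -(subrKA (u (maxn N n))) addrC (le_trans (ler_normD _ _))//.
apply: lerD; last exact: ltW.
by apply: tail; exact: leq_maxr.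
Qed.

End GeometricLimit.

Section Resolvent.
Context {R : realType} {A : banachStarAlgType R}.

(** In the unitization the inverse of t - b is t^-1 + t^-1 (t - b)^-1 b, and y is its second term.
    With s = z - t one has t - b = (z - b) - s, whose Neumann series multiplied by b is the limit of
    the partial sums [u]; after n terms the error is t^-1 s^-n (z - b)^n b, which decays
    geometrically. *)
Lemma resolvent (b : A) (z t : R[i]) (C r : R) : t != 0 -> 0 <= C -> 0 <= r -> r < nc (z - t) ->
  (forall n, `|iter n (bshift z b) b| <= (C * r ^+ n)%:C) ->
  exists y, t *: y - bmul b y = t^-1 *: b /\ bmul b y = bmul y b.
Proof.
move=> t0 C0 r0 rz hI; set I := fun n => iter n (bshift z b) b.
pose s := z - t; pose m := nc s; have m0 : 0 < m by exact: le_lt_trans rz.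
have s0 : s != 0 by apply: contraTneq m0 => s0; rewrite /m s0 Normc.normc0 ltxx.
pose k := r / m; have k0 : 0 <= k by rewrite divr_ge0// ltW.
have k1 : k < 1 by rewrite ltr_pdivrMr// mul1r.
have ns n : `|s ^- n| = (m ^- n)%:C.
  by rewrite normrV ?unitfE ?expf_neq0// normrX normr_normc -/m rmorphV ?rmorphXn// unitfE expf_neq0// gt_eqF.
have normI n : `|s ^- n *: I n| <= (C * k ^+ n)%:C.
  rewrite normrZ ns (le_trans (ler_wpM2l _ (hI n)))//.
    by rewrite lecR invr_ge0 exprn_ge0// ltW.
  rewrite -rmorphM lecR /k expr_div_n le_eqVlt; apply/orP; left; apply/eqP.
  by rewrite mulrC mulrA.
pose u n : A := - t^-1 *: \sum_(i < n) s ^- i.+1 *: I i.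
pose C' := nc t^-1 * (C / m).
have C'0 : 0 <= C' by rewrite mulr_ge0 ?normc_ge0// divr_ge0// ltW.
have hu n : `|u n.+1 - u n| <= (C' * k ^+ n)%:C.
  have -> : u n.+1 - u n = (- t^-1 * s^-1) *: (s ^- n *: I n).
    rewrite /u big_ord_recr /= scalerDr addrAC subrr add0r -!scalerA; congr (_ *: _).
    by rewrite scalerA exprS invfM.
  rewrite normrZ normrM normrN (normr_normc t^-1).
  have := ns 1%N; rewrite expr1 => ->.
  rewrite (le_trans (ler_wpM2l _ (normI n)))//.
    by rewrite -rmorphM lecR mulr_ge0 ?normc_ge0// invr_ge0 ltW.
  rewrite -!rmorphM lecR /C' le_eqVlt; apply/orP; left; apply/eqP.
  by rewrite expr1; ring.
have [y hy] := geometric_limit C'0 k0 k1 hu.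
have [K bK] : exists K : R, `|b| = K%:C.
  by exists (complex.Re `|b|); rewrite RRe_real// ger0_real.
have K0 : 0 <= K by have := normr_ge0 b; rewrite bK lecR.
have ub n : bmul b (u n) = bmul (u n) b.
  rewrite /u bmulZr bmulZl; congr (_ *: _).
  elim: n => [|n IH]; first by rewrite big_ord0 bmul0 bmul0l.
  by rewrite big_ord_recr /= bmulDr bmulDl IH bmulZr bmulZl bmul_iter_bshift.
pose T g := t *: g - bmul b g.
have TB g h : T (g - h) = T g - T h.
  by rewrite /T scalerBr bmulBr !opprB addrACA [RHS]addrACA [- (bmul b g) + _]addrC.
have TZ c g : T (c *: g) = c *: T g.
  by rewrite /T bmulZr scalerBr !scalerA mulrC.
have TI n : T (I n) = I n.+1 - s *: I n.
  rewrite /I /= -/(I n) /bshift /T /s scalerBl opprB.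
  by rewrite [RHS]addrC addrA subrK.
have tu n : T (u n) = t^-1 *: b - t^-1 *: (s ^- n *: I n).
  elim: n => [|n IH].
    by rewrite /u big_ord0 scaler0 /T scaler0 bmul0 expr0 invr1 scale1r !subrr.
  have -> : u n.+1 = u n - (t^-1 * s ^- n.+1) *: I n.
    by rewrite -scaleNr -mulNr -scalerA /u big_ord_recr scalerDr.
  rewrite TB IH TZ TI scalerBr !scalerA opprB -[t^-1 * _ * s]mulrA.
  have -> : s ^- n.+1 * s = s ^- n by rewrite exprS invfM mulrAC mulVf// mul1r.
  by rewrite addrA subrK.
exists y; split.
  apply/eqP; rewrite -subr_eq0; apply/eqP.
  apply: (@eq0_of_geometric _ _ _ ((nc t + K) * (C' / (1 - k)) + nc t^-1 * C) k) => // n.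
  have -> : t *: y - bmul b y - t^-1 *: b = T (y - u n) - t^-1 *: (s ^- n *: I n).
    by rewrite TB tu -/(T y) opprB [in RHS]addrA [RHS]addrAC addrK.
  have hT : `|T (y - u n)| <= ((nc t + K) * (C' / (1 - k) * k ^+ n))%:C.
    rewrite /T (le_trans (ler_normB _ _))// normrZ normr_normc.
    rewrite (le_trans (lerD (lexx _) (normr_bmul _ _)))// bK -mulrDl -rmorphD.
    rewrite (le_trans (ler_wpM2l _ (hy n))) ?rmorphM//.
    by rewrite lecR addr_ge0// normc_ge0.
  have hI' : `|t^-1 *: (s ^- n *: I n)| <= (nc t^-1 * (C * k ^+ n))%:C.
    rewrite normrZ normr_normc (le_trans (ler_wpM2l _ (normI n))) ?rmorphM//.
    by rewrite lecR normc_ge0.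
  rewrite (le_trans (ler_normB _ _))// (le_trans (lerD hT hI'))// -rmorphD lecR.
  by rewrite [leRHS]mulrDl !mulrA.
apply/eqP; rewrite -subr_eq0; apply/eqP.
apply: (@eq0_of_geometric _ _ _ (2 * K * (C' / (1 - k))) k) => // n.
have -> : bmul b y - bmul y b = bmul b (y - u n) - bmul (y - u n) b.
  by rewrite bmulBr bmulBl ub opprB [RHS]addrA subrK.
rewrite (le_trans (ler_normB _ _))// (le_trans (lerD (normr_bmul _ _) (normr_bmul _ _)))//.
rewrite bK [`|y - _| * _]mulrC -mulrDl -rmorphD (le_trans (ler_wpM2l _ (hy n)))//.
  by rewrite lecR addr_ge0.
rewrite -rmorphM lecR le_eqVlt; apply/orP; left; apply/eqP.
by rewrite mulrA; congr (_ * _); ring.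
Qed.

End Resolvent.

Section Symmetry.
Context {R : realType} {G : topologicalGroupType}.
Context {mu : {measure set (borel G) -> \bar R}}.
Hypothesis H : unimodular_haar mu.
Context {p q : R} {w : G -> R}.
Hypotheses (p_gt1 : 1 < p) (pq : p^-1 + q^-1 = 1) (wl : LPAlg mu q w).
Hypotheses (w_cont : continuous w) (wp : polynomial_weight w).
Context {A : banachStarAlgType R} {cls : (G -> R[i]) -> A}.
Hypothesis HA : is_Lpw_algebra mu p w cls.
Local Notation N r f := (Lpw_norm mu r (cst 1%R) f).
Local Notation rep := (rep HA).

Local Opaque Lpw_norm.

Lemma rep_bshift_star (z : R[i]) a g : \forall x \ae mu,
  rep (bshift z (bmul (bstar a) a) g) x =
  z * rep g x - convolution mu (involution (rep a)) (convolution mu (rep a) (rep g)) x.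
Proof.
have -> : bshift z (bmul (bstar a) a) g = z *: g + (-1) *: bmul (bstar a) (bmul a g).
  by rewrite /bshift -bmulA scaleN1r.
have h1 := rep_add HA (z *: g) ((-1) *: bmul (bstar a) (bmul a g)).
have h2 := rep_scale HA z g.
have h3 := rep_scale HA (-1) (bmul (bstar a) (bmul a g)).
have [Ls es] := cls_star HA (repP HA a).
have [Lc ec] := cls_conv HA (repP HA a) (repP HA g).
rewrite (repK HA) in es; rewrite !(repK HA) in ec.
have h4 := rep_mul HA Ls Lc es ec.
apply: aeS (aeI (aeI h1 h2) (aeI h3 h4)) => x [[e1 e2] [e3 e4]].
by rewrite e1 e2 e3 e4 mulN1r.
Qed.

(* A disc about a suitable centre [c / 2 + i s] which has [0] on its boundary
   contains [[0, c]] but not [t]. *)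
Lemma separating_center (c : R) (t : R[i]) : 0 <= c -> ~~ (0 <= t) ->
  exists2 z : R[i], complex.Re z = c / 2 & nc z < nc (z - t).
Proof.
move=> c0; case: t => [u v]; rewrite lecE /= negb_and => tn.
(* The centre is moved vertically away from t until 2 m v^2 = |c u| absorbs the term - c u. If v =
   0, the quotient is 0 by convention and u < 0 makes u^2 - c u positive. *)
pose m := `|c * u| / (2 * v ^+ 2).
exists ((c / 2) +i* (- m * v)) => //.
rewrite /=.
suff key : (c / 2) ^+ 2 + (- m * v) ^+ 2 < (c / 2 - u) ^+ 2 + (- m * v - v) ^+ 2.
  by rewrite ltr_sqrt//; apply: le_lt_trans key; rewrite addr_ge0 ?sqr_ge0.
rewrite -subr_gt0.
have -> : (c / 2 - u) ^+ 2 + (- m * v - v) ^+ 2 - ((c / 2) ^+ 2 + (- m * v) ^+ 2) =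
  u ^+ 2 + v ^+ 2 + (2 * m * v ^+ 2 - c * u) by field.
have [v0|v0] := eqVneq v 0.
  move: tn; rewrite v0 eqxx /= -ltNge => u0.
  by rewrite expr0n /= mulr0; nra.
have -> : 2 * m * v ^+ 2 = `|c * u| by rewrite /m; field.
have v2 : 0 < v ^+ 2 by rewrite exprn_even_gt0.
by have := ler_norm (c * u); have := sqr_ge0 u; lra.
Qed.

Lemma bshift_geometric a (z t : R[i]) :
    complex.Re z = fine (N 1 (rep a)) ^+ 2 / 2 -> nc z < nc (z - t) ->
  exists C r : R, [/\ 0 <= C, 0 <= r, r < nc (z - t) &
    forall n, `|iter n (bshift z (bmul (bstar a) a)) (bmul (bstar a) a)| <= (C * r ^+ n)%:C].
Proof.
move=> zE zt; set b := bmul (bstar a) a.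
have nz := normc_ge0 z.
(* Two strict steps are needed between |z| and |z - t|. The L^2 rate is taken as ln r0, since |z|
   may vanish, and [growth_spectral] reaches only rates strictly above it, such as ln r. *)
pose r0 := (nc z + nc (z - t)) / 2; pose r := (r0 + nc (z - t)) / 2.
have zr0 : nc z < r0 by rewrite /r0; lra.
have r0r : r0 < r by rewrite /r /r0; lra.
have rt : r < nc (z - t) by rewrite /r /r0; lra.
have r00 : 0 < r0 by lra.
have r_gt0 : 0 < r by lra.
have z_le : nc z <= expR (ln r0) by rewrite lnK ?ltW.
have a1 : (N 1 (rep a) < +oo)%E by exact: (Lpw_L1_lty p_gt1 pq wl wp (repP HA a)).
have L2_bshift g : (N 2 (rep g) < +oo)%E ->
    (N 2 (rep (bshift z b g)) <= (expR (ln r0))%:E * N 2 (rep g))%E.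
  move=> g2; have Lg : L2fun mu (rep g) by split => //; exact: mrep.
  have mg := mrep HA g; have mc := Cmeasurable_convolution H (mrep HA a) mg.
  have mk := Cmeasurable_convolution H (Cmeasurable_involution (mrep HA a)) mc.
  have mzg := CmeasurableB (CmeasurableZ z mg) mk.
  have e : N 2 (rep (bshift z b g)) =
      N 2 (fun x => z * rep g x - convolution mu (involution (rep a)) (convolution mu (rep a) (rep g)) x).
    exact: (Lpw_norm_ae_eq (ltr0n R 2) (mrep HA (bshift z b g)) mzg (weight1 R G) (rep_bshift_star z a g)).
  rewrite -> e.
  apply: (le_trans (L2_contraction H (mrep HA a) a1 zE Lg)).
  apply: lee_wpmul2r; first exact: Lpw_norm_ge0.
  by rewrite lee_fin.
have yx : ln r0 < ln r by rewrite ltr_ln.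
have [C C0 hC] := growth_spectral H p_gt1 pq wl w_cont wp z_le L2_bshift yx.
exists C, r; split => //; [exact: ltW|exact: ltW|move=> n].
rewrite (normr_nm HA) lecR (le_trans (hC n))//.
by rewrite expRM_natl lnK.
Qed.

Lemma symmetric_Lpw_algebra : symmetric_algebra A.
Proof.
move=> a t /= ht; apply: contrapT => /negP tn.
have [z zE zt] := separating_center (sqr_ge0 (fine (N 1 (rep a)))) tn.
have [C [r [C0 r0 rt hI]]] := bshift_geometric zE zt.
have t0 : t != 0 by apply: contraNneq tn => ->.
have [y [ey cy]] := resolvent t0 C0 r0 rt hI.
set b := bmul (bstar a) a in ht ey cy.
have ey' : t *: y - bmul y b = t^-1 *: b by rewrite -cy.
(* In both cases the inverse of t - b is t^-1 1 + y, where 1 is the unit of the algebra or the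
   adjoined one. *)
case: ht => [[e he]|[_]]; apply.
  have e1 x : bmul e x = x by case: (he x).
  have e2 x : bmul x e = x by case: (he x).
  exists (t^-1 *: e + y); split.
    rewrite bmulDr bmulZr !bmulBl !bmulZl !e1 !e2 scalerBr scalerA mulVf// scale1r.
    by rewrite ey subrK.
  rewrite bmulDl bmulZl !bmulBr !bmulZr !e1 !e2 scalerBr scalerA mulVf// scale1r.
  by rewrite ey' subrK.
exists (y, t^-1); rewrite /umul /=; split; congr (_, _).
- by rewrite bmulNl scalerN [- _ + _]addrC ey subrr.
- by rewrite mulfV.
- by rewrite bmulNr scalerN addrAC [- _ + _]addrC ey' subrr.
- by rewrite mulVf.
Qed.

End Symmetry.

Theorem theorem3p9 (R : realType) (G : topologicalGroupType)
    (mu : {measure set (borel G) -> \bar R}) (p q : R) (w : G -> R)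
    (G_lc : locally_compact_group G)
    (G_cg : compactly_generated G)
    (mu_haar : left_haar mu)
    (G_pg : polynomial_growth mu)
    (p_gt1 : 1 < p)
    (pq : p^-1 + q^-1 = 1)
    (w_cont : continuous w)
    (w_lpalg : LPAlg mu q w)
    (w_poly : polynomial_weight w) :
  exists (A : banachStarAlgType R) (cls : (G -> complex R) -> A),
    is_Lpw_algebra mu p w cls /\ symmetric_algebra A.
Proof.
have H := left_haar_unimodular G_lc G_cg mu_haar G_pg.
pose S := LpSetting H p_gt1 pq w_lpalg.
have HS : is_Lpw_algebra mu p w (@lp_cls _ _ S) := lp_space_is_Lpw_algebra S.
exists (lp_space S), (@lp_cls _ _ S); split; first exact: HS.
exact: (symmetric_Lpw_algebra H p_gt1 pq w_lpalg w_cont w_poly HS).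
Qed.
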